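(* Let $T>0$, $\alpha\in[0,1)$ and $0<\rho<2$. Given $(u^0,u^1)\in X_N^2\times X_N^0$, there exists $g\in L^2(0,T)$ such that the weak solution $u$ (in the sense defined in the context) of $$u_{tt}+A_N^2u+\rho\tilde A_N^{\alpha}u_t=0,\quad u_x(0,t)=u_x(\pi,t)=0,\quad u_{xxx}(0,t)=0,\quad u_{xxx}(\pi,t)=g(t),$$ $$u(x,0)=u^0(x),\quad u_t(x,0)=u^1(x)$$ on $(0,\pi)\times(0,T)$ satisfies $u(\cdot,T)=u_t(\cdot,T)=0$, and there exists a constant $C$ depending only on $\alpha,\rho,T$ such that $g$ can be chosen with $$\|g\|_{L^2(0,T)}\le C\big(\|u^0\|_{X_N^2}+\|u^1\|_{X_N^0}\big).$$
   Context: $A_N=-\partial_x^2$ is the Neumann Laplacian on $(0,\pi)$, with eigenvalues $n^2$, $n\ge0$, and orthonormal eigenfunctions $\varphi_0=1/\sqrt\pi$, $\varphi_n=\sqrt{2/\pi}\cos(nx)$ for $n\ge1$. For $p\in\mathbb R$, $X_N^p$ is the space of (generalized) series $v=\sum_{n\ge0}a_n\varphi_n$ with $\|v\|_{X_N^p}^2=|a_0|^2+\sum_{n\ge1}n^{2p}|a_n|^2<\infty$. The operators $A_N^\alpha$ act by $A_N^\alpha\sum a_n\varphi_n=\sum n^{2\alpha}a_n\varphi_n$ (with $A_N^0$ the identity, i.e. $0^0=1$). The symbol $\langle\cdot,\cdot\rangle$ is the duality pairing of $X_N^p$ and $X_N^{-p}$: $\langle\sum a_n\varphi_n,\sum b_n\varphi_n\rangle=\sum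 a_nb_n$. For $\alpha\in(0,1)$ the extended operator is $\tilde A_N^{\alpha}v(x)=\mathrm{PV}\int_0^\pi(v(x)-v(y))J_N(x,y)\,dy$, where $J_N(x,y)=\frac{\alpha}{\Gamma(1-\alpha)}\int_0^\infty p_N(t,x,y)t^{-\alpha-1}dt$ and $p_N$ is the heat kernel of $A_N$; for $\alpha=0$ it is the identity. The initial boundary value problem is formal; its precise meaning is the following weak formulation. Adjoint solutions. For $\tau\in(0,T]$ and $w^0=\sum w_n^0\varphi_n\in X_N^0$, $w^1=\sum w_n^1\varphi_n\in X_N^{-2}$, let $w(x,t)=\sum_{n\ge0}w_n(t)\varphi_n(x)$, $t\in[0,\tau]$, where $w_n''-\rho n^{2\alpha}w_n'+n^4w_n=0$, $w_n(\tau)=w_n^0$, $w_n'(\tau)=w_n^1$. The trace $w(\pi,t)=\sum\varphi_n(\pi)w_n(t)$ is understood as a limit in $L^2(0,\tau)$ of partial sums. Weak solution: $u\in C([0,T];X_N^2)\cap C^1([0,T];X_N^0)$ with $u(\cdot,0)=u^0$, $u_t(\cdot,0)=u^1$, such that for every $\tau\in(0,T]$ and all $(w^0,w^1)\in X_N^0\times X_N^{-2}$, $$0=\langle w^1-\rho A_N^\alpha w^0,u(\cdot,\tau)\rangle-\langle w^0,u_t(\cdot,\tau)\rangle-\langle w_t(\cdot,0)-\rho A_N^\alpha w(\cdot,0),u^0\rangle+\langle w(\cdot,0),u^1\rangle-\int_0^\tau w(\pi,t)g(t)\,dt .$$ For given $u^0,u^1,g$ the weak solution is unique. *)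

(* Defs.v *)
From HB Require Import structures.
From mathcomp Require Import all_boot all_order all_algebra.
From mathcomp Require Import all_classical all_reals all_analysis.

Set Implicit Arguments.
Unset Strict Implicit.
Unset Printing Implicit Defensive.

Import Order.TTheory GRing.Theory Num.Theory.
Import numFieldNormedType.Exports.

Local Open Scope classical_set_scope.
Local Open Scope ring_scope.

(* A generalized series v = sum_n a_n phi_n is represented by its sequence of
   coefficients a : nat -> R, and a time-dependent one by a map
   u : R -> nat -> R, where u t n is the n-th coefficient of u(., t).
   Only the values of u at times in the relevant interval are meaningful. *)

Section SpectralScale.
Context {R : realType}.
Implicit Types (a b : nat -> R) (u v : R -> nat -> R).

Definition phiN (n : nat) (x : R) : R :=
  if n == 0%N then (Num.sqrt pi)^-1 else Num.sqrt (2 / pi) * cos (n%:R * x).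

(* The norm of X_N^p takes its values in [0, +oo]. *)
Definition Xnorm (p : R) a : \bar R :=
  ((`|a 0%N| ^+ 2)%:E
    + \sum_(1 <= n <oo) (n%:R `^ (2 * p) * `|a n| ^+ 2)%:E)%E `^ 2^-1.

Definition inX (p : R) a : Prop := (Xnorm p a < +oo)%E.

(* Since 0 `^ 0 = 1, AN 0 is the identity. *)
Definition AN (alpha : R) a : nat -> R := fun n => n%:R `^ (2 * alpha) * a n.

(* Convergent whenever a lies in X_N^p and b in X_N^(-p) for some p. *)
Definition pairing a b : R := limn (series (fun n => a n * b n)).

Definition Xcontinuous (p : R) (D : set R) u : Prop :=
  (forall t, D t -> inX p (u t)) /\
  (forall s, D s ->
    Xnorm p (fun n => u t n - u s n) @[t --> within D (nbhs s)] --> 0%E).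

(* v is the derivative of u with respect to the norm of X_N^p, one-sided at
   the endpoints when D is a closed interval. *)
Definition Xderivative (p : R) (D : set R) u v : Prop :=
  forall s, D s ->
    Xnorm p (fun n => (u t n - u s n) / (t - s) - v s n)
      @[t --> within D s^'] --> 0%E.

(* The norm of L^2(0, T), with values in [0, +oo]. *)
Definition L2norm (T : R) (f : R -> R) : \bar R :=
  ('N[lebesgue_measure]_2%:E [EFin \o (f \_ `]0, T[)%R])%E.

Definition inL2 (T : R) (f : R -> R) : Prop :=
  measurable_fun `]0, T[ f /\ (L2norm T f < +oo)%E.

(* dw stands for the time derivative of w; both are continuous up to the
   endpoints, so that the terminal values, and w, dw at time 0, make sense. *)
Definition adjoint_solution (alpha rho tau : R) (w0 w1 : nat -> R)
    (w dw : R -> nat -> R) : Prop :=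
  forall n,
    [/\ {within `[0, tau], continuous (fun t => w t n)},
        {within `[0, tau], continuous (fun t => dw t n)},
        forall t : R, t \in `]0, tau[ -> is_derive t 1 (fun s => w s n) (dw t n),
        forall t : R, t \in `]0, tau[ ->
          exists ddw : R, is_derive t 1 (fun s => dw s n) ddw /\
            ddw - rho * n%:R `^ (2 * alpha) * dw t n + n%:R ^+ 4 * w t n = 0
      & w tau n = w0 n /\ dw tau n = w1 n].

(* z is the trace w(pi, .) in L^2(0, tau). *)
Definition is_trace (tau : R) (w : R -> nat -> R) (z : R -> R) : Prop :=
  inL2 tau z /\
  L2norm tau (fun t => z t - \sum_(0 <= n < N) phiN n pi * w t n)
    @[N --> \oo] --> 0%E.

(* ut stands for the time derivative of u. Neither the adjoint solution w (on
   [0, tau]) nor its trace z (almost everywhere) depends on any choice. *)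
Definition weak_solution (T alpha rho : R) (u0 u1 : nat -> R) (g : R -> R)
    (u ut : R -> nat -> R) : Prop :=
  [/\ Xcontinuous 2 `[0, T] u,
      Xcontinuous 0 `[0, T] ut,
      Xderivative 0 `[0, T] u ut,
      u 0 = u0 /\ ut 0 = u1
    & forall tau : R, 0 < tau <= T ->
      forall w0 w1, inX 0 w0 -> inX (- 2) w1 ->
      forall w dw, adjoint_solution alpha rho tau w0 w1 w dw ->
      exists2 z, is_trace tau w z &
        0 = pairing (fun n => w1 n - rho * AN alpha w0 n) (u tau)
            - pairing w0 (ut tau)
            - pairing (fun n => dw 0 n - rho * AN alpha (w 0) n) u0
            + pairing (w 0) u1
            - \int[lebesgue_measure]_(t in `]0, tau[) (z t * g t)].

End SpectralScale.

(* Main.v *)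
Require Import Defs.
From HB Require Import structures.
From mathcomp Require Import all_boot all_order all_algebra.
From mathcomp Require Import all_classical all_reals all_analysis.
From mathcomp Require Import measurable_realfun.
From mathcomp Require Import complex.
From mathcomp Require Import ring lra zify.

Set Implicit Arguments.
Unset Strict Implicit.
Unset Printing Implicit Defensive.

Import Order.TTheory GRing.Theory Num.Theory.
Import numFieldNormedType.Exports.

Local Open Scope classical_set_scope.
Local Open Scope ring_scope.

(* In the cosine basis the problem splits into the oscillators
   u_n'' + 2 sigma_n u_n' + n^4 u_n = - phi_n(pi) g, 2 sigma_n = rho n^(2 alpha).
   As rho < 2, each mode n >= 1 is underdamped, and its frequency
   om_n = sqrt(n^4 - sigma_n^2) satisfies |om_n - om_m| >= c (n - m)^2 and
   om_n >= c n^2 with c = 1 - rho^2/4. Null controllability is a moment problem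
   for the exponentials exp((sigma_n +- i om_n) t) and the two solutions of mode 0;
   by duality (a quadratic functional is minimized) it reduces to the observability
   inequality p^2 + q^2 + sum_k (A_k^2 + B_k^2) <= C int_0^L F^2 for
   F(t) = p + q S_0(-t) + sum_k exp(sigma_k t) (A_k cos(om_k t) - B_k sin(om_k t)).

   To bound one coefficient, multiply the function by exp(- mu_n t), so that the
   n-th term becomes constant, and annihilate the other exponentials exp(z t) one
   at a time by h |-> c0 h + c1 h(. + a) with c0 + c1 = 1 and
   c0 + c1 exp(z a) = 0. For a = pi/|Im z| this operator has norm 1, and by the
   quadratic gap the shifts can be made to add up to less than L, shortening only
   the finitely many largest ones, at a bounded cost uniform in n. Averaging F
   against exp(- mu_n s) over a short interval beforehand makes the bounds square
   summable in n, by the Bessel inequality dual to the direct inequality; the latter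
   follows from Schur's test, because the Gram matrix decays like (n - m)^(-2).

   The weak solution is given by Duhamel's formula in each mode, and the same Bessel
   inequality bounds its energy. *)

(** * Square-integrable functions on an interval *)

Section SquareIntegrable.
Context {R : realType}.
Implicit Types (a b c : R) (f g h : R -> R).
Local Notation mu := (@lebesgue_measure R).

(** For alpha > 0 the factors exp(sigma_k t) of F grow at rates unbounded in k, so F admits no upper
    bound by its coefficients at t = 0 that is uniform in the number of modes. The direct inequality
    is therefore applied only where time runs in the decaying direction: to the averaging kernels,
    to Duhamel's integral, to the adjoint solution read backwards from tau, and to F read backwards
    from an interior time at which it is expanded anew. Annihilation is immune to this growth,
    because the cost of removing exp(z t) is bounded through Im z alone: only gaps between
    frequencies enter. Mode 0 does not oscillate, and for sigma_0 = 0 it contributes the function t,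
    which is no exponential. It is carried along with arbitrary coefficients while the other modes
    are estimated; its own coefficients are recovered at the end from F minus the oscillating part.
    The inequalities are proved for finite sums, with constants independent of their length. *)

Definition Iab a b f : R := \int[mu]_(t in `]a, b[) f t.

Definition iab a b f : Prop := mu.-integrable `]a, b[ (EFin \o f).

Definition sqint a b f : Prop :=
  measurable_fun `]a, b[ f /\ iab a b (fun t => f t ^+ 2).

Lemma iab_meas a b f : iab a b f -> measurable_fun `]a, b[ f.
Proof. by move=> /measurable_int/measurable_EFinP. Qed.

Lemma iab_le a b f g : measurable_fun `]a, b[ f ->
  (forall x, a < x < b -> `|f x| <= g x) -> iab a b g -> iab a b f.
Proof.
move=> mf fg ig; apply: le_integrable ig => //; first exact/measurable_EFinP.
move=> x /=; rewrite in_itv /= => xab.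
by rewrite /= lee_fin; apply: (le_trans (fg x xab)); exact: ler_norm.
Qed.

Lemma iab_eq a b f g : (forall x, a < x < b -> f x = g x) ->
  iab a b f -> iab a b g.
Proof.
move=> fg; apply: eq_integrable => // x; rewrite inE /= in_itv /= => xab.
by rewrite fg.
Qed.

Lemma iabD a b f g : iab a b f -> iab a b g -> iab a b (fun x => f x + g x).
Proof. by move=> i1 i2; apply: eq_integrable (integrableD _ i1 i2). Qed.

Lemma iabZ a b k f : iab a b f -> iab a b (fun x => k * f x).
Proof. by move=> i1; apply: eq_integrable (integrableZl _ k i1). Qed.

Lemma iab_sum a b (I : Type) (s : seq I) (f : I -> R -> R) :
  (forall i, iab a b (f i)) -> iab a b (fun x => \sum_(i <- s) f i x).
Proof.
move=> h; elim: s => [|i s IH].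
  under eq_fun do rewrite big_nil.
  by apply: eq_integrable (integrable0 _ _) => // x _.
by under eq_fun do rewrite big_cons; exact: iabD.
Qed.

Lemma iab_norm a b f : iab a b f -> iab a b (fun x => `|f x|).
Proof. by move=> i; exact: integrable_norm i. Qed.

Lemma iabS a b a' b' f : a <= a' -> b' <= b -> iab a b f -> iab a' b' f.
Proof.
move=> aa bb; apply: integrableS => //.
by apply: subset_itv; rewrite bnd_simp.
Qed.

Lemma iab_cont a b f : continuous f -> iab a b f.
Proof.
move=> cf; have : mu.-integrable `[a, b] (EFin \o f).
  by apply: continuous_compact_integrable; [exact: segment_compact|
     exact: continuous_subspaceT].
by apply: integrableS => //; exact: subset_itv_oo_cc.
Qed.

Lemma Iab_eq a b f g : (forall x, a < x < b -> f x = g x) ->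
  Iab a b f = Iab a b g.
Proof.
by move=> fg; apply: eq_Rintegral => x; rewrite inE /= in_itv /=; exact: fg.
Qed.

Lemma IabD a b f g : iab a b f -> iab a b g ->
  Iab a b (fun x => f x + g x) = Iab a b f + Iab a b g.
Proof. by move=> *; exact: RintegralD. Qed.

Lemma IabB a b f g : iab a b f -> iab a b g ->
  Iab a b (fun x => f x - g x) = Iab a b f - Iab a b g.
Proof. by move=> *; exact: RintegralB. Qed.

Lemma IabZ a b k f : iab a b f -> Iab a b (fun x => k * f x) = k * Iab a b f.
Proof. by move=> *; exact: RintegralZl. Qed.

Lemma Iab_sum a b (I : Type) (s : seq I) (f : I -> R -> R) :
  (forall i, iab a b (f i)) ->
  Iab a b (fun x => \sum_(i <- s) f i x) = \sum_(i <- s) Iab a b (f i).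
Proof.
move=> h; elim: s => [|i s IH].
  rewrite /Iab; under eq_Rintegral do rewrite big_nil.
  by rewrite Rintegral_cst // mul0r big_nil.
rewrite big_cons -IH -IabD //; last exact: iab_sum.
by apply: Iab_eq => x _; rewrite big_cons.
Qed.

Lemma Iab_ge0 a b f : (forall x, a < x < b -> 0 <= f x) -> 0 <= Iab a b f.
Proof.
by move=> h; apply: Rintegral_ge0 => x; rewrite /= in_itv /=; exact: h.
Qed.

Lemma Iab_le a b f g : iab a b f -> iab a b g ->
  (forall x, a < x < b -> f x <= g x) -> Iab a b f <= Iab a b g.
Proof.
move=> i1 i2 h; apply: le_Rintegral => // x; rewrite /= in_itv /=; exact: h.
Qed.

Lemma Iab_norm a b f : iab a b f -> `|Iab a b f| <= Iab a b (fun x => `|f x|).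
Proof. by move=> i1; exact: le_normr_Rintegral. Qed.

Lemma Iab_cst a b k : a <= b -> Iab a b (fun=> k) = k * (b - a).
Proof.
move=> ab; rewrite /Iab Rintegral_cst //; congr (_ * _).
have := @lebesgue_measure_itv R `]a, b[; rewrite /= lte_fin => E.
transitivity (fine (if (a < b)%R then b%:E + (- a)%:E else 0)%E).
  by congr fine; exact: E.
by case: ltgtP ab => //= ->; rewrite subrr.
Qed.

Lemma Iab_nil a b f : b <= a -> Iab a b f = 0.
Proof. by move=> ba; rewrite /Iab set_itv_ge ?Rintegral_set0 // bnd_simp -leNgt. Qed.

Lemma Iab_split a c b f : a <= c -> c <= b -> iab a b f ->
  Iab a b f = Iab a c f + Iab c b f.
Proof.
rewrite le_eqVlt => /predU1P[<- _ _|ac].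
  by rewrite (Iab_nil _ (lexx a)) add0r.
rewrite le_eqVlt => /predU1P[<- _|cb i].
  by rewrite (Iab_nil _ (lexx c)) addr0.
have := @Rintegral_itvB R f (BRight a) (BLeft b) c i.
rewrite !bnd_simp => /(_ (ltW ac) cb) E.
rewrite {1}/Iab -[LHS](subrK (\int[mu]_(t in `]a, c]) f t)) E addrC.
congr (_ + _); rewrite /Iab Rintegral_itv_bndo_bndc //.
by apply: integrableS i => //; apply: subset_itv; rewrite bnd_simp // ltW.
Qed.

Lemma Iab_sub a b a' b' f : iab a b f -> (forall x, 0 <= f x) ->
  a <= a' -> b' <= b -> Iab a' b' f <= Iab a b f.
Proof.
move=> i f0 aa bb.
have [ab|ba] := leP a' b'; last first.
  by rewrite (Iab_nil _ (ltW ba)); apply: Iab_ge0 => x _.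
have i' : iab a' b f by apply: iabS i.
rewrite (Iab_split aa (le_trans ab bb) i) (Iab_split ab bb i').
have := @Iab_ge0 a a' f (fun x _ => f0 x).
have := @Iab_ge0 b' b f (fun x _ => f0 x).
lra.
Qed.

Lemma is_derive_continuous f (df : R -> R) :
  (forall x : R, is_derive x (1 : R) f (df x)) -> continuous f.
Proof.
move=> h x; apply: differentiable_continuous; apply/derivable1_diffP.
by have := h x; move=> /@ex_derive.
Qed.

Lemma ftc_on a b F f : a < b -> continuous f ->
  (forall x : R, a <= x <= b -> is_derive x (1 : R) F (f x)) ->
  Iab a b f = F b - F a.
Proof.
move=> ab cf dF.
have cF (x : R) : a <= x <= b -> {for x, continuous F}.
  move=> h; apply: differentiable_continuous; apply/derivable1_diffP.
  by have := dF x h => /@ex_derive.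
have i : mu.-integrable `[a, b] (EFin \o f).
  by apply: continuous_compact_integrable; [exact: segment_compact|
     exact: continuous_subspaceT].
have E := @continuous_FTC2 R f F a b ab (continuous_subspaceT cf).
rewrite /Iab Rintegral_itv_bndo_bndc; last first.
  by apply: integrableS i => //; apply: subset_itv; rewrite bnd_simp // ltW.
rewrite Rintegral_itv_obnd_cbnd; last first.
  by apply: integrableS i => //; apply: subset_itv; rewrite bnd_simp // ltW.
rewrite /Rintegral E //=.
  split.
  - move=> x; rewrite in_itv /= => /andP[x1 x2].
    by have := dF x; rewrite !ltW // => /(_ isT) /@ex_derive.
  - by apply: cvg_at_right_filter; apply: cF; rewrite lexx ltW.
  - by apply: cvg_at_left_filter; apply: cF; rewrite lexx ltW.
move=> x; rewrite in_itv /= => /andP[x1 x2]; rewrite derive1E.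
by apply: derive_val; apply: dF; rewrite !ltW.
Qed.

Lemma ftc a b F f : a <= b -> continuous f ->
  (forall x : R, is_derive x (1 : R) F (f x)) -> Iab a b f = F b - F a.
Proof.
rewrite le_eqVlt => /predU1P[<- _ _|ab cf dF].
  by rewrite (Iab_nil _ (lexx a)) subrr.
by apply: ftc_on.
Qed.

Lemma Iab_shift a b c f : a <= b -> continuous f ->
  Iab a b (fun t => f (t + c)) = Iab (a + c) (b + c) f.
Proof.
move=> ab cf.
(* A base point one unit to the left, and later an upper end one unit to the right, make F
   differentiable at both end points a + c and b + c. *)
pose F x := \int[mu]_(t in `[a + c - 1, x]) f t.
have dF x : a + c - 1 < x < b + c + 1 -> is_derive x 1 F (f x).
  move=> /andP[ax xb].
  have := @continuous_FTC1_closed R f (a + c - 1) x (b + c + 1) xb.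
  case.
  - by apply: continuous_compact_integrable; [exact: segment_compact|
      exact: continuous_subspaceT].
  - exact: ax.
  - by apply: cf.
  by move=> d1; rewrite derive1E => d2; split; [exact: d1|exact: d2].
move: ab; rewrite le_eqVlt => /predU1P[<-|ab].
  by rewrite !Iab_nil.
have dF' (x : R) : a + c <= x <= b + c -> is_derive x (1 : R) F (f x).
  by move=> /andP[x1 x2]; apply: dF; lra.
rewrite (ftc_on (F := F) _ cf dF') ?ltrD2r //.
pose G x : R := F (x + c).
have dG (x : R) : a <= x <= b -> is_derive x (1 : R) G (f (x + c)).
  move=> /andP[x1 x2].
  have d1 : is_derive (x + c) (1 : R) F (f (x + c)) by apply: dF'; lra.
  have d2 : is_derive x (1 : R) (fun x => x + c) 1.
    have := is_deriveD (is_derive_id x (1 : R)) (is_derive_cst c x (1 : R)).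
    by rewrite addr0.
  by have := is_derive1_comp (f := F) (g := fun x => x + c) d1 d2; rewrite mulr1.
rewrite (ftc_on ab _ dG) // => x.
apply: continuous_comp; last exact: cf.
by apply: cvgD; [exact: cvg_id|exact: cvg_cst].
Qed.

Lemma sqint_prod a b f g : sqint a b f -> sqint a b g -> iab a b (fun x => f x * g x).
Proof.
move=> [mf i1] [mg i2].
apply: (@iab_le _ _ _ (fun x => f x ^+ 2 + g x ^+ 2)); last exact: iabD.
  exact: measurable_funM.
move=> x _; rewrite normrM.
have := sqr_ge0 (`|f x| - `|g x|).
have -> : f x ^+ 2 = `|f x| ^+ 2 by rewrite real_normK ?num_real.
have -> : g x ^+ 2 = `|g x| ^+ 2 by rewrite real_normK ?num_real.
nra.
Qed.

Lemma sqintD a b f g : sqint a b f -> sqint a b g -> sqint a b (fun x => f x + g x).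
Proof.
move=> s1 s2; have i := sqint_prod s1 s2; case: s1 s2 => m1 i1 [m2 i2].
split; first exact: measurable_funD.
apply: (@iab_eq _ _ (fun x => f x ^+ 2 + 2 * (f x * g x) + g x ^+ 2)).
  by move=> x _; ring.
by apply: iabD => //; apply: iabD => //; exact: iabZ.
Qed.

Lemma sqintZ a b k f : sqint a b f -> sqint a b (fun x => k * f x).
Proof.
move=> [m1 i1]; split; first by apply: measurable_funM => //; exact: measurable_cst.
apply: (@iab_eq _ _ (fun x => k ^+ 2 * f x ^+ 2)); last exact: iabZ.
by move=> x _; ring.
Qed.

Lemma sqint_eq a b f g : (forall x, a < x < b -> f x = g x) -> sqint a b f -> sqint a b g.
Proof.
move=> fg [m1 i1]; split.
  apply: eq_measurable_fun m1 => x; rewrite inE /= in_itv /=; exact: fg.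
by apply: iab_eq i1 => x xab; rewrite fg.
Qed.

Lemma sqintB a b f g : sqint a b f -> sqint a b g -> sqint a b (fun x => f x - g x).
Proof.
move=> s1 s2; apply: (@sqint_eq _ _ (fun x => f x + (-1) * g x)).
  by move=> x _; rewrite mulN1r.
by apply: sqintD => //; exact: sqintZ.
Qed.

Lemma sqint_cont a b f : continuous f -> sqint a b f.
Proof.
move=> cf; split; first exact: iab_meas (iab_cont _ _ cf).
apply: iab_cont => x; apply: (@continuous_comp _ _ _ f (fun y => y ^+ 2)).
  exact: cf.
exact: exprn_continuous.
Qed.

Lemma sqintS a b a' b' f : a <= a' -> b' <= b -> sqint a b f -> sqint a' b' f.
Proof.
move=> aa bb [m1 i1]; split; last exact: iabS i1.
by apply: measurable_funS m1 => //; apply: subset_itv; rewrite bnd_simp.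
Qed.

Lemma sqint_norm a b f : sqint a b f -> sqint a b (fun x => `|f x|).
Proof.
move=> [m1 i1]; split.
  exact: (measurableT_comp _ m1).
by apply: iab_eq i1 => x _; rewrite real_normK ?num_real.
Qed.

Lemma sqint_iab a b f : sqint a b f -> iab a b f.
Proof.
move=> s1; have s2 : sqint a b (fun=> 1) by apply: sqint_cont; exact: cst_continuous.
by apply: iab_eq (sqint_prod s1 s2) => x _; rewrite mulr1.
Qed.

Lemma sqint_sum a b (I : Type) (s : seq I) (f : I -> R -> R) :
  (forall i, sqint a b (f i)) -> sqint a b (fun x => \sum_(i <- s) f i x).
Proof.
move=> h; elim: s => [|i s IH].
  apply: (@sqint_eq _ _ (fun=> 0)) => [x _|]; first by rewrite big_nil.
  by apply: sqint_cont; exact: cst_continuous.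
by under eq_fun do rewrite big_cons; exact: sqintD.
Qed.

(** For z > 0 the choice s = - y / z gives the claim; for z = 0 and y nonzero, the s chosen below
    makes the affine polynomial equal to -1. *)
Lemma quad_discr (x y z : R) : 0 <= x -> 0 <= z ->
  (forall s, 0 <= x + 2 * s * y + s ^+ 2 * z) -> y ^+ 2 <= x * z.
Proof.
move=> x0 z0 h.
move: h; have [->|zn0] := eqVneq z 0.
  rewrite mulr0 => {}h.
  have [->|yn0] := eqVneq y 0; first by rewrite expr0n.
  have := h (- (x + 1) / (2 * y)).
  have -> : 2 * (- (x + 1) / (2 * y)) * y = - (x + 1) by field.
  by lra.
have zp : 0 < z by rewrite lt_neqAle eq_sym zn0.
move=> h; have := h (- y / z).
have -> : x + 2 * (- y / z) * y + (- y / z) ^+ 2 * z = (x * z - y ^+ 2) / z by field.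
by rewrite pmulr_lge0 ?invr_gt0 // subr_ge0.
Qed.

Lemma cauchy_schwarz a b f g : sqint a b f -> sqint a b g ->
  Iab a b (fun x => f x * g x) ^+ 2 <=
  Iab a b (fun x => f x ^+ 2) * Iab a b (fun x => g x ^+ 2).
Proof.
move=> s1 s2; have i := sqint_prod s1 s2.
apply: quad_discr; [by apply: Iab_ge0 => x _; exact: sqr_ge0..|move=> s].
have -> : Iab a b (fun x => f x ^+ 2) + 2 * s * Iab a b (fun x => f x * g x) +
    s ^+ 2 * Iab a b (fun x => g x ^+ 2) =
    Iab a b (fun x => (f x + s * g x) ^+ 2).
  case: s1 s2 => m1 i1 [m2 i2].
  rewrite -!IabZ // -!IabD //; try exact: iabZ; last by apply: iabD => //; exact: iabZ.
  by apply: Iab_eq => x _; ring.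
by apply: Iab_ge0 => x _; exact: sqr_ge0.
Qed.

Lemma Iab_sqrD_le a b f g : sqint a b f -> sqint a b g ->
  Iab a b (fun x => (f x + g x) ^+ 2) <=
  2 * Iab a b (fun x => f x ^+ 2) + 2 * Iab a b (fun x => g x ^+ 2).
Proof.
move=> s1 s2; have [_ i] := sqintD s1 s2; case: s1 s2 => _ i1 [_ i2].
rewrite -!IabZ // -IabD; try exact: iabZ.
apply: Iab_le => //; first by apply: iabD; exact: iabZ.
by move=> x _; have := sqr_ge0 (f x - g x); nra.
Qed.

(** Absolute continuity of the integral, applied on the whole line to the extension of f by zero. *)
Lemma Iab_abs_cont a b f : iab a b f -> forall e, 0 < e -> exists2 d : R, 0 < d &
  forall u v, a <= u -> u <= v -> v <= b -> v - u < d ->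
    Iab u v (fun x => `|f x|) < e.
Proof.
move=> i e e0.
have i' : mu.-integrable [set: R] (EFin \o (f \_ `]a, b[)).
  have /integrable_mkcond := i.
  by rewrite restrict_EFin; apply; exact: measurable_itv.
have [d [d0 h]] := integral_normr_continuous i' e0.
exists d => // u v au uv vb vud.
have := h `]u, v[%classic (measurable_itv _).
have mE := @lebesgue_measure_itv R `]u, v[; rewrite /= lte_fin in mE.
have md : (mu `]u, v[%classic < d%:E)%E.
  by rewrite mE; case: ifPn => _; rewrite lte_fin.
move=> /(_ md); apply: le_lt_trans.
rewrite le_eqVlt; apply/orP; left; apply/eqP; apply: eq_Rintegral => x.
rewrite inE /= in_itv /= => /andP[ux xv]; rewrite patchE ifT // inE /= in_itv /=.
by rewrite (le_lt_trans au) // (lt_le_trans xv).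
Qed.

(** By Cauchy-Schwarz the L^1 norms are at most sqrt(b - a) 2^-n, so the sum of the |f n| is
    integrable, hence finite almost everywhere. *)
Lemma ae_series_cvg a b (f : nat -> R -> R) :
  (forall n, sqint a b (f n)) ->
  (forall n, Iab a b (fun x => f n x ^+ 2) <= 4^-1 ^+ n) ->
  \forall x \ae mu, `]a, b[%classic x -> cvgn (series (fun n => `|f n x|)).
Proof.
move=> s1 h.
have [ab|ba] := ltP a b; last first.
  apply: aeW => x /=; rewrite in_itv /= => /andP[ax xb].
  by have := lt_trans ax xb; rewrite ltNge ba.
have mabs n : measurable_fun `]a, b[ (fun x => (`|f n x|%:E)).
  by apply/measurable_EFinP; exact: (proj1 (sqint_norm (s1 n))).
have bnd n : Iab a b (fun x => `|f n x|) <= Num.sqrt (b - a) * 2^-1 ^+ n.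
  have -> : Num.sqrt (b - a) * 2^-1 ^+ n = Num.sqrt ((b - a) * 4^-1 ^+ n).
    rewrite sqrtrM ?subr_ge0 ?ltW //; congr (_ * _).
    have -> : (4^-1 : R) = 2^-1 ^+ 2 by field.
    by rewrite exprAC sqrtr_sqr ger0_norm // exprn_ge0.
  rewrite -[X in X <= _]ger0_norm; last exact: Iab_ge0.
  rewrite -sqrtr_sqr; apply: ler_wsqrtr.
  have s0 : sqint a b (fun=> 1) by apply: sqint_cont; exact: cst_continuous.
  have -> : Iab a b (fun x => `|f n x|) = Iab a b (fun x => 1 * `|f n x|).
    by apply: Iab_eq => x _; rewrite mul1r.
  apply: (le_trans (cauchy_schwarz s0 (sqint_norm (s1 n)))).
  have -> : Iab a b (fun=> 1 ^+ 2) = b - a.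
    by rewrite Iab_cst ?expr1n ?mul1r // ltW.
  apply: ler_wpM2l; first by rewrite subr_ge0 ltW.
  apply: le_trans (h n); rewrite le_eqVlt; apply/orP; left; apply/eqP.
  by apply: Iab_eq => x _; rewrite real_normK ?num_real.
have E : (\int[mu]_(x in `]a, b[) \sum_(0 <= n <oo) (`|f n x|)%:E =
    \sum_(0 <= n <oo) (\int[mu]_(x in `]a, b[) (`|f n x|)%:E))%E.
  by apply: integral_nneseries.
have fin : (\int[mu]_(x in `]a, b[) \sum_(0 <= n <oo) (`|f n x|)%:E < +oo)%E.
  rewrite E.
  have /le_lt_trans : (\sum_(0 <= n <oo) (\int[mu]_(x in `]a, b[) (`|f n x|)%:E)
     <= (2 * Num.sqrt (b - a))%:E)%E.
    apply: lime_le; first by apply: is_cvg_nneseries => n _ _; apply: integral_ge0 => x _; rewrite lee_fin.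
    near=> N.
    have -> : (\sum_(0 <= i < N) \int[mu]_(x in `]a, b[) `|f i x|%:E =
       (\sum_(0 <= i < N) Iab a b (fun x => `|f i x|))%:E)%E.
      rewrite -sumEFin; apply: eq_bigr => i _.
      rewrite /Iab /Rintegral fineK //.
      apply: integrable_fin_num => //.
      exact: (iab_norm (sqint_iab (s1 i))).
    rewrite lee_fin.
    apply: (@le_trans _ _ (\sum_(0 <= i < N) Num.sqrt (b - a) * 2^-1 ^+ i)).
      by apply: ler_sum => i _.
    rewrite -mulr_sumr mulrC; apply: ler_wpM2r; first exact: sqrtr_ge0.
    have : forall m, \sum_(0 <= i < m) 2^-1 ^+ i = 2 - 2 * (2^-1 : R) ^+ m.
      elim=> [|m IH]; first by rewrite big_geq // expr0; lra.
      by rewrite big_nat_recr //= IH exprS; field.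
    move=> ->; have : 0 <= (2^-1 : R) ^+ N by apply: exprn_ge0.
    lra.
  by apply; exact: ltry.
have i : mu.-integrable `]a, b[ (fun x => \sum_(0 <= n <oo) (`|f n x|)%:E)%E.
  apply/integrableP; split.
    have := @ge0_emeasurable_sum _ _ R `]a, b[%classic (fun n x => (`|f n x|)%:E) predT.
    by apply => // k x _ _; rewrite lee_fin.
  apply: le_lt_trans fin; rewrite le_eqVlt; apply/orP; left; apply/eqP.
  apply: eq_integral => x _; rewrite gee0_abs //.
  by apply: nneseries_ge0 => n _ _; rewrite lee_fin.
have ae : \forall x \ae mu, `]a, b[%classic x ->
    (\sum_(0 <= n <oo) (`|f n x|)%:E)%E \is a fin_num.
  by apply: integrable_ae i; exact: measurable_itv.
apply: (@filterS _ _ (ae_filter_ringOfSetsType mu) _ _ _ ae) => x hx xab; have {}hx := hx xab.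
apply: nondecreasing_is_cvgn.
  by apply: nondecreasing_series => n _ _; exact: normr_ge0.
exists (fine (\sum_(0 <= n <oo) (`|f n x|)%:E)%E) => _ [N _ <-].
rewrite -lee_fin fineK //.
apply: le_trans (nneseries_lim_ge N _); last by move=> n _; rewrite lee_fin.
by rewrite sumEFin.
Unshelve. all: by end_near. Qed.

(** Riesz-Fischer: a subsequence with squared distances at most 4^-k converges almost everywhere,
    and Fatou's lemma carries the Cauchy estimate over to the limit. *)
Lemma sqint_complete a b (f : nat -> R -> R) : (forall n, sqint a b (f n)) ->
  (forall e, 0 < e -> exists N, forall m n, (N <= m)%N -> (N <= n)%N ->
    Iab a b (fun x => (f m x - f n x) ^+ 2) <= e) ->
  exists2 g, sqint a b g &
  forall e, 0 < e -> exists N, forall n, (N <= n)%N ->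
    Iab a b (fun x => (f n x - g x) ^+ 2) <= e.
Proof.
move=> sf cf.
have e4 k : (0 : R) < 4^-1 ^+ k by apply: exprn_gt0; rewrite invr_gt0.
have [N0 hN0] := choice (fun k => cf _ (e4 k)).
(* Summing the thresholds makes N monotone and unbounded while N k stays above N0 k. *)
pose N k := (\sum_(j < k.+1) (N0 j).+1)%N.
have NN0 k m : (N k <= m)%N -> (N0 k <= m)%N.
  by apply: leq_trans; rewrite /N big_ord_recr /= (leq_trans (leqnSn _)) // leq_addl.
have Nmono k : (N k <= N k.+1)%N by rewrite /N [leqRHS]big_ord_recr /= leq_addr.
have Nk k : (k <= N k)%N.
  elim: k => // k IH; rewrite /N big_ord_recr /= -/(N k).
  by rewrite addnS ltnS (leq_trans IH) // leq_addr.
pose d k x := f (N k.+1) x - f (N k) x.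
have sd k : sqint a b (d k) by exact: sqintB.
have dE k : Iab a b (fun x => d k x ^+ 2) <= 4^-1 ^+ k.
  by apply: hN0; apply: NN0.
have ae := ae_series_cvg sd dE.
(* The upper limit is measurable on the whole interval, and equals the limit wherever the
   subsequence converges. *)
pose g0 x := limn_esup (fun k => (f (N k) x)%:E).
pose g x := fine (g0 x).
have mg : measurable_fun `]a, b[ g.
  apply: (measurableT_comp (fine_measurable _)) => //.
  apply: measurable_fun_limn_esup => k; apply/measurable_EFinP.
  exact: (proj1 (sf _)).
have aecvg : \forall x \ae mu, `]a, b[%classic x ->
    f (N k) x @[k --> \oo] --> g x.
  apply: (@filterS _ _ (ae_filter_ringOfSetsType mu) _ _ _ ae)=> x hx xab; have {}hx := hx xab.
  have c1 : cvgn (fun k => f (N k) x).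
    have := normed_cvg hx => c2.
    have -> : (fun k => f (N k) x) = (fun k => series (fun k => d k x) k + f (N 0%N) x).
      apply/funext => k; rewrite /series /= /d telescope_sumr // subrK //.
    by apply: is_cvgD => //; exact: is_cvg_cst.
  pose l : R := limn (fun k => f (N k) x).
  have cl : f (N k) x @[k --> \oo] --> l by exact: c1.
  suff -> : g x = l by [].
  rewrite /g /g0.
  have : (f (N k) x)%:E @[k --> \oo] --> l%:E by apply: cvg_EFin => //; exact: nearW.
  by move=> /cvg_limn_einf_sup[_ ->].
have key n e : (exists K, forall k, (K <= k)%N ->
      Iab a b (fun x => (f n x - f (N k) x) ^+ 2) <= e) ->
    iab a b (fun x => (f n x - g x) ^+ 2) /\
    Iab a b (fun x => (f n x - g x) ^+ 2) <= e.
  move=> [K hK].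
  pose F k x := (((f n x - f (N k) x) ^+ 2)%:E).
  have mF k : measurable_fun `]a, b[ (F k).
    by apply/measurable_EFinP; exact: (iab_meas (proj2 (sqintB (sf n) (sf (N k))))).
  have F0 k x : `]a, b[%classic x -> (0 <= F k x)%E by rewrite lee_fin sqr_ge0.
  have fat := fatou mu (measurable_itv _) mF F0.
  have mG : measurable_fun `]a, b[ (fun x => (f n x - g x) ^+ 2).
    by apply: measurable_funX; apply: measurable_funB => //; exact: (proj1 (sf n)).
  have intE : (\int[mu]_(x in `]a, b[) ((f n x - g x) ^+ 2)%:E <= e%:E)%E.
    apply: (@le_trans _ _ (\int[mu]_(x in `]a, b[) limn_einf (F^~ x))%E).
      rewrite le_eqVlt; apply/orP; left; apply/eqP; apply: ae_eq_integral => //.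
      - exact/measurable_EFinP.
      - rewrite /limn_einf; apply: measurableT_comp => //.
        apply: (@measurable_fun_limn_esup _ _ R _ (fun k x => - F k x)%E) => k.
        by apply: measurableT_comp => //; exact: mF.
      apply: (@filterS _ _ (ae_filter_ringOfSetsType mu) _ _ _ aecvg) => x hx xab; have {}hx := hx xab.
      have : F k x @[k --> \oo] --> ((f n x - g x) ^+ 2)%:E.
        apply: cvg_EFin; first exact: nearW.
        rewrite /F /=; apply: (@cvg_comp _ _ _ _ (fun y => (f n x - y) ^+ 2) _ _ _ hx).
        apply: (@continuous_comp _ _ _ (fun y => f n x - y) (fun z => z ^+ 2)).
          by apply: continuousB; [exact: cst_continuous|].
        exact: exprn_continuous.
      by move=> /cvg_limn_einf_sup[-> _].
    apply: (le_trans fat).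
    rewrite limn_einf_lim; apply: lime_le; first exact: is_cvg_einfs.
    near=> k.
    apply: (@le_trans _ _ (\int[mu]_(x in `]a, b[) F (maxn k K) x)%E).
      by apply: ereal_inf_lbound; exists (maxn k K) => //=; exact: leq_maxl.
    have := hK (maxn k K) (leq_maxr _ _).
    rewrite -lee_fin /Iab /Rintegral fineK //.
    apply: integrable_fin_num; first exact: measurable_itv.
    exact: (proj2 (sqintB (sf n) (sf _))).
  split.
    apply/integrableP; split; first exact/measurable_EFinP.
    apply: le_lt_trans (ltry e); apply: le_trans intE.
    rewrite le_eqVlt; apply/orP; left; apply/eqP; apply: eq_integral => x _.
    by rewrite /= ger0_norm ?sqr_ge0.
  rewrite -lee_fin /Iab /Rintegral fineK //.
  have : (0 <= \int[mu]_(x in `]a, b[) ((f n x - g x) ^+ 2)%:E)%E.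
    by apply: integral_ge0 => x _; rewrite lee_fin sqr_ge0.
  by move=> h0; rewrite ge0_fin_numE // (le_lt_trans intE) // ltry.
have key2 e : 0 < e -> exists M, forall n, (M <= n)%N ->
    iab a b (fun x => (f n x - g x) ^+ 2) /\
    Iab a b (fun x => (f n x - g x) ^+ 2) <= e.
  move=> e0; have [M hM] := cf e e0; exists M => n Mn.
  by apply: key; exists M => k Mk; apply: hM => //; exact: leq_trans (Nk k).
exists g.
  have [M /(_ M (leqnn _))[i1 _]] := key2 _ ltr01.
  apply: (@sqint_eq _ _ (fun x => f M x - (f M x - g x))).
    by move=> x _; rewrite opprB addrC subrK.
  apply: sqintB => //; split => //.
  by apply: measurable_funB => //; exact: (proj1 (sf M)).
move=> e e0; have [M hM] := key2 e e0.
by exists M => n Mn; have [] := hM n Mn.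
Unshelve. all: by end_near. Qed.


End SquareIntegrable.

(** * The norms in terms of partial sums *)

Section Norms.
Context {R : realType}.
Implicit Types (T : R) (f g : R -> R) (a : nat -> R).
Local Notation mu := (@lebesgue_measure R).

Lemma L2norm_integral T f :
  L2norm T f = ((\int[mu]_(x in `]0%R, T[) ((f x) ^+ 2)%:E) `^ 2^-1)%E.
Proof.
rewrite /L2norm unlock; congr (_ `^ _)%E.
rewrite [RHS]integral_mkcond; apply: eq_integral => x _.
rewrite -restrict_EFin /patch; case: ifPn => _.
  have -> : (`|(EFin \o f) x|)%E = (`|f x|)%:E by [].
  by rewrite poweR_EFin powR_mulrn // real_normK ?num_real.
have -> : (`|point| : \bar R)%E = 0%:E by rewrite /point /= normr0.
by rewrite poweR_EFin powR0.
Qed.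

Lemma sqint_inL2 T f : sqint 0 T f -> L2norm T f = (Num.sqrt (Iab 0 T (fun x => f x ^+ 2)))%:E.
Proof.
move=> [mf i]; rewrite L2norm_integral.
have -> : (\int[mu]_(x in `]0%R, T[) (f x ^+ 2)%:E)%E = (Iab 0 T (fun x => f x ^+ 2))%:E.
  by rewrite /Iab /Rintegral fineK //; apply: integrable_fin_num.
rewrite poweR_EFin powR12_sqrt //; apply: Iab_ge0 => x _; exact: sqr_ge0.
Qed.

Lemma inL2P T f : inL2 T f <-> sqint 0 T f.
Proof.
split=> [[mf]|s]; last first.
  by split; [exact: (proj1 s)|rewrite sqint_inL2 // ltry].
rewrite L2norm_integral => h; split => //.
apply/integrableP; split.
  by apply/measurable_EFinP; exact: measurable_funX.
apply: le_lt_trans (lty_poweRy _ h); last by rewrite invr_eq0 pnatr_eq0.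
rewrite le_eqVlt; apply/orP; left; apply/eqP.
by apply: eq_integral => x _; rewrite /= ger0_norm ?sqr_ge0.
Qed.

(** Mode 0 has weight 1 for every p, as in [Xnorm]; the power alone would give 0 for p nonzero. *)
Definition wt (p : R) (n : nat) : R := if n == 0%N then 1 else n%:R `^ (2 * p).

Lemma wt_ge0 p n : 0 <= wt p n.
Proof. by rewrite /wt; case: ifP => // _; exact: powR_ge0. Qed.

Lemma wt_sum p a N : ((`|a 0%N| ^+ 2)%:E +
    \sum_(1 <= n < N.+1) (n%:R `^ (2 * p) * `|a n| ^+ 2)%:E)%E =
  (\sum_(n < N.+1) wt p n * a n ^+ 2)%:E.
Proof.
rewrite sumEFin -EFinD; congr (_%:E); rewrite -(big_mkord xpredT (fun n => wt p n * a n ^+ 2)) [RHS]big_ltn //.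
congr (_ + _); first by rewrite /wt eqxx mul1r real_normK ?num_real.
by apply: eq_big_nat => n /andP[n1 _]; rewrite /wt gtn_eqF // real_normK ?num_real.
Qed.

Lemma wt_sumS p a N : \sum_(n < N) wt p n * a n ^+ 2 <= \sum_(n < N.+1) wt p n * a n ^+ 2.
Proof. by rewrite big_ord_recr /= lerDl mulr_ge0 ?wt_ge0 ?sqr_ge0. Qed.

Lemma wt_sum_succ p a (M : R) N : (forall N, \sum_(n < N) wt p n * a n ^+ 2 <= M) ->
  \sum_(k < N) wt p k.+1 * a k.+1 ^+ 2 <= M.
Proof.
move=> h; apply: le_trans (h N.+1); rewrite big_ord_recl lerDr.
by rewrite mulr_ge0 ?wt_ge0 ?sqr_ge0.
Qed.

Lemma Xnorm_le p a M : 0 <= M ->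
  (forall N, \sum_(n < N) wt p n * a n ^+ 2 <= M ^+ 2) -> (Xnorm p a <= M%:E)%E.
Proof.
move=> M0 h.
have -> : M%:E = ((M ^+ 2)%:E `^ 2^-1)%E.
  by rewrite poweR_EFin powR12_sqrt ?sqr_ge0 // sqrtr_sqr ger0_norm.
rewrite /Xnorm; apply: gt0_ler_poweR; rewrite ?invr_ge0 //.
- rewrite in_itv /= leey andbT adde_ge0 ?lee_fin ?sqr_ge0 //.
  by apply: nneseries_ge0 => n _ _; rewrite lee_fin mulr_ge0 ?powR_ge0 ?sqr_ge0.
- by rewrite in_itv /= leey andbT lee_fin sqr_ge0.
rewrite -leeBrDl //; apply: lime_le.
  by apply: is_cvg_nneseries => n _ _; rewrite lee_fin mulr_ge0 ?powR_ge0 ?sqr_ge0.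
near=> N; rewrite leeBrDl //.
have [->|N0] := posnP N.
  rewrite big_geq // adde0; have := h 1%N.
  by rewrite big_ord1 /wt eqxx mul1r lee_fin real_normK ?num_real.
by rewrite -(prednK N0) wt_sum lee_fin.
Unshelve. all: by end_near. Qed.

(** From here on a finite norm is used as a common bound of all partial sums; that M is the norm
    itself matters for the final estimate of the control. *)
Lemma inX_bound p a : inX p a -> exists2 M, 0 <= M &
  Xnorm p a = M%:E /\ forall N, \sum_(n < N) wt p n * a n ^+ 2 <= M ^+ 2.
Proof.
rewrite /inX => h; exists (fine (Xnorm p a)).
  by rewrite fine_ge0 // poweR_ge0.
have X0 : (0 <= Xnorm p a)%E by exact: poweR_ge0.
have fX : Xnorm p a \is a fin_num by rewrite ge0_fin_numE.
split; first by rewrite fineK.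
set S := ((`|a 0%N| ^+ 2)%:E + \sum_(1 <= n <oo) (n%:R `^ (2 * p) * `|a n| ^+ 2)%:E)%E.
have S0 : (0 <= S)%E.
  rewrite adde_ge0 ?lee_fin ?sqr_ge0 //.
  by apply: nneseries_ge0 => n _ _; rewrite lee_fin mulr_ge0 ?powR_ge0 ?sqr_ge0.
have Sy : (S < +oo)%E by apply: lty_poweRy h; rewrite invr_eq0 pnatr_eq0.
have fS : S \is a fin_num by rewrite ge0_fin_numE.
have -> : fine (Xnorm p a) ^+ 2 = fine S.
  rewrite /Xnorm -/S -(fineK fS) poweR_EFin /= powR12_sqrt ?fine_ge0 //.
  by rewrite sqr_sqrtr // fine_ge0.
move=> N; apply: (le_trans (wt_sumS p a N)).
rewrite -lee_fin fineK // -wt_sum /S leeD2l //.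
by apply: nneseries_lim_ge => n _ _; rewrite lee_fin mulr_ge0 ?powR_ge0 ?sqr_ge0.
Qed.

Lemma inXI p a M : 0 <= M -> (forall N, \sum_(n < N) wt p n * a n ^+ 2 <= M ^+ 2) ->
  inX p a.
Proof. by move=> M0 h; apply: le_lt_trans (Xnorm_le M0 h) (ltry _). Qed.

End Norms.

(** * Fundamental solutions of the modal equations *)

Section Modes.
Context {R : realType}.
Implicit Types (t x y : R) (n m : nat).

Lemma is_derive_lin (k t : R) : is_derive t (1 : R) (fun x => k * x) k.
Proof.
have := is_deriveZ k (is_derive_id t (1 : R)).
by rewrite /GRing.scale /= mulr1.
Qed.

Lemma is_derive_expk (k t : R) :
  is_derive t (1 : R) (fun x => expR (k * x)) (k * expR (k * t)).
Proof.
by rewrite mulrC; have := is_derive1_comp (is_derive_expR (k * t)) (is_derive_lin k t).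
Qed.

Lemma is_derive_sink (k t : R) :
  is_derive t (1 : R) (fun x => sin (k * x)) (k * cos (k * t)).
Proof.
by rewrite mulrC; have := is_derive1_comp (is_derive_sin (k * t)) (is_derive_lin k t).
Qed.

Lemma is_derive_cosk (k t : R) :
  is_derive t (1 : R) (fun x => cos (k * x)) (- (k * sin (k * t))).
Proof.
rewrite -mulNr mulrC mulrN -mulNr.
by have := is_derive1_comp (is_derive_cos (k * t)) (is_derive_lin k t).
Qed.

Lemma is_derive1D (f g : R -> R) t (df dg : R) :
  is_derive t (1 : R) f df -> is_derive t (1 : R) g dg ->
  is_derive t (1 : R) (fun x => f x + g x) (df + dg).
Proof. by move=> d1 d2; exact: is_deriveD. Qed.

Lemma is_derive1M (f g : R -> R) t (df dg : R) :
  is_derive t (1 : R) f df -> is_derive t (1 : R) g dg ->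
  is_derive t (1 : R) (fun x => f x * g x) (df * g t + f t * dg).
Proof.
move=> d1 d2; have := is_deriveM d1 d2.
by rewrite /GRing.scale /= addrC [g t * df]mulrC.
Qed.

Lemma is_derive1Z (k : R) (f : R -> R) t (df : R) :
  is_derive t (1 : R) f df -> is_derive t (1 : R) (fun x => k * f x) (k * df).
Proof. by move=> d1; exact: is_deriveZ. Qed.

Lemma is_derive1_eq (f : R -> R) t (a b : R) :
  is_derive t (1 : R) f a -> a = b -> is_derive t (1 : R) f b.
Proof. by move=> ? <-. Qed.

Lemma is_derive_ecos (s w t : R) :
  is_derive t (1 : R) (fun x => expR (- s * x) * cos (w * x))
    (- s * (expR (- s * t) * cos (w * t)) - w * (expR (- s * t) * sin (w * t))).
Proof.
apply: (is_derive1_eq (is_derive1M (is_derive_expk (- s) t) (is_derive_cosk w t))).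
by ring.
Qed.

Lemma is_derive_esin (s w t : R) :
  is_derive t (1 : R) (fun x => expR (- s * x) * sin (w * x))
    (- s * (expR (- s * t) * sin (w * t)) + w * (expR (- s * t) * cos (w * t))).
Proof.
apply: (is_derive1_eq (is_derive1M (is_derive_expk (- s) t) (is_derive_sink w t))).
by ring.
Qed.

Context (alpha rho : R).

Definition damp n : R := rho * n%:R `^ (2 * alpha) / 2.
Local Notation sig := damp.
Definition om n : R := Num.sqrt (n%:R ^+ 4 - sig n ^+ 2).
Definition dampcos n t : R := expR (- sig n * t) * cos (om n * t).
Local Notation ec := dampcos.
Definition dampsin n t : R := expR (- sig n * t) * sin (om n * t).
Local Notation es := dampsin.

(* [Smode n] and [Cmode n] solve y'' + 2 sigma_n y' + n^4 y = 0 with data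
   (y, y') = (0, 1) and (1, 0). Since 0^0 = 1, mode 0 is damped exactly when
   alpha = 0, whence the case distinction. *)
Definition Smode n t : R :=
  if n == 0%N then
    if sig 0 == 0 then t else (1 - expR (- (2 * sig 0) * t)) / (2 * sig 0)
  else es n t / om n.
Local Notation SS := Smode.

Definition Cmode n t : R := if n == 0%N then 1 else ec n t + sig n / om n * es n t.
Local Notation CC := Cmode.

Definition dSmode n t : R := CC n t - 2 * sig n * SS n t.
Local Notation DS := dSmode.

Context (halpha : 0 <= alpha < 1) (hrho : 0 < rho < 2).

(* The constant c in the gap condition |om_n - om_m| >= c (n - m)^2. *)
Definition gapc : R := 1 - rho ^+ 2 / 4.

Lemma gapc_gt0 : 0 < gapc. Proof. by have /andP[r0 r2] := hrho; rewrite /gapc; nra. Qed.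
Lemma gapc_lt1 : gapc < 1. Proof. by have /andP[r0 r2] := hrho; rewrite /gapc; nra. Qed.

Lemma rho2_le1 : rho ^+ 2 / 4 <= 1.
Proof. by have := gapc_gt0; rewrite /gapc; lra. Qed.

Lemma sig_ge0 n : 0 <= sig n.
Proof.
by rewrite /sig divr_ge0 // mulr_ge0 ?powR_ge0 // ltW //; case/andP: hrho.
Qed.

(** With q = n / m, both m^(2 alpha) <= m^2 and q^(2 alpha) <= q^2, since alpha < 1 and m, q >= 1.
    Hence om_n^2 = n^4 - sigma_n^2 inherits the gaps of n^4 up to the factor 1 - rho^2/4. *)
Lemma sig_sq_diff n m : (0 < m)%N -> (m <= n)%N ->
  sig n ^+ 2 - sig m ^+ 2 <= rho ^+ 2 / 4 * (n%:R ^+ 4 - m%:R ^+ 4).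
Proof.
move=> m0 mn; have n0 : (0 < n)%N by exact: leq_trans mn.
have mp : (0 : R) < m%:R by rewrite ltr0n.
have np : (0 : R) < n%:R by rewrite ltr0n.
have m1 : (1 : R) <= m%:R by rewrite ler1n.
have e2 : 2 * alpha <= 2 by case/andP: halpha; lra.
set A := n%:R `^ (2 * alpha); set B := m%:R `^ (2 * alpha).
have B0 : 0 < B by exact: powR_gt0.
have Bm : B <= m%:R ^+ 2 by rewrite /B -powR_mulrn ?ler_powR // ltW.
set q : R := n%:R / m%:R.
have q1 : 1 <= q by rewrite ler_pdivlMr // mul1r ler_nat.
have nE : n%:R = q * m%:R by rewrite /q divfK // gt_eqF.
have AE : A = q `^ (2 * alpha) * B.
  by rewrite /A nE powRM // (le_trans _ q1).
have Q2 : q `^ (2 * alpha) <= q ^+ 2.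
  by rewrite -powR_mulrn ?(le_trans _ q1) //; apply: (ler_powR q1).
set Q := q `^ (2 * alpha) in AE Q2.
have Q1 : 0 <= Q by exact: powR_ge0.
have -> : sig n ^+ 2 - sig m ^+ 2 = rho ^+ 2 / 4 * (A ^+ 2 - B ^+ 2).
  by rewrite /sig -/A -/B; field.
apply: ler_wpM2l; first by rewrite divr_ge0 ?sqr_ge0.
have -> : A ^+ 2 - B ^+ 2 = B ^+ 2 * (Q ^+ 2 - 1) by rewrite AE; ring.
have -> : (n%:R : R) ^+ 4 - m%:R ^+ 4 = (m%:R ^+ 2) ^+ 2 * ((q ^+ 2) ^+ 2 - 1).
  by rewrite nE; ring.
have h1 : B ^+ 2 <= (m%:R ^+ 2) ^+ 2 by rewrite ler_sqr ?nnegrE // ltW.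
have h2 : Q ^+ 2 <= (q ^+ 2) ^+ 2 by rewrite ler_sqr ?nnegrE // sqr_ge0.
have h3 : 1 <= (q ^+ 2) ^+ 2 by rewrite -exprM exprn_ege1.
apply: (@le_trans _ _ (B ^+ 2 * ((q ^+ 2) ^+ 2 - 1))).
  by apply: ler_wpM2l; [exact: sqr_ge0|lra].
by apply: ler_wpM2r => //; lra.
Qed.

Lemma sig_le n : (0 < n)%N -> sig n ^+ 2 <= rho ^+ 2 / 4 * n%:R ^+ 4.
Proof.
move=> n0; have := @sig_sq_diff n 1 isT n0.
have -> : sig 1 = rho / 2 by rewrite /sig powR1; field.
lra.
Qed.

Lemma om2 n : (0 < n)%N -> om n ^+ 2 = n%:R ^+ 4 - sig n ^+ 2.
Proof.
move=> n0; rewrite /om sqr_sqrtr // subr_ge0.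
apply: (le_trans (sig_le n0)).
have : (0 : R) <= n%:R ^+ 4 by exact: exprn_ge0.
have := rho2_le1.
nra.
Qed.

(** om_n^2 is at least c n^4, and c^2 <= c because 0 < c < 1; this avoids square roots of c. *)
Lemma om_ge n : (0 < n)%N -> gapc * n%:R ^+ 2 <= om n.
Proof.
move=> n0; have := om2 n0; have := sig_le n0.
have : 0 <= om n by exact: sqrtr_ge0.
have := gapc_gt0; have := gapc_lt1.
rewrite /gapc; set c := rho ^+ 2 / 4.
have n4 : (0 : R) <= n%:R ^+ 2 by exact: sqr_ge0.
rewrite -[n%:R ^+ 4]/(n%:R ^+ (2 * 2)) exprM => h1 h2 h3 h4 h5.
rewrite -ler_sqr ?nnegrE //; last by apply: mulr_ge0 => //; lra.
rewrite h5 exprMn.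
have h6 : (1 - c) ^+ 2 <= 1 - c by nra.
have := ler_wpM2r (sqr_ge0 (n%:R ^+ 2)) h6.
lra.
Qed.

Lemma om_gt0 n : (0 < n)%N -> 0 < om n.
Proof.
move=> n0; apply: lt_le_trans (om_ge n0).
by rewrite mulr_gt0 ?gapc_gt0 // exprn_gt0 // ltr0n.
Qed.

Lemma om_sqr_ge n : (0 < n)%N -> gapc ^+ 2 * n%:R ^+ 4 <= om n ^+ 2.
Proof.
move=> n0; have -> : gapc ^+ 2 * n%:R ^+ 4 = (gapc * n%:R ^+ 2) ^+ 2 by ring.
have g0 := gapc_gt0; rewrite ler_sqr ?nnegrE ?sqrtr_ge0 //; first exact: om_ge.
by rewrite mulr_ge0 ?exprn_ge0 // ltW.
Qed.

Lemma sig_sqr_le n : (0 < n)%N -> sig n ^+ 2 <= n%:R ^+ 4.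
Proof. by move=> n0; have := om2 n0; have := sqr_ge0 (om n); lra. Qed.

Lemma om_le n : (0 < n)%N -> om n <= n%:R ^+ 2.
Proof.
move=> n0; rewrite -ler_sqr ?nnegrE ?sqr_ge0 //; last exact: ltW (om_gt0 n0).
by rewrite om2 // -exprM; have := sqr_ge0 (sig n); lra.
Qed.

(** Dividing om_n^2 - om_m^2 >= c (n^4 - m^4) by om_n + om_m <= n^2 + m^2 leaves c (n^2 - m^2),
    which is at least c (n - m)^2. *)
Lemma om_diff n m : (0 < m)%N -> (m <= n)%N ->
  gapc * (n%:R - m%:R) ^+ 2 <= om n - om m.
Proof.
move=> m0 mn; have n0 : (0 < n)%N by exact: leq_trans mn.
have h1 := sig_sq_diff m0 mn; have h2 := om2 n0; have h3 := om2 m0.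
have h4 := om_le n0; have h5 := om_le m0; have h6 := om_gt0 n0; have h7 := om_gt0 m0.
have mn' : (m%:R : R) <= n%:R by rewrite ler_nat.
have mp : (0 : R) < m%:R by rewrite ltr0n.
have D2 : (0 : R) <= n%:R ^+ 2 - m%:R ^+ 2 by nra.
have key : gapc * (n%:R ^+ 2 - m%:R ^+ 2) * (om n + om m) <=
    (om n - om m) * (om n + om m).
  have -> : (om n - om m) * (om n + om m) = om n ^+ 2 - om m ^+ 2 by ring.
  rewrite h2 h3.
  apply: (@le_trans _ _ (gapc * (n%:R ^+ 2 - m%:R ^+ 2) * (n%:R ^+ 2 + m%:R ^+ 2))).
    apply: ler_wpM2l; last by lra.
    by apply: mulr_ge0 => //; exact: ltW gapc_gt0.
  have -> : gapc * (n%:R ^+ 2 - m%:R ^+ 2) * (n%:R ^+ 2 + m%:R ^+ 2) =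
     (n%:R ^+ 4 - m%:R ^+ 4) - rho ^+ 2 / 4 * (n%:R ^+ 4 - m%:R ^+ 4).
    by rewrite /gapc; ring.
  lra.
apply: (@le_trans _ _ (gapc * (n%:R ^+ 2 - m%:R ^+ 2))); last first.
  by move: key; rewrite ler_pM2r // addr_gt0.
by apply: ler_wpM2l; [exact: ltW gapc_gt0|nra].
Qed.

Lemma om_gap n m : (0 < m)%N -> (0 < n)%N ->
  gapc * (n%:R - m%:R) ^+ 2 <= `|om n - om m|.
Proof.
move=> m0 n0; case: (leqP m n) => [mn|/ltnW nm].
  by apply: (le_trans (om_diff m0 mn)); exact: ler_norm.
rewrite distrC; have := om_diff n0 nm.
have -> : (n%:R - m%:R) ^+ 2 = (m%:R - n%:R) ^+ 2 :> R by ring.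
by move=> h; apply: (le_trans h); exact: ler_norm.
Qed.

(** This separates an exponential from the complex conjugates of the others. *)
Lemma om_sum_gap n m : (0 < m)%N -> (0 < n)%N ->
  gapc * (n%:R - m%:R) ^+ 2 <= om n + om m.
Proof.
move=> m0 n0; have h1 := om_ge n0; have h2 := om_ge m0.
have : (n%:R - m%:R) ^+ 2 <= n%:R ^+ 2 + m%:R ^+ 2 :> R.
  have : (0 : R) <= n%:R * m%:R by rewrite mulr_ge0.
  nra.
by move=> h; have := ler_wpM2l (ltW gapc_gt0) h; lra.
Qed.

Lemma SS0 n : SS n 0 = 0.
Proof.
rewrite /SS /es; case: ifP => _; last by rewrite !mulr0 sin0 mulr0 mul0r.
by case: ifP => // _; rewrite mulr0 expR0 subrr mul0r.
Qed.

Lemma CC0 n : CC n 0 = 1.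
Proof.
rewrite /CC /ec /es; case: ifP => // _.
by rewrite !mulr0 sin0 cos0 expR0 !mulr0 addr0 mulr1.
Qed.

Lemma DS0 n : DS n 0 = 1.
Proof. by rewrite /DS SS0 CC0 mulr0 subr0. Qed.

Lemma DS_pos n t : (0 < n)%N -> DS n t = ec n t - sig n / om n * es n t.
Proof.
move=> n0; rewrite /DS /CC /SS gtn_eqF //.
by have := om_gt0 n0; move: (om n) => w w0; field; rewrite gt_eqF.
Qed.

Lemma DS_zero t : DS 0 t = expR (- (2 * sig 0) * t).
Proof.
rewrite /DS /CC /SS eqxx; case: eqVneq => [->|s0].
  by rewrite !(mulr0, mul0r, oppr0, expR0, subr0).
by field.
Qed.

Lemma dSS n t : is_derive t (1 : R) (SS n) (DS n t).
Proof.
have [->|n0] := posnP n.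
  rewrite DS_zero /SS eqxx; case: eqVneq => [->|s0].
    by rewrite mulr0 oppr0 mul0r expR0; exact: is_derive_id.
  have := is_derive1Z (- (2 * sig 0)^-1) (is_derive_expk (- (2 * sig 0)) t).
  move=> /(is_derive1D (is_derive_cst ((2 * sig 0)^-1) t 1)).
  have -> : (fun x => cst (2 * sig 0)^-1 x + - (2 * sig 0)^-1 * expR (- (2 * sig 0) * x)) =
    (fun t0 => (1 - expR (- (2 * sig 0) * t0)) / (2 * sig 0)).
    by apply/funext => x /=; field.
  by move=> h; apply: is_derive1_eq h _; field.
rewrite DS_pos //.
have -> : SS n = (fun t => (om n)^-1 * (expR (- sig n * t) * sin (om n * t))).
  by apply/funext => x; rewrite /SS gtn_eqF // mulrC.
apply: is_derive1_eq (is_derive1Z _ (is_derive_esin _ _ _)) _.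
by rewrite /ec /es; have := om_gt0 n0; move: (om n) => w w0; field; rewrite gt_eqF.
Qed.

Lemma dCC n t : is_derive t (1 : R) (CC n) (- n%:R ^+ 4 * SS n t).
Proof.
have [->|n0] := posnP n.
  by rewrite expr0n /= oppr0 mul0r /CC eqxx; exact: is_derive_cst.
have -> : CC n = (fun t => (expR (- sig n * t) * cos (om n * t)) +
    (sig n / om n) * (expR (- sig n * t) * sin (om n * t))).
  by apply/funext => x; rewrite /CC gtn_eqF.
apply: is_derive1_eq (is_derive1D (is_derive_ecos _ _ _)
  (is_derive1Z _ (is_derive_esin _ _ _))) _.
have -> : n%:R ^+ 4 = om n ^+ 2 + sig n ^+ 2 by rewrite om2 // subrK.
rewrite /SS gtn_eqF // /es.
by have := om_gt0 n0; move: (om n) => w w0; field; rewrite gt_eqF.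
Qed.

Lemma dDS n t : is_derive t (1 : R) (DS n) (- n%:R ^+ 4 * SS n t - 2 * sig n * DS n t).
Proof.
have := is_derive1D (dCC n t) (is_derive1Z (- (2 * sig n)) (dSS n t)).
have -> : (fun x => CC n x + - (2 * sig n) * SS n x) = DS n.
  by apply/funext => x; rewrite /DS mulNr.
by rewrite mulNr [X in _ + X]mulNr.
Qed.

Lemma SS_cont n : continuous (SS n).
Proof. exact: is_derive_continuous (dSS n). Qed.

Lemma CC_cont n : continuous (CC n).
Proof. exact: is_derive_continuous (dCC n). Qed.

Lemma DS_cont n : continuous (DS n).
Proof. exact: is_derive_continuous (dDS n). Qed.

Lemma ec_cont n : continuous (ec n).
Proof. apply: is_derive_continuous; exact: is_derive_ecos. Qed.

Lemma es_cont n : continuous (es n).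
Proof. apply: is_derive_continuous; exact: is_derive_esin. Qed.

(** The semigroup property of the modal evolution, together with [CCD] and [DSD]. It allows
    Duhamel's formula to be restarted, and mode 0 of F to be expanded anew, at any time. *)
Lemma SSD n x y : SS n (x + y) = SS n x * CC n y + DS n x * SS n y.
Proof.
have [->|n0] := posnP n.
  rewrite DS_zero /SS /CC eqxx mulr1; case: eqVneq => [->|s0].
    by rewrite !(mulr0, mul0r, oppr0, expR0, mul1r).
  by rewrite mulrDr expRD; field.
rewrite DS_pos // /SS /CC gtn_eqF // /ec /es !mulrDr sinD !expRD.
by have := om_gt0 n0; move: (om n) => w w0; field; rewrite gt_eqF.
Qed.

Lemma CCD n x y : CC n (x + y) = CC n x * CC n y - n%:R ^+ 4 * SS n x * SS n y.
Proof.
have [->|n0] := posnP n.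
  by rewrite /CC eqxx expr0n /= !mul0r subr0 mulr1.
have -> : n%:R ^+ 4 = om n ^+ 2 + sig n ^+ 2 by rewrite om2 // subrK.
rewrite /SS /CC gtn_eqF // /ec /es !mulrDr sinD cosD !expRD.
by have := om_gt0 n0; move: (om n) => w w0; field; rewrite gt_eqF.
Qed.

Lemma DSD n x y : DS n (x + y) = - n%:R ^+ 4 * SS n x * SS n y + DS n x * DS n y.
Proof. by rewrite /DS CCD SSD /DS; ring. Qed.

End Modes.

(** * The direct inequality *)

Section Direct.
Context {R : realType}.
Implicit Types (a b t x y : R) (n m : nat).

Definition ndist k n : nat := if (k < n)%N then (n - k)%N else (k - n)%N.

Lemma ndist_sym k n : ndist k n = ndist n k.
Proof. by rewrite /ndist; case: ltngtP => // ->. Qed.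

(** Each distance is attained at most twice, once on each side of n. *)
Lemma sum_ndist (f : nat -> R) (B : R) n N : (forall m, 0 <= f m) ->
  (forall M, \sum_(m < M) f m.+1 <= B) ->
  \sum_(k < N | k != n :> nat) f (ndist k n) <= 2 * B.
Proof.
move=> f0 fB.
rewrite (bigID (fun k : 'I_N => (k < n)%N)) /=.
have -> : 2 * B = B + B by ring.
apply: lerD.
  have -> : \sum_(i < N | (i != n :> nat) && (i < n)%N) f (ndist i n) =
      \sum_(i < N | (i < n)%N) f (n - i)%N.
    by apply: eq_big => [i|i /andP[_ h]]; [case: ltngtP|rewrite /ndist h].
  rewrite (big_ord_widen_cond (N + n) (fun i => (i < n)%N) (fun i => f (n - i)%N)) ?leq_addr //.
  apply: (@le_trans _ _ (\sum_(i < N + n | (i < n)%N) f (n - i)%N)).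
    rewrite [leRHS](bigID (fun i : 'I_(N + n) => (i < N)%N)) /= lerDl.
    by apply: sumr_ge0.
  rewrite -(big_ord_widen _ (fun i => f (n - i)%N)) ?leq_addl //.
  rewrite -(big_mkord xpredT (fun i => f (n - i)%N)) big_nat_rev /= big_mkord.
  rewrite (eq_bigr (fun i : 'I_n => f i.+1)); first exact: fB.
  by move=> i _; congr f; have := ltn_ord i; lia.
have -> : \sum_(i < N | (i != n :> nat) && ~~ (i < n)%N) f (ndist i n) =
    \sum_(i < N | (n < i)%N) f (i - n)%N.
  apply: eq_big => [i|i /andP[_ h]]; first by case: ltngtP.
  by rewrite /ndist (negbTE h).
have -> : \sum_(i < N | (n < i)%N) f (i - n)%N = \sum_(m < N - n.+1) f m.+1.
  elim: N => [|N IH]; first by rewrite !big_ord0.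
  rewrite big_mkcond big_ord_recr -big_mkcond /= IH.
  case: ltnP => h; last by have [-> ->] : (N.+1 - n.+1 = 0)%N /\ (N - n.+1 = 0)%N;
    [lia|rewrite !big_ord0 addr0].
  have -> : (N.+1 - n.+1 = (N - n.+1).+1)%N by lia.
  by rewrite big_ord_recr /=; congr (_ + f _); lia.
exact: fB.
Qed.

Lemma sum_inv_sq M : \sum_(m < M) (m.+1%:R ^- 2 : R) <= 2.
Proof.
suff h : (0 < M)%N -> \sum_(m < M) (m.+1%:R ^- 2 : R) <= 2 - M%:R^-1.
  have [->|M0] := posnP M; first by rewrite big_ord0.
  apply: (le_trans (h M0)); have : (0 : R) <= M%:R^-1 by rewrite invr_ge0.
  lra.
elim: M => // -[|M] IH _; first by rewrite big_ord1 expr1n invr1; lra.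
rewrite big_ord_recr /=; have {}IH := IH isT.
apply: (le_trans (lerD IH (lexx _))).
set x : R := M.+1%:R; have x0 : 0 < x by rewrite ltr0n.
have -> : M.+2%:R = x + 1 :> R by rewrite /x -[M.+2]addn1 natrD.
have -> : 2 - x^-1 + (x + 1) ^- 2 = 2 - (x + 1)^-1 - (x * (x + 1) ^+ 2)^-1.
  by field; apply/andP; split; apply/eqP; lra.
by rewrite lerBlDr lerDl invr_ge0 mulr_ge0 ?sqr_ge0 // ltW.
Qed.

Lemma ndist_natr k n : ((ndist k n)%:R : R) ^+ 2 = (k%:R - n%:R) ^+ 2.
Proof.
rewrite /ndist; case: ltnP => h; rewrite natrB //; last exact: ltnW.
by ring.
Qed.

(** Since 2 |c_n c_m| <= c_n^2 + c_m^2, it suffices that the rows and the columns of f(|n - m|) have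
    sums at most 2 B. *)
Lemma schur_test (e : nat -> nat -> R) (f : nat -> R) (B : R) N (c : nat -> R) :
  (forall m, 0 <= f m) -> (forall M, \sum_(m < M) f m.+1 <= B) ->
  (forall n m, n != m -> `|e n m| <= f (ndist n m)) ->
  \sum_(n < N) \sum_(m < N | m != n :> nat) c n * c m * e n m <=
  2 * B * \sum_(n < N) c n ^+ 2.
Proof.
move=> f0 fB ef.
apply: (@le_trans _ _ (\sum_(n < N) \sum_(m < N | m != n :> nat)
   (c n ^+ 2 / 2 * f (ndist m n) + c m ^+ 2 / 2 * f (ndist n m)))).
  apply: ler_sum => n _; apply: ler_sum => m mn.
  apply: (le_trans (ler_norm _)); rewrite !normrM.
  have h : `|e n m| <= f (ndist n m) by apply: ef; rewrite eq_sym.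
  rewrite (ndist_sym m n) -mulrDl.
  apply: (@le_trans _ _ (`|c n| * `|c m| * f (ndist n m))).
    by apply: ler_wpM2l => //; exact: mulr_ge0.
  apply: ler_wpM2r => //.
  have -> : c n ^+ 2 = `|c n| ^+ 2 by rewrite real_normK ?num_real.
  have -> : c m ^+ 2 = `|c m| ^+ 2 by rewrite real_normK ?num_real.
  by have := sqr_ge0 (`|c n| - `|c m|); nra.
under eq_bigr do rewrite big_split /=.
rewrite big_split /=.
have bnd : \sum_(i < N) \sum_(i0 < N | i0 != i :> nat) c i ^+ 2 / 2 * f (ndist i0 i) <=
    B * \sum_(n < N) c n ^+ 2.
  rewrite mulr_sumr; apply: ler_sum => i _; rewrite -mulr_sumr.
  have := sum_ndist i N f0 fB => h.
  have c0 : 0 <= c i ^+ 2 / 2 by rewrite divr_ge0 ?sqr_ge0.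
  have := ler_wpM2l c0 h; lra.
have -> : 2 * B * \sum_(n < N) c n ^+ 2 = B * \sum_(n < N) c n ^+ 2 + B * \sum_(n < N) c n ^+ 2.
  by ring.
apply: lerD => //.
rewrite (exchange_big_dep xpredT) //=.
apply: le_trans bnd; apply: ler_sum => i _.
rewrite le_eqVlt; apply/orP; left; apply/eqP.
by apply: eq_bigl => j; rewrite eq_sym.
Qed.

(** The diagonal contributes K0. For the rest Schur's test applies with f(m) = K / m^2, whose sum is
    at most 2 K, whence 4 K. *)
Lemma gram_direct a b (f : nat -> R -> R) (K0 K : R) N (c : nat -> R) :
  0 <= K -> (forall n, sqint a b (f n)) ->
  (forall n, Iab a b (fun t => f n t ^+ 2) <= K0) ->
  (forall n m, n != m -> `|Iab a b (fun t => f n t * f m t)| <= K / (n%:R - m%:R) ^+ 2) ->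
  Iab a b (fun t => (\sum_(n < N) c n * f n t) ^+ 2) <= (K0 + 4 * K) * \sum_(n < N) c n ^+ 2.
Proof.
move=> Kp sf h0 h.
have -> : Iab a b (fun t => (\sum_(n < N) c n * f n t) ^+ 2) =
   \sum_(n < N) \sum_(m < N) c n * c m * Iab a b (fun t => f n t * f m t).
  have E : forall n m, iab a b (fun t => (c n * c m) * (f n t * f m t)).
    by move=> n m; apply: iabZ; exact: sqint_prod.
  transitivity (Iab a b (fun t => \sum_(n < N) \sum_(m < N) (c n * c m) * (f n t * f m t))).
    apply: Iab_eq => t _; rewrite expr2 mulr_suml; apply: eq_bigr => n _.
    by rewrite mulr_sumr; apply: eq_bigr => m _; ring.
  rewrite Iab_sum; last by move=> n; apply: iab_sum.
  apply: eq_bigr => n _; rewrite Iab_sum //; apply: eq_bigr => m _.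
  by rewrite IabZ //; exact: sqint_prod.
under eq_bigr => n _ do rewrite (bigD1 n) //=.
rewrite big_split /= mulrDl; apply: lerD.
  rewrite mulr_sumr; apply: ler_sum => n _.
  rewrite mulrC -expr2; apply: ler_wpM2r; first exact: sqr_ge0.
  by apply: le_trans (h0 n); rewrite le_eqVlt; apply/orP; left; apply/eqP; apply: Iab_eq.
have -> : 4 * K = 2 * (2 * K) by ring.
apply: (@schur_test (fun n m => Iab a b (fun t => f n t * f m t)) (fun m => K / m%:R ^+ 2) (2 * K)).
- by move=> m; rewrite divr_ge0 // sqr_ge0.
- move=> M; rewrite -mulr_sumr mulrC; apply: ler_wpM2r => //; exact: sum_inv_sq.
- by move=> n m nm; rewrite ndist_natr; exact: h.
Qed.

(** Duality: with c_n the moments themselves, the left-hand side S is the pairing of h with the sum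
    of the c_n f_n, so that S^2 <= |h|^2 D S. *)
Lemma bessel a b (f : nat -> R -> R) (D : R) N (h : R -> R) :
  0 <= D -> (forall n, sqint a b (f n)) -> sqint a b h ->
  (forall c : nat -> R, Iab a b (fun t => (\sum_(n < N) c n * f n t) ^+ 2) <=
     D * \sum_(n < N) c n ^+ 2) ->
  \sum_(n < N) Iab a b (fun t => h t * f n t) ^+ 2 <= D * Iab a b (fun t => h t ^+ 2).
Proof.
move=> D0 sf sh dir.
pose c n := Iab a b (fun t => h t * f n t).
set S := (X in X <= _).
have S0 : 0 <= S by apply: sumr_ge0 => n _; exact: sqr_ge0.
have SE : S = Iab a b (fun t => h t * \sum_(n < N) c n * f n t).
  transitivity (Iab a b (fun t => \sum_(n < N) c n * (h t * f n t))).
    rewrite Iab_sum; last by move=> n; apply: iabZ; exact: sqint_prod.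
    by apply: eq_bigr => n _; rewrite IabZ //; exact: sqint_prod.
  by apply: Iab_eq => t _; rewrite mulr_sumr; apply: eq_bigr => n _; ring.
have sF : sqint a b (fun t => \sum_(n < N) c n * f n t).
  by apply: sqint_sum => n; exact: sqintZ.
have CS := cauchy_schwarz sh sF; rewrite -SE in CS.
set H := Iab a b (fun t => h t ^+ 2) in CS *.
have H0 : 0 <= H by apply: Iab_ge0 => t _; exact: sqr_ge0.
have := ler_wpM2l H0 (dir c); rewrite -/S => h2.
have {CS h2}h3 : S * S <= H * (D * S) by rewrite -expr2; exact: le_trans CS h2.
have [->|Sn0] := eqVneq S 0; first exact: mulr_ge0.
have Sp : 0 < S by rewrite lt_neqAle eq_sym Sn0.
by move: h3; rewrite mulrA ler_pM2r // mulrC.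
Qed.

Lemma is_derive_affine (F : R -> R) (k d t df : R) :
  is_derive (k * t + d) (1 : R) F df ->
  is_derive t (1 : R) (fun u => F (k * u + d)) (k * df).
Proof.
move=> h.
have h2 : is_derive t (1 : R) (fun u => k * u + d) k.
  by have := is_derive1D (is_derive_lin k t) (is_derive_cst d t (1 : R)); rewrite addr0.
by have := is_derive1_comp (f := F) (g := fun u => k * u + d) h h2; rewrite mulrC.
Qed.

Lemma affine_cont (F : R -> R) (k d : R) : continuous F -> continuous (fun u => F (k * u + d)).
Proof.
move=> cF x; apply: (@continuous_comp _ _ _ (fun u => k * u + d) F); last exact: cF.
by apply: cvgD; [apply: cvgM; [exact: cvg_cst|exact: cvg_id]|exact: cvg_cst].
Qed.

(** The variable k t + d with k = 1 or -1 covers forward and reversed time; its sign condition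
    selects the direction of decay. The primitive G below is at most (s + |nu|) / (s^2 + nu^2) <= 2
    / |nu|, uniformly in the damping s. *)
Lemma oscillatory_integral_le a b (k d s nu : R) : a <= b -> k ^+ 2 = 1 ->
  (forall t, a <= t <= b -> 0 <= k * t + d) -> 0 <= s -> nu != 0 ->
  `|Iab a b (fun t => expR (- s * (k * t + d)) * cos (nu * (k * t + d)))| <= 4 / `|nu|.
Proof.
move=> ab k1 x0 s0 n0.
have q0 : s ^+ 2 + nu ^+ 2 != 0.
  by rewrite gt_eqF // ltr_wpDl ?sqr_ge0 // exprn_even_gt0.
pose G x : R := (- s * (expR (- s * x) * cos (nu * x)) + nu * (expR (- s * x) * sin (nu * x))) /
   (s ^+ 2 + nu ^+ 2).
have dG x : is_derive x (1 : R) G (expR (- s * x) * cos (nu * x)).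
  have := is_derive1Z (s ^+ 2 + nu ^+ 2)^-1
    (is_derive1D (is_derive1Z (- s) (is_derive_ecos s nu x))
                 (is_derive1Z nu (is_derive_esin s nu x))).
  have -> : (fun x => (s ^+ 2 + nu ^+ 2)^-1 *
    (- s * (expR (- s * x) * cos (nu * x)) + nu * (expR (- s * x) * sin (nu * x)))) = G.
    by apply/funext => y; rewrite mulrC.
  by move=> h; apply: is_derive1_eq h _; field.
have cE : continuous (fun t => expR (- s * (k * t + d)) * cos (nu * (k * t + d))).
  apply: (@affine_cont (fun x => expR (- s * x) * cos (nu * x))).
  exact: is_derive_continuous (fun t => is_derive_ecos s nu t).
have dE (t : R) : is_derive t (1 : R) (fun t => k * G (k * t + d))
    (expR (- s * (k * t + d)) * cos (nu * (k * t + d))).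
  apply: is_derive1_eq (is_derive1Z k (is_derive_affine (dG _))) _.
  by rewrite mulrA -expr2 k1 mul1r.
rewrite (ftc ab cE dE).
have G1 x : 0 <= x -> `|G x| <= 2 / `|nu|.
  move=> xp; rewrite /G normrM normfV.
  have q1 : 0 < s ^+ 2 + nu ^+ 2 by rewrite lt_neqAle eq_sym q0 addr_ge0 ?sqr_ge0.
  rewrite (gtr0_norm q1) ler_pdivrMr //.
  have e1 : `|expR (- s * x)| <= 1.
    rewrite ger0_norm ?expR_ge0 // -expR0 ler_expR; nra.
  have h1 : `|expR (- s * x) * cos (nu * x)| <= 1.
    by rewrite normrM mulr_ile1 ?normr_ge0 // ler_norml cos_geN1 cos_le1.
  have h2 : `|expR (- s * x) * sin (nu * x)| <= 1.
    by rewrite normrM mulr_ile1 ?normr_ge0 // ler_norml sin_geN1 sin_le1.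
  apply: (le_trans (ler_normD _ _)); rewrite !normrM normrN.
  rewrite !normrM in h1 h2.
  have np : 0 < `|nu| by rewrite normr_gt0.
  have -> : nu ^+ 2 = `|nu| ^+ 2 by rewrite real_normK ?num_real.
  apply: (@le_trans _ _ (s + `|nu|)).
    by rewrite (ger0_norm s0); apply: lerD; rewrite ler_piMr.
  rewrite -ler_pdivrMl ?divr_gt0 // invf_div.
  have -> : `|nu| / 2 * (s + `|nu|) = (`|nu| * s + `|nu| ^+ 2) / 2 by field.
  by have := sqr_ge0 (s - `|nu|); have := sqr_ge0 s; nra.
have kn : `|k| = 1.
  by apply/eqP; rewrite -sqrp_eq1 // real_normK ?num_real // k1.
apply: (le_trans (ler_normB _ _)); rewrite !(normrM k) kn !mul1r.
have -> : 4 / `|nu| = 2 / `|nu| + 2 / `|nu| by field; rewrite normr_eq0.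
by apply: lerD; apply: G1; apply: x0; rewrite ?ab ?lexx.
Qed.

Context (alpha rho : R).
Context (halpha : 0 <= alpha < 1) (hrho : 0 < rho < 2).
Local Notation sig := (damp alpha rho).
Local Notation om := (om alpha rho).
Local Notation ec := (dampcos alpha rho).
Local Notation es := (dampsin alpha rho).
Local Notation gapc := (gapc rho).

(** The integrand is a product of two modes written as a sum: e = 1 gives the cosines and e = -1 the
    sines. Both frequencies om_n - om_m and om_n + om_m are at least c (n - m)^2 in absolute
    value. *)
Let mode_product a b (k d e : R) n m : a <= b -> k ^+ 2 = 1 ->
  (forall t, a <= t <= b -> 0 <= k * t + d) ->
  (0 < n)%N -> (0 < m)%N -> n != m -> e ^+ 2 = 1 ->
  `|Iab a b (fun t => 2^-1 *
      (expR (- (sig n + sig m) * (k * t + d)) * cos ((om n - om m) * (k * t + d)) +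
       e * (expR (- (sig n + sig m) * (k * t + d)) * cos ((om n + om m) * (k * t + d)))))|
  <= 4 / gapc / (n%:R - m%:R) ^+ 2.
Proof.
move=> ab k1 x0 n0 m0 nm e1.
have cI (nu : R) : iab a b (fun t => expR (- (sig n + sig m) * (k * t + d)) * cos (nu * (k * t + d))).
  apply: iab_cont.
  apply: (@affine_cont (fun x => expR (- (sig n + sig m) * x) * cos (nu * x))).
  exact: is_derive_continuous (fun t => is_derive_ecos (sig n + sig m) nu t).
rewrite IabZ; last by apply: iabD => //; exact: iabZ.
rewrite IabD //; last exact: iabZ.
rewrite IabZ // normrM (@ger0_norm _ 2^-1) //.
have g0 := gapc_gt0 hrho.
have d0 : (0 : R) < (n%:R - m%:R) ^+ 2.
  by rewrite exprn_even_gt0 //= subr_eq0 eqr_nat.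
have s0 : 0 <= sig n + sig m by rewrite addr_ge0 // sig_ge0.
have B nu : gapc * (n%:R - m%:R) ^+ 2 <= `|nu| ->
    `|Iab a b (fun t => expR (- (sig n + sig m) * (k * t + d)) * cos (nu * (k * t + d)))| <=
    4 / gapc / (n%:R - m%:R) ^+ 2.
  move=> h; have np : 0 < `|nu| by apply: lt_le_trans h; exact: mulr_gt0.
  apply: (le_trans (oscillatory_integral_le ab k1 x0 s0 _)); first by rewrite -normr_gt0.
  rewrite -mulrA -invfM; apply: ler_wpM2l => //.
  by rewrite lef_pV2 // posrE; exact: mulr_gt0.
have en : `|e| = 1 by apply/eqP; rewrite -sqrp_eq1 // real_normK ?num_real // e1.
have b1 := B _ (om_gap halpha hrho m0 n0).
have b2 : gapc * (n%:R - m%:R) ^+ 2 <= `|om n + om m|.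
  exact: le_trans (om_sum_gap halpha hrho m0 n0) (ler_norm _).
have {}b2 := B _ b2.
have := ler_normD (Iab a b (fun t => expR (- (sig n + sig m) * (k * t + d)) * cos ((om n - om m) * (k * t + d))))
  (e * Iab a b (fun t => expR (- (sig n + sig m) * (k * t + d)) * cos ((om n + om m) * (k * t + d)))).
rewrite normrM en mul1r; lra.
Qed.

Lemma ec_product a b (k d : R) n m : a <= b -> k ^+ 2 = 1 ->
  (forall t, a <= t <= b -> 0 <= k * t + d) ->
  (0 < n)%N -> (0 < m)%N -> n != m ->
  `|Iab a b (fun t => ec n (k * t + d) * ec m (k * t + d))| <=
  4 / gapc / (n%:R - m%:R) ^+ 2.
Proof.
move=> ab k1 x0 n0 m0 nm.
have := mode_product ab k1 x0 n0 m0 nm (expr1n _ 2).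
congr (`| _ | <= _); apply: Iab_eq => t _.
set x := k * t + d.
by rewrite /ec opprD !(mulrDl _ _ x) expRD (mulNr (om m)) cosB cosD; field.
Qed.

Lemma es_product a b (k d : R) n m : a <= b -> k ^+ 2 = 1 ->
  (forall t, a <= t <= b -> 0 <= k * t + d) ->
  (0 < n)%N -> (0 < m)%N -> n != m ->
  `|Iab a b (fun t => es n (k * t + d) * es m (k * t + d))| <=
  4 / gapc / (n%:R - m%:R) ^+ 2.
Proof.
move=> ab k1 x0 n0 m0 nm.
have e1 : (-1 : R) ^+ 2 = 1 by rewrite sqrrN expr1n.
have := mode_product ab k1 x0 n0 m0 nm e1.
congr (`| _ | <= _); apply: Iab_eq => t _.
set x := k * t + d.
by rewrite /es opprD !(mulrDl _ _ x) expRD (mulNr (om m)) cosB cosD; field.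
Qed.

Lemma ec_le1 n x : 0 <= x -> ec n x ^+ 2 + es n x ^+ 2 <= 1.
Proof.
move=> x0; rewrite /ec /es !exprMn -mulrDr cos2Dsin2 mulr1 -expRM_natl.
by rewrite -[leRHS]expR0 ler_expR; have := mulr_ge0 (sig_ge0 alpha hrho n) x0; lra.
Qed.

(** L bounds the diagonal of the Gram matrix, as the modes are at most 1, and 16 / c = 4 (4 / c) is
    the contribution of the other entries. *)
Definition direct_const (L : R) : R := L + 16 / gapc.
Local Notation dirc := direct_const.

Lemma dirc_ge0 L : 0 <= L -> 0 <= dirc L.
Proof. by move=> L0; rewrite addr_ge0 // divr_ge0 // ltW // gapc_gt0. Qed.

Lemma direct_ec a b (k d : R) N (c : nat -> R) : a <= b -> k ^+ 2 = 1 ->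
  (forall t, a <= t <= b -> 0 <= k * t + d) ->
  Iab a b (fun t => (\sum_(n < N) c n * ec n.+1 (k * t + d)) ^+ 2) <=
  dirc (b - a) * \sum_(n < N) c n ^+ 2.
Proof.
move=> ab k1 x0; have g0 := gapc_gt0 hrho.
have -> : dirc (b - a) = (b - a) + 4 * (4 / gapc) by rewrite /dirc; ring.
apply: (@gram_direct a b (fun n t => ec n.+1 (k * t + d))).
- by rewrite divr_ge0 // ltW.
- by move=> n; apply: sqint_cont; apply: affine_cont; exact: ec_cont.
- move=> n; apply: (@le_trans _ _ (Iab a b (fun=> 1))); last by rewrite Iab_cst // mul1r.
  apply: Iab_le.
  + have [//] := sqint_cont a b (affine_cont (k := k) (d := d) (@ec_cont _ alpha rho n.+1)).
  + by apply: iab_cont; exact: cst_continuous.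
  + move=> t /andP[t1 t2].
    have xp : 0 <= k * t + d by apply: x0; rewrite !ltW.
    have := @ec_le1 n.+1 (k * t + d) xp.
    by have := sqr_ge0 (es n.+1 (k * t + d)); lra.
- move=> n m nm; have := @ec_product a b k d n.+1 m.+1 ab k1 x0 isT isT.
  by rewrite eqSS => /(_ nm); rewrite -[n.+1]addn1 -[m.+1]addn1 !natrD opprD addrACA subrr addr0.
Qed.

Lemma direct_es a b (k d : R) N (c : nat -> R) : a <= b -> k ^+ 2 = 1 ->
  (forall t, a <= t <= b -> 0 <= k * t + d) ->
  Iab a b (fun t => (\sum_(n < N) c n * es n.+1 (k * t + d)) ^+ 2) <=
  dirc (b - a) * \sum_(n < N) c n ^+ 2.
Proof.
move=> ab k1 x0; have g0 := gapc_gt0 hrho.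
have -> : dirc (b - a) = (b - a) + 4 * (4 / gapc) by rewrite /dirc; ring.
apply: (@gram_direct a b (fun n t => es n.+1 (k * t + d))).
- by rewrite divr_ge0 // ltW.
- by move=> n; apply: sqint_cont; apply: affine_cont; exact: es_cont.
- move=> n; apply: (@le_trans _ _ (Iab a b (fun=> 1))); last by rewrite Iab_cst // mul1r.
  apply: Iab_le.
  + have [//] := sqint_cont a b (affine_cont (k := k) (d := d) (@es_cont _ alpha rho n.+1)).
  + by apply: iab_cont; exact: cst_continuous.
  + move=> t /andP[t1 t2].
    have xp : 0 <= k * t + d by apply: x0; rewrite !ltW.
    have := @ec_le1 n.+1 (k * t + d) xp.
    by have := sqr_ge0 (ec n.+1 (k * t + d)); lra.
- move=> n m nm; have := @es_product a b k d n.+1 m.+1 ab k1 x0 isT isT.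
  by rewrite eqSS => /(_ nm); rewrite -[n.+1]addn1 -[m.+1]addn1 !natrD opprD addrACA subrr addr0.
Qed.

Lemma bessel_modes a b (k d : R) N (h : R -> R) : a <= b -> k ^+ 2 = 1 ->
  (forall t, a <= t <= b -> 0 <= k * t + d) -> sqint a b h ->
  \sum_(n < N) (Iab a b (fun t => h t * ec n.+1 (k * t + d)) ^+ 2 +
                Iab a b (fun t => h t * es n.+1 (k * t + d)) ^+ 2) <=
  2 * dirc (b - a) * Iab a b (fun t => h t ^+ 2).
Proof.
move=> ab k1 x0 sh; rewrite big_split /=.
have D0 : 0 <= dirc (b - a) by apply: dirc_ge0; rewrite subr_ge0.
have -> : forall x y : R, 2 * x * y = x * y + x * y by move=> x y; ring.
apply: lerD.
- apply: (@bessel a b (fun n t => ec n.+1 (k * t + d))) => //.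
    by move=> n; apply: sqint_cont; apply: affine_cont; exact: ec_cont.
  by move=> c; exact: direct_ec.
- apply: (@bessel a b (fun n t => es n.+1 (k * t + d))) => //.
    by move=> n; apply: sqint_cont; apply: affine_cont; exact: es_cont.
  by move=> c; exact: direct_es.
Qed.

End Direct.

(** * Annihilation of exponentials *)

Section Kill.
Context {R : realType}.
Local Notation C := (complex R).
Implicit Types (a b t x y : R) (z u v : C) (h : R -> C).

Definition n2 z : R := complex.Re z ^+ 2 + complex.Im z ^+ 2.

Definition cexp z : C :=
  Complex (expR (complex.Re z) * cos (complex.Im z)) (expR (complex.Re z) * sin (complex.Im z)).

Definition rc x : C := Complex x 0.

Lemma n2_ge0 z : 0 <= n2 z. Proof. by rewrite addr_ge0 ?sqr_ge0. Qed.

Lemma normc_sq z : Normc.normc z ^+ 2 = n2 z.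
Proof. by case: z => x y; rewrite /Normc.normc /n2 sqr_sqrtr // addr_ge0 ?sqr_ge0. Qed.

Lemma normc_ge0 z : 0 <= Normc.normc z.
Proof. by case: z => x y; rewrite /Normc.normc sqrtr_ge0. Qed.

Lemma n2M z u : n2 (z * u) = n2 z * n2 u.
Proof. by rewrite -!normc_sq Normc.normcM exprMn. Qed.

Lemma cexpD z u : cexp (z + u) = cexp z * cexp u.
Proof.
case: z => a b; case: u => c d; apply/eqP; rewrite eq_complex /= expRD sinD cosD.
by apply/andP; split; apply/eqP; ring.
Qed.

Lemma cexp0 : cexp 0 = 1.
Proof. by apply/eqP; rewrite eq_complex /= expR0 sin0 cos0 !mulr0 mulr1 !eqxx. Qed.

Lemma n2_cexp z : n2 (cexp z) = expR (2 * complex.Re z).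
Proof. by rewrite /n2 /= !exprMn -mulrDr cos2Dsin2 mulr1 -expRM_natl. Qed.

Lemma cexp_rc z x : cexp (z * rc x) =
  Complex (expR (complex.Re z * x) * cos (complex.Im z * x)) (expR (complex.Re z * x) * sin (complex.Im z * x)).
Proof. by case: z => a b; rewrite /cexp /= !mulr0 subr0 add0r. Qed.

Lemma rcD x y : rc (x + y) = rc x + rc y.
Proof. by apply/eqP; rewrite eq_complex /= addr0 !eqxx. Qed.

Lemma rcN x : rc (- x) = - rc x.
Proof. by apply/eqP; rewrite eq_complex /= oppr0 !eqxx. Qed.

Lemma rcM x y : rc (x * y) = rc x * rc y.
Proof. by apply/eqP; rewrite eq_complex /= !mulr0 mul0r subr0 addr0 !eqxx. Qed.

Lemma cexpDx z x y : cexp (z * rc (x + y)) = cexp (z * rc x) * cexp (z * rc y).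
Proof. by rewrite rcD mulrDr cexpD. Qed.

(** Convexity of the square with weights |c0| and |c1|. Nothing is lost when |c0| + |c1| = 1, which
    is essential because the step is iterated over an unbounded number of exponentials. *)
Lemma n2_convex c0 c1 u v :
  n2 (c0 * u + c1 * v) <= (Normc.normc c0 + Normc.normc c1) *
    (Normc.normc c0 * n2 u + Normc.normc c1 * n2 v).
Proof.
rewrite -!normc_sq.
have h : Normc.normc (c0 * u + c1 * v) <=
    Normc.normc c0 * Normc.normc u + Normc.normc c1 * Normc.normc v.
  by rewrite -!Normc.normcM; exact: le_normcD.
move: h (normc_ge0 (c0 * u + c1 * v)) (normc_ge0 c0) (normc_ge0 c1) (normc_ge0 u) (normc_ge0 v).
move: (Normc.normc (c0 * u + c1 * v)) (Normc.normc c0) (Normc.normc c1) (Normc.normc u) (Normc.normc v).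
move=> w p q x y h w0 p0 q0 x0 y0.
apply: (@le_trans _ _ ((p * x + q * y) ^+ 2)).
  by rewrite ler_sqr ?nnegrE // addr_ge0 // mulr_ge0.
rewrite -subr_ge0.
have -> : (p + q) * (p * x ^+ 2 + q * y ^+ 2) - (p * x + q * y) ^+ 2 = p * q * (x - y) ^+ 2 by ring.
by rewrite mulr_ge0 ?sqr_ge0 // mulr_ge0.
Qed.

Lemma contD (f g : R -> R) : continuous f -> continuous g -> continuous (fun x => f x + g x).
Proof. by move=> cf cg x; apply: cvgD; [exact: cf|exact: cg]. Qed.

Lemma contM (f g : R -> R) : continuous f -> continuous g -> continuous (fun x => f x * g x).
Proof. by move=> cf cg x; apply: cvgM; [exact: cf|exact: cg]. Qed.

Lemma contN (f : R -> R) : continuous f -> continuous (fun x => - f x).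
Proof. by move=> cf x; apply: cvgN; exact: cf. Qed.

Lemma cont_shift (f : R -> R) c : continuous f -> continuous (fun x => f (x + c)).
Proof.
move=> cf; have := affine_cont (k := 1) (d := c) cf.
by under eq_fun do rewrite mul1r.
Qed.

Definition ccont h : Prop :=
  continuous (fun t => complex.Re (h t)) /\ continuous (fun t => complex.Im (h t)).

Lemma ccont_eq h1 h2 : h1 =1 h2 -> ccont h1 -> ccont h2.
Proof. by move=> /funext ->. Qed.

Lemma cReD z u : complex.Re (z + u) = complex.Re z + complex.Re u.
Proof. by case: z; case: u. Qed.
Lemma cImD z u : complex.Im (z + u) = complex.Im z + complex.Im u.
Proof. by case: z; case: u. Qed.
Lemma cReM z u : complex.Re (z * u) = complex.Re z * complex.Re u - complex.Im z * complex.Im u.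
Proof. by case: z; case: u. Qed.
Lemma cImM z u : complex.Im (z * u) = complex.Re z * complex.Im u + complex.Im z * complex.Re u.
Proof. by case: z; case: u. Qed.

Lemma ccontD h1 h2 : ccont h1 -> ccont h2 -> ccont (fun t => h1 t + h2 t).
Proof.
move=> [a1 b1] [a2 b2]; split.
- by under eq_fun do rewrite cReD; exact: contD.
- by under eq_fun do rewrite cImD; exact: contD.
Qed.

Lemma ccontM h1 h2 : ccont h1 -> ccont h2 -> ccont (fun t => h1 t * h2 t).
Proof.
move=> [a1 b1] [a2 b2]; split.
- by under eq_fun do rewrite cReM; apply: contD; [|apply: contN]; exact: contM.
- by under eq_fun do rewrite cImM; apply: contD; exact: contM.
Qed.

Lemma ccont_cst z : ccont (fun=> z).
Proof. by split; exact: cst_continuous. Qed.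

Lemma ccont_rc (f : R -> R) : continuous f -> ccont (fun t => rc (f t)).
Proof. by move=> cf; split => //=; exact: cst_continuous. Qed.

Lemma ccont_cexp z : ccont (fun t => cexp (z * rc t)).
Proof.
have e : (fun t => cexp (z * rc t)) = (fun t =>
  Complex (expR (- - complex.Re z * t) * cos (complex.Im z * t)) (expR (- - complex.Re z * t) * sin (complex.Im z * t))).
  by apply/funext => t; rewrite cexp_rc opprK.
rewrite e; split => /=.
- exact: is_derive_continuous (fun t => is_derive_ecos (- complex.Re z) (complex.Im z) t).
- exact: is_derive_continuous (fun t => is_derive_esin (- complex.Re z) (complex.Im z) t).
Qed.

Lemma ccont_sum (I : Type) (s : seq I) (h : I -> R -> C) :
  (forall i, ccont (h i)) -> ccont (fun t => \sum_(i <- s) h i t).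
Proof.
move=> hc; elim: s => [|i s IH].
  by apply: (@ccont_eq (fun=> 0)); [move=> t; rewrite big_nil|exact: ccont_cst].
apply: (@ccont_eq (fun t => h i t + \sum_(i <- s) h i t)); first by move=> t; rewrite big_cons.
exact: ccontD.
Qed.

Lemma ccont_shift h c : ccont h -> ccont (fun t => h (t + c)).
Proof. by move=> [a b]; split; [exact: (cont_shift (c := c) a)|exact: (cont_shift (c := c) b)]. Qed.

Lemma n2_cont h : ccont h -> continuous (fun t => n2 (h t)).
Proof. by move=> [a b]; rewrite /n2; apply: contD; under eq_fun do rewrite expr2; exact: contM. Qed.

(** On (0, L - a) both h and its translate see only values on (0, L): a shift costs length, and the
    norm grows only through the coefficients. *)
Lemma killstep (L a M : R) h c0 c1 : 0 <= a -> a <= L -> ccont h ->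
  (Normc.normc c0 + Normc.normc c1) ^+ 2 <= M ->
  Iab 0 (L - a) (fun t => n2 (c0 * h t + c1 * h (t + a))) <= M * Iab 0 L (fun t => n2 (h t)).
Proof.
move=> a0 aL ch hM.
have c2 := n2_cont ch.
have c2s := n2_cont (ccont_shift a ch).
set S := Normc.normc c0 + Normc.normc c1.
have p0 := normc_ge0 c0; have q0 := normc_ge0 c1.
have S0 : 0 <= S by rewrite addr_ge0.
set H := Iab 0 L _.
have h1 : Iab 0 (L - a) (fun t => n2 (h t)) <= H.
  apply: Iab_sub => //; first exact: iab_cont.
    by move=> x; exact: n2_ge0.
  by rewrite lerBlDr lerDl.
have h2 : Iab 0 (L - a) (fun t => n2 (h (t + a))) <= H.
  rewrite (@Iab_shift _ 0 (L - a) a (fun t => n2 (h t))) ?subr_ge0 // add0r subrK.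
  apply: Iab_sub => //; first exact: iab_cont.
  by move=> x; exact: n2_ge0.
have i1 : iab 0 (L - a) (fun t => n2 (h t)) by exact: iab_cont.
have i2 : iab 0 (L - a) (fun t => n2 (h (t + a))) by exact: iab_cont.
apply: (@le_trans _ _ (Iab 0 (L - a) (fun t => S *
    (Normc.normc c0 * n2 (h t) + Normc.normc c1 * n2 (h (t + a)))))).
  apply: Iab_le.
  - apply: iab_cont; apply: n2_cont; apply: ccontD; apply: ccontM => //;
      [exact: ccont_cst|exact: ccont_cst|exact: ccont_shift].
  - by apply: iabZ; apply: iabD; exact: iabZ.
  - by move=> t _; exact: n2_convex.
rewrite IabZ; last by apply: iabD; exact: iabZ.
rewrite IabD; try exact: iabZ.
rewrite !IabZ //.
have H0 : 0 <= H by apply: Iab_ge0 => t _; exact: n2_ge0.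
apply: (@le_trans _ _ (S * (S * H))).
  apply: ler_wpM2l => //; rewrite mulrDl; apply: lerD; exact: ler_wpM2l.
by rewrite mulrA -expr2; exact: ler_wpM2r.
Qed.

(* With c0 = [kc0 z a] and c1 = [kc1 z a], the operator h |-> c0 h + c1 h(. + a)
   preserves constants and annihilates exp(z t); [th] bounds the logarithm of its
   squared norm. *)
Definition kc1 z a : C := (1 - cexp (z * rc a))^-1.
Definition kc0 z a : C := 1 - kc1 z a.

Definition killable z a (th : R) : Prop :=
  [/\ 0 <= a, cexp (z * rc a) != 1 &
   (Normc.normc (kc0 z a) + Normc.normc (kc1 z a)) ^+ 2 <= expR th].

Lemma kill_root z a th : killable z a th -> kc0 z a + kc1 z a * cexp (z * rc a) = 0.
Proof.
move=> [_ e1 _]; rewrite /kc0 /kc1; set e := cexp _ in e1 *.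
by field; rewrite subr_eq0 eq_sym.
Qed.

Lemma kill_one z a : kc0 z a + kc1 z a = 1.
Proof. by rewrite /kc0 subrK. Qed.

(** Induction on the list, with the coefficients d arbitrary: each step changes them but preserves
    d0, while the shifts and the logarithmic costs add up. *)
Lemma kill (I : eqType) (s : seq I) (z : I -> C) (a th : I -> R) (d : I -> C) (d0 : C) (L : R) :
  (forall i, i \in s -> killable (z i) (a i) (th i)) -> \sum_(i <- s) a i <= L ->
  n2 d0 * (L - \sum_(i <- s) a i) <= expR (\sum_(i <- s) th i) *
    Iab 0 L (fun t => n2 (d0 + \sum_(i <- s) d i * cexp (z i * rc t))).
Proof.
elim: s d L => [|i s IH] d L hk.
  rewrite !big_nil expR0 mul1r subr0 => L0.
  have -> : Iab 0 L (fun t => n2 (d0 + \sum_(i <- [::]) d i * cexp (z i * rc t))) = Iab 0 L (fun=> n2 d0).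
    by apply: Iab_eq => t _; rewrite big_nil addr0.
  by rewrite Iab_cst // subr0.
rewrite !big_cons => hL.
have ki := hk i (mem_head _ _).
have hs : forall j, j \in s -> killable (z j) (a j) (th j).
  by move=> j js; apply: hk; rewrite inE js orbT.
have as0 : 0 <= \sum_(j <- s) a j.
  by rewrite big_seq; apply: sumr_ge0 => j js; case: (hs j js).
have ai : 0 <= a i by case: ki.
pose c0 := kc0 (z i) (a i); pose c1 := kc1 (z i) (a i).
(* The operator for z i multiplies exp(z_j t) by this factor, which vanishes for j = i. *)
pose d' j := d j * (c0 + c1 * cexp (z j * rc (a i))).
pose h t := d0 + \sum_(j <- i :: s) d j * cexp (z j * rc t).
have ch : ccont h.
  apply: ccontD; first exact: ccont_cst.
  by apply: ccont_sum => j; apply: ccontM; [exact: ccont_cst|exact: ccont_cexp].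
have := IH d' (L - a i) hs; rewrite lerBrDl => /(_ hL).
have -> : L - a i - \sum_(j <- s) a j = L - (a i + \sum_(j <- s) a j) by ring.
move=> h1; apply: (le_trans h1); rewrite expRD [expR (th i) * _]mulrC -mulrA.
apply: ler_wpM2l; first exact: expR_ge0.
have -> : Iab 0 (L - a i) (fun t => n2 (d0 + \sum_(j <- s) d' j * cexp (z j * rc t))) =
    Iab 0 (L - a i) (fun t => n2 (c0 * h t + c1 * h (t + a i))).
  apply: Iab_eq => t _; congr n2.
  have E x : h x = d0 + d i * cexp (z i * rc x) + \sum_(j <- s) d j * cexp (z j * rc x).
    by rewrite /h big_cons addrA.
  rewrite !E.
  have -> : \sum_(j <- s) d' j * cexp (z j * rc t) =
    c0 * (\sum_(j <- s) d j * cexp (z j * rc t)) +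
    c1 * (\sum_(j <- s) d j * cexp (z j * rc (t + a i))).
    rewrite !mulr_sumr -big_split /=; apply: eq_bigr => j _.
    by rewrite cexpDx /d'; ring.
  rewrite cexpDx.
  have r0 := kill_root ki; have r1 := kill_one (z i) (a i).
  rewrite -/c0 -/c1 in r0 r1.
  have -> : forall X Y e f : C,
    c0 * (d0 + d i * e + X) + c1 * (d0 + d i * (e * f) + Y) =
    (c0 + c1) * d0 + d i * e * (c0 + c1 * f) + (c0 * X + c1 * Y) by move=> *; ring.
  by rewrite r0 r1 mul1r mulr0 addr0.
apply: (le_trans (killstep ai _ ch _ )); last first.
- exact: lexx.
- by case: ki => _ _ h2; exact: h2.
- by apply: le_trans hL; rewrite lerDl.
Qed.

(** With r = exp(a Re z) and y = a Im z the squared norm is (1 + r)^2 / ((1 - r)^2 + 2 r (1 - cos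
    y)). It is at most 2 / (1 - cos y) for every r > 0, hence uniformly in Re z. *)
Lemma killableP z a : 0 <= a -> cos (complex.Im z * a) < 1 ->
  killable z a (ln (2 / (1 - cos (complex.Im z * a)))).
Proof.
move=> a0 c1; set y := complex.Im z * a in c1 *.
set r := expR (complex.Re z * a).
have r0 : 0 < r by exact: expR_gt0.
have eE : cexp (z * rc a) = Complex (r * cos y) (r * sin y) by rewrite cexp_rc.
have e1 : cexp (z * rc a) != 1.
  rewrite eE eq_complex /=; apply/negP => /andP[/eqP h1 /eqP h2].
  have s0 : sin y = 0 by move/eqP: h2; rewrite mulf_eq0 gt_eqF //= => /eqP.
  have := cos2Dsin2 y; rewrite s0 expr0n /= addr0 => c2.
  have cp : 0 < cos y by rewrite -(pmulr_rgt0 _ r0) h1 ltr01.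
  have u1 : 0 < 1 - cos y by rewrite subr_gt0.
  have u2 : 0 < 1 + cos y by lra.
  have := mulr_gt0 u1 u2; have -> : (1 - cos y) * (1 + cos y) = 1 - cos y ^+ 2 by ring.
  by rewrite c2 subrr ltxx.
split => //.
have n1 : Normc.normc (kc1 z a) = (Normc.normc (1 - cexp (z * rc a)))^-1.
  by rewrite /kc1 Normc.normcV.
have e1' : 1 - cexp (z * rc a) != 0 by rewrite subr_eq0 eq_sym.
have n0 : Normc.normc (kc0 z a) = r * (Normc.normc (1 - cexp (z * rc a)))^-1.
  have -> : kc0 z a = (- cexp (z * rc a)) * kc1 z a by rewrite /kc0 /kc1; field.
  rewrite Normc.normcM n1; congr (_ * _).
  rewrite eE /Normc.normc /= !sqrrN !exprMn -mulrDr cos2Dsin2 mulr1.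
  by rewrite sqrtr_sqr ger0_norm // ltW.
rewrite n0 n1.
have -> : r / Normc.normc (1 - cexp (z * rc a)) + (Normc.normc (1 - cexp (z * rc a)))^-1 =
   (r + 1) / Normc.normc (1 - cexp (z * rc a)) by rewrite mulrDl mul1r.
rewrite expr_div_n normc_sq eE /n2 /= sub0r sqrrN lnK; last first.
  by rewrite posrE divr_gt0 // subr_gt0.
have -> : (1 - r * cos y) ^+ 2 + (r * sin y) ^+ 2 = (1 - r) ^+ 2 + 2 * r * (1 - cos y).
  have -> : (r * sin y) ^+ 2 = r ^+ 2 * (1 - cos y ^+ 2) by rewrite exprMn sin2cos2.
  ring.
have c1' : 0 < 1 - cos y by rewrite subr_gt0.
have D0 : 0 < (1 - r) ^+ 2 + 2 * r * (1 - cos y).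
  by rewrite ltr_wpDl ?sqr_ge0 // !mulr_gt0.
rewrite ler_pdivrMr // mulrC mulrA ler_pdivlMr //.
have : cos y >= -1 by exact: cos_geN1.
have := sqr_ge0 (1 - r); nra.
Qed.

End Kill.

(** * Shifts and costs for quadratically separated exponents *)

Section Shifts.
Context {R : realType}.
Local Notation C := (complex R).
Implicit Types (t x y L : R) (n m k N K : nat).
Context (alpha rho : R).
Context (halpha : 0 <= alpha < 1) (hrho : 0 < rho < 2).
Local Notation sig := (damp alpha rho).
Local Notation om := (om alpha rho).
Local Notation gapc := (gapc rho).
Local Notation g0 := (gapc_gt0 hrho).

(* For n >= 1 the pair (n, true) encodes sigma_n - i om_n and (n, false) its
   conjugate; both pairs with n = 0 encode 2 sigma_0. *)
Definition mu n : C := Complex (sig n) (- om n).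

Definition exponent (i : nat * bool) : C :=
  if i.1 == 0%N then rc (2 * sig 0) else if i.2 then mu i.1 else Complex (sig i.1) (om i.1).

Definition exp_diff n i : C := exponent i - mu n.

Definition idx N : seq (nat * bool) := allpairs pair (iota 0 N) [:: true; false].

Definition idx_but n N := [seq i <- idx N | i != (n, true)].

Lemma cImN (z : C) : complex.Im (- z) = - complex.Im z. Proof. by case: z. Qed.
(** Three cases: mode 0, a frequency of the same sign, and one of the opposite sign. The second
    bound is needed for the conjugate (n, false), at index distance 0, where the first one is
    empty. *)
Lemma Im_exp_diff_gap n i : (0 < n)%N -> i != (n, true) ->
  gapc * (ndist i.1 n)%:R ^+ 2 <= `|complex.Im (exp_diff n i)| /\ gapc <= `|complex.Im (exp_diff n i)|.
Proof.
move=> n0; case: i => k b /= h.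
have g1 := g0; have on := om_ge halpha hrho n0.
have n1 : (1 : R) <= n%:R by rewrite ler1n.
have n2 : (1 : R) <= n%:R ^+ 2 by rewrite exprn_ege1.
have gn : gapc <= om n by apply: le_trans on; rewrite ler_pMr.
rewrite ndist_natr.
have -> : complex.Im (exp_diff n (k, b)) =
    if k == 0%N then om n else if b then om n - om k else om k + om n.
  rewrite /exp_diff /exponent cImD cImN /= opprK; case: (k == 0%N) => /=; first by rewrite add0r.
  by case: b {h} => //=; rewrite addrC.
case: eqVneq => [->|k0].
  by rewrite sub0r sqrrN ger0_norm; [split|lra].
have kp : (0 < k)%N by rewrite lt0n.
have k1 : gapc <= om k.
  apply: le_trans (om_ge halpha hrho kp); rewrite ler_pMr //.
  by rewrite exprn_ege1 // ler1n.
case: b h => h /=.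
  have kn : k != n by apply: contra h => /eqP ->.
  have gg := om_gap halpha hrho n0 kp; rewrite distrC in gg.
  split => //; apply: le_trans gg; rewrite ler_pMr //.
  rewrite -ndist_natr exprn_ege1 // ler1n /ndist.
  by case: (ltnP k n) => h1; rewrite subn_gt0 // ltn_neqAle eq_sym kn.
have gs := om_sum_gap halpha hrho n0 kp.
by rewrite ger0_norm; [split => //; lra|lra].
Qed.

(** The shift pi / |y| for the smallest admissible gap |y| = c. *)
Definition shift_const : R := pi / gapc.

Lemma shift_const_gt0 : 0 < shift_const. Proof. by rewrite divr_gt0 ?pi_gt0 ?g0. Qed.

(* A shift by pi/|y| makes exp(z a) a negative real number, so the operator has
   norm 1 at no cost. It is too long for the finitely many small y, which get a
   shorter shift at the cost [kill_cost_max]. *)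
Definition kill_shift K y : R := Num.min (shift_const / K%:R ^+ 2) (pi / `|y|).

Definition kill_cost_max K : R := ln (2 / (1 - cos (pi / K%:R ^+ 2))).

Definition kill_cost K y : R := if gapc * K%:R ^+ 2 <= `|y| then 0 else kill_cost_max K.

Lemma cos_piK K : (0 < K)%N -> cos (pi / K%:R ^+ 2) < 1 :> R.
Proof.
move=> K0; have p0 := pi_gt0 R.
have K1 : (1 : R) <= K%:R ^+ 2 by rewrite exprn_ege1 // ler1n.
rewrite -[ltRHS]cos0 ltr_cos ?in_itv /= ?lexx ?(ltW p0) //.
- by rewrite divr_gt0 // (lt_le_trans _ K1).
- have Kp : (0 : R) < K%:R ^+ 2 by exact: lt_le_trans K1.
  by rewrite divr_ge0 ?(ltW p0) ?(ltW Kp) //= ler_pdivrMr // ler_peMr // ltW.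
Qed.

Lemma kill_cost_max_ge0 K : (0 < K)%N -> 0 <= kill_cost_max K.
Proof.
move=> K0; apply: ln_ge0; rewrite ler_pdivlMr ?subr_gt0 ?cos_piK // mul1r.
by have := cos_geN1 (pi / K%:R ^+ 2 : R); lra.
Qed.

Lemma killableW (z : C) a th th' : killable z a th -> th <= th' -> killable z a th'.
Proof. by move=> [h1 h2 h3] h; split => //; apply: le_trans h3 _; rewrite ler_expR. Qed.

Lemma cos_norm y : cos `|y| = cos y :> R.
Proof. by have [h|h] := lerP 0 y; [rewrite ger0_norm|rewrite ltr0_norm // cosN]. Qed.

(** If |y| >= c K^2 the shift is pi / |y|, the cosine is -1 and the cost is ln 1 = 0. Otherwise the
    shift is pi / (c K^2), and its product with |y| lies between pi / K^2 and pi, where the cosine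
    decreases; the worst case is the lower end. *)
Lemma killable_shift K (z : C) : (0 < K)%N -> gapc <= `|complex.Im z| ->
  killable z (kill_shift K (complex.Im z)) (kill_cost K (complex.Im z)).
Proof.
move=> K0 gy; set y := complex.Im z in gy *.
have y0 : 0 < `|y| by apply: lt_le_trans gy; exact: g0.
have K1 : (1 : R) <= K%:R ^+ 2 by rewrite exprn_ege1 // ler1n.
have Kp : (0 : R) < K%:R ^+ 2 by exact: lt_le_trans K1.
have p0 := pi_gt0 R; have g1 := g0; have B0 := shift_const_gt0.
have a0 : 0 <= kill_shift K y.
  by rewrite /kill_shift le_min !divr_ge0 // ltW.
have cE a : cos (y * a) = cos (`|y| * `|a|) :> R by rewrite -normrM cos_norm.
rewrite /kill_cost; case: ifPn => [h|]; last rewrite -ltNge => h.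
  have aE : kill_shift K y = pi / `|y|.
    apply/min_idPr; rewrite /shift_const -mulrA -invfM ler_pM2l // lef_pV2 ?posrE //.
    exact: mulr_gt0.
  have c1 : cos (y * kill_shift K y) = -1.
    rewrite cE (ger0_norm a0) aE.
    by rewrite mulrC divfK ?gt_eqF // cospi.
  apply: killableW (killableP a0 _) _; first by rewrite -/y c1; lra.
  by rewrite -/y c1 opprK divff ?ln1.
have aE : kill_shift K y = shift_const / K%:R ^+ 2.
  apply/min_idPl; rewrite /shift_const -mulrA -invfM ler_pM2l // lef_pV2 ?posrE //.
    exact: ltW.
  exact: mulr_gt0.
have gE : gapc * (shift_const / K%:R ^+ 2) = pi / K%:R ^+ 2.
  by rewrite /shift_const; field; rewrite pnatr_eq0 -lt0n K0 gt_eqF.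
have b1 : pi / K%:R ^+ 2 <= `|y| * `|kill_shift K y|.
  rewrite -gE (ger0_norm a0) aE; apply: ler_wpM2r => //.
  by rewrite divr_ge0 // ltW.
have b2 : `|y| * `|kill_shift K y| <= pi.
  rewrite (ger0_norm a0) aE.
  apply: (@le_trans _ _ (gapc * K%:R ^+ 2 * (shift_const / K%:R ^+ 2))).
    by apply: ler_wpM2r (ltW h); rewrite divr_ge0 // ltW.
  by rewrite /shift_const le_eqVlt; apply/orP; left; apply/eqP; field; rewrite pnatr_eq0 -lt0n K0 gt_eqF.
have b0 : 0 < pi / K%:R ^+ 2 :> R by exact: divr_gt0.
have cle : cos (y * kill_shift K y) <= cos (pi / K%:R ^+ 2).
  rewrite cE; rewrite leNgt; apply/negP.
  rewrite ltr_cos ?in_itv /= ?b2 ?(ltW b0) ?mulr_ge0 ?(le_trans b1) //.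
  by rewrite ltNge b1.
have clt := cos_piK K0.
apply: killableW (killableP a0 (le_lt_trans cle clt)) _.
rewrite /kill_cost_max ler_ln ?posrE ?divr_gt0 ?subr_gt0 ?(le_lt_trans cle) //.
by apply: ler_wpM2l => //; rewrite lef_pV2 ?posrE ?subr_gt0 ?(le_lt_trans cle) // lerD2l lerN2.
Qed.

(** The bounds pi / (c K^2) and pi / (c m^2) merge into one that is summable in m and small for
    large K, because K + m is at most twice the larger of the two. *)
Lemma kill_shift_le K m y : (0 < K)%N -> gapc * m%:R ^+ 2 <= `|y| -> gapc <= `|y| ->
  kill_shift K y <= 4 * shift_const / (K + m)%:R ^+ 2.
Proof.
move=> K0 h gy; have B0 := shift_const_gt0; have g1 := g0; have p0 := pi_gt0 R.
have Kp : (0 : R) < K%:R by rewrite ltr0n.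
have m0 : (0 : R) <= m%:R by rewrite ler0n.
have KM : (0 : R) < (K%:R + m%:R) ^+ 2 by rewrite exprn_gt0 // ltr_wpDr.
rewrite natrD.
case: (leqP m K) => mK.
  apply: (@le_trans _ _ (shift_const / K%:R ^+ 2)); first by rewrite ge_min lexx.
  rewrite ler_pdivrMr ?exprn_gt0 // mulrAC ler_pdivlMr //.
  have : (m%:R : R) <= K%:R by rewrite ler_nat.
  move=> mk; have : (K%:R + m%:R) ^+ 2 <= 4 * K%:R ^+ 2 :> R.
    have -> : 4 * K%:R ^+ 2 = (2 * K%:R) ^+ 2 :> R by ring.
    by rewrite ler_sqr ?nnegrE; lra.
  by move=> /(ler_wpM2l (ltW B0)); lra.
have mp : (0 : R) < m%:R by rewrite ltr0n (leq_ltn_trans _ mK).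
apply: (@le_trans _ _ (shift_const / m%:R ^+ 2)).
  rewrite ge_min; apply/orP; right; rewrite /shift_const -mulrA -invfM ler_pM2l //.
  by rewrite lef_pV2 // posrE; [exact: lt_le_trans gy|rewrite mulr_gt0 // exprn_gt0].
rewrite ler_pdivrMr ?exprn_gt0 // mulrAC ler_pdivlMr //.
have : (K%:R : R) <= m%:R by rewrite ler_nat ltnW.
move=> mk; have : (K%:R + m%:R) ^+ 2 <= 4 * m%:R ^+ 2 :> R.
  have -> : 4 * m%:R ^+ 2 = (2 * m%:R) ^+ 2 :> R by ring.
  by rewrite ler_sqr ?nnegrE; lra.
by move=> /(ler_wpM2l (ltW B0)); lra.
Qed.

Lemma kill_cost_le K m y : (0 < K)%N -> gapc * m%:R ^+ 2 <= `|y| ->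
  kill_cost K y <= if (m < K)%N then kill_cost_max K else 0.
Proof.
move=> K0 h; rewrite /kill_cost; case: ifPn => [_|h1].
  by case: ifP => // _; exact: kill_cost_max_ge0.
case: ltnP => // Km; exfalso; move/negP: h1; apply; apply: le_trans h.
by apply: ler_wpM2l; [exact: ltW g0|rewrite ler_sqr ?nnegrE // ler_nat].
Qed.

(** Each k occurs with two signs and each distance at most twice, whence 4 B; the two indices with k
    = n give 2 f(0), the excluded one being added back. *)
Lemma sum_idx n N (F : nat * bool -> R) (f : nat -> R) (B : R) : (n < N)%N ->
  (forall m, 0 <= f m) -> (forall M, \sum_(m < M) f m.+1 <= B) ->
  (forall i, i != (n, true) -> F i <= f (ndist i.1 n)) ->
  \sum_(i <- idx_but n N) F i <= 2 * f 0%N + 4 * B.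
Proof.
move=> nN f0 fB Ff; rewrite big_filter.
apply: (@le_trans _ _ (\sum_(i <- idx N) f (ndist i.1 n))).
  rewrite [leRHS](bigID (fun i => i != (n, true))) /=.
  apply: ler_wpDr; first by apply: sumr_ge0.
  by apply: ler_sum => i; exact: Ff.
rewrite big_allpairs /=.
under eq_bigr do rewrite big_cons big_seq1 /=.
have -> : iota 0 N = index_iota 0 N by rewrite /index_iota subn0.
rewrite big_mkord big_split /=.
have h : \sum_(k < N) f (ndist k n) <= f 0%N + 2 * B.
  rewrite (bigD1 (Ordinal nN)) //= {1}/ndist ltnn subnn lerD2l.
  have := @sum_ndist R f B n N f0 fB.
  apply: le_trans; rewrite le_eqVlt; apply/orP; left; apply/eqP.
  by apply: eq_bigl => k.
lra.
Qed.

Lemma sum_inv_shift K M : (0 < K)%N -> \sum_(m < M) ((K + m.+1)%:R ^- 2 : R) <= K%:R^-1.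
Proof.
move=> K0; suff h : \sum_(m < M) ((K + m.+1)%:R ^- 2 : R) <= K%:R^-1 - (K + M)%:R^-1.
  by apply: (le_trans h); rewrite lerBlDr lerDl invr_ge0.
elim: M => [|M IH]; first by rewrite big_ord0 addn0 subrr.
rewrite big_ord_recr /=; apply: (le_trans (lerD IH (lexx _))).
set x : R := (K + M)%:R; have x0 : 0 < x by rewrite ltr0n addn_gt0 K0.
have -> : (K + M.+1)%:R = x + 1 :> R by rewrite addnS -addn1 natrD.
have -> : K%:R^-1 - x^-1 + (x + 1) ^- 2 = K%:R^-1 - (x + 1)^-1 - (x * (x + 1) ^+ 2)^-1.
  have kp : (0 : R) < K%:R by rewrite ltr0n.
  move: kp x0; move: (K%:R : R) x => kk x kp x0; field.
  by rewrite !gt_eqF ?addr_gt0.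
by rewrite lerBlDr lerDl invr_ge0 mulr_ge0 ?sqr_ge0 // ltW.
Qed.

(** The total length of the shifts tends to 0 as K grows, uniformly in n and N. This allows an
    arbitrarily short observation time. *)
Lemma sum_kill_shift K n N : (0 < K)%N -> (0 < n)%N -> (n < N)%N ->
  \sum_(i <- idx_but n N) kill_shift K (complex.Im (exp_diff n i)) <= 24 * shift_const / K%:R.
Proof.
move=> K0 n0 nN; have B0 := shift_const_gt0.
have Kp : (0 : R) < K%:R by rewrite ltr0n.
have K1 : (1 : R) <= K%:R by rewrite ler1n.
have := @sum_idx n N (fun i => kill_shift K (complex.Im (exp_diff n i)))
  (fun m => 4 * shift_const / (K + m)%:R ^+ 2) (4 * shift_const / K%:R) nN.
have f0 m : 0 <= 4 * shift_const / (K + m)%:R ^+ 2 by rewrite divr_ge0 ?sqr_ge0 // mulr_ge0 // ltW.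
move=> /(_ f0) h.
apply: le_trans (h _ _) _.
- move=> M; rewrite -mulr_sumr; apply: ler_wpM2l; first by rewrite mulr_ge0 // ltW.
  exact: sum_inv_shift.
- by move=> i /(Im_exp_diff_gap n0)[h1 h2]; exact: kill_shift_le.
rewrite addn0.
have : 4 * shift_const / K%:R ^+ 2 <= 4 * shift_const / K%:R.
  apply: ler_wpM2l; first by rewrite mulr_ge0 // ltW.
  by rewrite lef_pV2 ?posrE ?exprn_gt0 // expr2 ler_pMr.
have -> : 24 * shift_const / K%:R = 6 * (4 * shift_const / K%:R) by field; rewrite gt_eqF.
lra.
Qed.

(** Only exponents at index distance below K cost anything, so the cost does not depend on n or
    N. *)
Lemma sum_kill_cost K n N : (0 < K)%N -> (0 < n)%N -> (n < N)%N ->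
  \sum_(i <- idx_but n N) kill_cost K (complex.Im (exp_diff n i)) <= (2 + 4 * K%:R) * kill_cost_max K.
Proof.
move=> K0 n0 nN; have T0 := kill_cost_max_ge0 K0.
have := @sum_idx n N (fun i => kill_cost K (complex.Im (exp_diff n i)))
  (fun m => if (m < K)%N then kill_cost_max K else 0) (K%:R * kill_cost_max K) nN.
have f0 m : 0 <= if (m < K)%N then kill_cost_max K else 0 by case: ifP.
move=> /(_ f0) h.
apply: le_trans (h _ _) _.
- move=> M; apply: (@le_trans _ _ (\sum_(m < K) kill_cost_max K)); last first.
    by rewrite sumr_const card_ord -[X in X <= _]mulr_natl.
  have [MK|KM] := leqP M K.
    rewrite (big_ord_widen _ (fun m => if (m.+1 < K)%N then kill_cost_max K else 0) MK) big_mkcond /=.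
    by apply: ler_sum => m _; case: ifP => // _; case: ifP.
  rewrite (big_ord_widen _ (fun=> kill_cost_max K) (ltnW KM)) [leRHS]big_mkcond /=.
  by apply: ler_sum => m _; case: (ltnP m.+1 K) => [/ltnW ->|_] //; case: ifP.
- by move=> i /(Im_exp_diff_gap n0)[h1 h2]; exact: kill_cost_le.
rewrite K0; lra.
Qed.

End Shifts.

(** * Bounds on single coefficients *)

Section SingleCoefficient.
Context {R : realType}.
Local Notation C := (complex R).
Implicit Types (t x y L eps : R) (n m k N K : nat).
Context (alpha rho : R).
Context (halpha : 0 <= alpha < 1) (hrho : 0 < rho < 2).
Local Notation sig := (damp alpha rho).
Local Notation om := (om alpha rho).
Local Notation ec := (dampcos alpha rho).
Local Notation es := (dampsin alpha rho).
Local Notation SS := (Smode alpha rho).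
Local Notation DS := (dSmode alpha rho).
Local Notation gapc := (gapc rho).
Local Notation mu := (mu alpha rho).
Local Notation exponent := (exponent alpha rho).
Local Notation exp_diff := (exp_diff alpha rho).

Definition CI eps (h : R -> C) : C :=
  Complex (Iab 0 eps (fun s => complex.Re (h s))) (Iab 0 eps (fun s => complex.Im (h s))).

Lemma CI_eq eps h1 h2 : h1 =1 h2 -> CI eps h1 = CI eps h2.
Proof. by move=> /funext ->. Qed.

Lemma CID eps h1 h2 : ccont h1 -> ccont h2 ->
  CI eps (fun s => h1 s + h2 s) = CI eps h1 + CI eps h2.
Proof.
move=> [a1 b1] [a2 b2]; apply/eqP; rewrite eq_complex /= -!IabD; try exact: iab_cont.
by apply/andP; split; apply/eqP; apply: Iab_eq => s _; rewrite ?cReD ?cImD.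
Qed.

Lemma CIZ eps c h : ccont h -> CI eps (fun s => c * h s) = c * CI eps h.
Proof.
move=> [a1 b1]; apply/eqP; rewrite eq_complex; apply/andP; split; apply/eqP.
- transitivity (complex.Re c * Iab 0 eps (fun s => complex.Re (h s)) -
    complex.Im c * Iab 0 eps (fun s => complex.Im (h s))); last by rewrite cReM.
  rewrite -!IabZ; try exact: iab_cont.
  rewrite -IabB; try by apply: iabZ; exact: iab_cont.
  by apply: Iab_eq => s _; rewrite cReM.
- transitivity (complex.Re c * Iab 0 eps (fun s => complex.Im (h s)) +
    complex.Im c * Iab 0 eps (fun s => complex.Re (h s))); last by rewrite cImM.
  rewrite -!IabZ; try exact: iab_cont.
  rewrite -IabD; try by apply: iabZ; exact: iab_cont.
  by apply: Iab_eq => s _; rewrite cImM.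
Qed.

Lemma CI_sum eps (I : Type) (s : seq I) (h : I -> R -> C) : (forall i, ccont (h i)) ->
  CI eps (fun x => \sum_(i <- s) h i x) = \sum_(i <- s) CI eps (h i).
Proof.
move=> hc; elim: s => [|i s IH].
  rewrite big_nil; apply/eqP; rewrite eq_complex /=.
  by apply/andP; split; apply/eqP; rewrite -[RHS](mul0r (Iab 0 eps (fun=> 0))) -IabZ;
    try (by apply: iab_cont; exact: cst_continuous);
    by apply: Iab_eq => x _; rewrite big_nil mul0r.
rewrite big_cons -IH -CID //; last exact: ccont_sum.
by apply: CI_eq => x; rewrite big_cons.
Qed.

Lemma CI1 eps : 0 <= eps -> CI eps (fun=> 1) = rc eps.
Proof. by move=> e0; rewrite /CI /= !Iab_cst // mul0r mul1r subr0. Qed.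

Lemma cexp_mu n t : cexp (mu n * rc t) = Complex (ec n (- t)) (es n (- t)).
Proof. by rewrite cexp_rc /= /ec /es !mulrNN !mulNr mulrN. Qed.

Lemma cexp_Nmu n t : cexp (- mu n * rc t) = Complex (ec n t) (es n t).
Proof. by rewrite cexp_rc /= opprK. Qed.

Lemma cexp_muconj n t : cexp (Complex (sig n) (om n) * rc t) = Complex (ec n (- t)) (- es n (- t)).
Proof. by rewrite cexp_rc /= /ec /es !mulrN !mulNr opprK cosN sinN mulrN opprK. Qed.

(** Modal solutions evaluated at - t: this is how the adjoint solution reads when it is expanded at
    time 0. *)
Definition trigsum N (p q : R) (A B : nat -> R) t : R :=
  p + q * SS 0 (- t) + \sum_(k < N) (A k * ec k.+1 (- t) + B k * es k.+1 (- t)).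
Local Notation FF := trigsum.

Lemma cont_opp (f : R -> R) : continuous f -> continuous (fun t => f (- t)).
Proof.
move=> cf; have := affine_cont (k := -1) (d := 0) cf.
by under eq_fun do rewrite mulN1r addr0.
Qed.

Lemma cont_sum (I : Type) (s : seq I) (f : I -> R -> R) :
  (forall i, continuous (f i)) -> continuous (fun t => \sum_(i <- s) f i t).
Proof.
move=> hc; elim: s => [|i s IH].
  by under eq_fun do rewrite big_nil; exact: cst_continuous.
by under eq_fun do rewrite big_cons; exact: contD.
Qed.

Lemma FF_cont N p q A B : continuous (FF N p q A B).
Proof.
apply: contD.
  apply: contD; first exact: cst_continuous.
  apply: contM; first exact: cst_continuous.
  by apply: cont_opp; exact: SS_cont.
apply: cont_sum => k; apply: contD; (apply: contM; first exact: cst_continuous);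
  apply: cont_opp; [exact: ec_cont|exact: es_cont].
Qed.

(** A cosine and a sine with real coefficients split into two conjugate exponentials with
    coefficients (A -+ i B) / 2. Mode 0 stays outside, but its index remains available for the
    exponential that the annihilation leaves of it. *)
Definition coef (A B : nat -> R) (i : nat * bool) : C :=
  if i.1 == 0%N then 0 else
  Complex (A i.1.-1 / 2) (if i.2 then - (B i.1.-1 / 2) else B i.1.-1 / 2).

Lemma rc_sum (I : Type) (s : seq I) (f : I -> R) : rc (\sum_(i <- s) f i) = \sum_(i <- s) rc (f i).
Proof.
elim: s => [|i s IH]; first by rewrite !big_nil.
by rewrite !big_cons rcD IH.
Qed.

Lemma FF_complex N p q A B t : rc (FF N p q A B t) =
  rc p + rc q * rc (SS 0 (- t)) +
  \sum_(i <- idx N.+1) coef A B i * cexp (exponent i * rc t).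
Proof.
rewrite /FF !rcD rcM; congr (_ + _); rewrite rc_sum.
rewrite big_allpairs /=.
under [RHS]eq_bigr do rewrite big_cons big_seq1 /=.
have -> : 0%N :: iota 1 N = index_iota 0 N.+1 by rewrite /index_iota subn0.
rewrite big_mkord big_ord_recl /= /coef /= !mul0r !add0r.
apply: eq_bigr => k _; rewrite /bump /= /exponent /= cexp_mu cexp_muconj.
by apply/eqP; rewrite eq_complex /=; apply/andP; split; apply/eqP; field.
Qed.

(* Averaging against exp(- mu_n s) keeps the n-th coefficient up to the factor
   eps, and its sum over n is controlled by the Bessel inequality. *)
Definition filtered eps N p q A B n t : C :=
  Complex (Iab 0 eps (fun s => FF N p q A B (t + s) * ec n s))
          (Iab 0 eps (fun s => FF N p q A B (t + s) * es n s)).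

Lemma filtered_CI eps N p q A B n t : filtered eps N p q A B n t =
  CI eps (fun s => rc (FF N p q A B (t + s)) * cexp (- mu n * rc s)).
Proof.
rewrite /filtered /CI; congr Complex; apply: Iab_eq => s _.
- by rewrite cReM cexp_Nmu /= mul0r subr0.
- by rewrite cImM cexp_Nmu /= mul0r addr0.
Qed.

Definition filter_coef eps n i : C := CI eps (fun s => cexp (exp_diff n i * rc s)).

Lemma filter_coef_self eps n : 0 <= eps -> (0 < n)%N -> filter_coef eps n (n, true) = rc eps.
Proof.
move=> e0 n0; rewrite -CI1 //; apply: CI_eq => s.
by rewrite /exp_diff /exponent /= gtn_eqF // subrr mul0r cexp0.
Qed.

Lemma SS0D t s : SS 0 (- (t + s)) = SS 0 (- t) + DS 0 (- t) * SS 0 (- s).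
Proof. by rewrite opprD SSD // /Cmode eqxx mulr1. Qed.

Lemma SS0_DS t : DS 0 t = 1 - 2 * sig 0 * SS 0 t.
Proof. by rewrite /dSmode /Cmode eqxx. Qed.

(** Averaging over translates preserves the span of 1, S_0(- t) and the exponentials. The values of
    b0 and b1 may stay unspecified because mode 0 is eliminated afterwards. *)
Lemma filteredE eps N p q A B n : exists b0 b1 : C, forall t, filtered eps N p q A B n t =
  b0 + b1 * rc (SS 0 (- t)) +
  \sum_(i <- idx N.+1) coef A B i * filter_coef eps n i * cexp (exponent i * rc t).
Proof.
have cn := @ccont_cexp R (- mu n).
have cS : ccont (fun s => rc (SS 0 (- s))) by apply: ccont_rc; apply: cont_opp; exact: SS_cont.
pose k0 := CI eps (fun s => cexp (- mu n * rc s)).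
pose k1 := CI eps (fun s => rc (SS 0 (- s)) * cexp (- mu n * rc s)).
exists (rc p * k0 + rc q * k1), (rc q * k0 - rc q * rc (2 * sig 0) * k1) => t.
rewrite filtered_CI.
transitivity (CI eps (fun s => ((rc p + rc q * rc (SS 0 (- t))) * cexp (- mu n * rc s) +
   (rc q * rc (DS 0 (- t))) * (rc (SS 0 (- s)) * cexp (- mu n * rc s))) +
   \sum_(i <- idx N.+1) (coef A B i * cexp (exponent i * rc t)) * cexp (exp_diff n i * rc s))).
  apply: CI_eq => s; rewrite FF_complex SS0D rcD rcM !mulrDl mulr_suml.
  congr (_ + _); first by ring.
  apply: eq_bigr => i _; rewrite cexpDx /exp_diff [in RHS]mulrDl [in RHS]cexpD; ring.
rewrite CID; last 2 first.
- by apply: ccontD; apply: ccontM => //; [exact: ccont_cst|exact: ccont_cst|exact: ccontM].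
- by apply: ccont_sum => i; apply: ccontM; [exact: ccont_cst|exact: ccont_cexp].
rewrite CID; last 2 first.
- by apply: ccontM => //; exact: ccont_cst.
- by apply: ccontM => //; [exact: ccont_cst|exact: ccontM].
rewrite CIZ // CIZ; last exact: ccontM.
rewrite CI_sum; last by move=> i; apply: ccontM; [exact: ccont_cst|exact: ccont_cexp].
congr (_ + _).
  rewrite -/k0 -/k1 SS0_DS rcD rcN [rc (2 * sig 0 * _)]rcM.
  have -> : rc 1 = 1 :> C by [].
  ring.
by apply: eq_bigr => i _; rewrite CIZ ?/filter_coef; [ring|exact: ccont_cexp].
Qed.

Lemma idx_uniq N : uniq (idx N).
Proof. by apply: allpairs_uniq => //; [exact: iota_uniq|case=> a b [c d]]. Qed.

Lemma mem_idx N n b : (n < N)%N -> (n, b) \in idx N.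
Proof.
move=> nN; apply/allpairsP; exists (n, b); split => //=.
  by rewrite mem_iota.
by case: b.
Qed.

Lemma n2_rc x : n2 (rc x) = x ^+ 2 :> R.
Proof. by rewrite /n2 /= expr0n /= addr0. Qed.

Lemma ccont_filtered eps N p q A B n : ccont (filtered eps N p q A B n).
Proof.
have [b0 [b1 fE]] := filteredE eps N p q A B n.
apply: ccont_eq (fun t => esym (fE t)) _.
apply: ccontD.
  apply: ccontD; first exact: ccont_cst.
  apply: ccontM; first exact: ccont_cst.
  by apply: ccont_rc; apply: cont_opp; exact: SS_cont.
by apply: ccont_sum => i; apply: ccontM; [exact: ccont_cst|exact: ccont_cexp].
Qed.

(** The constants record the budget: 24 units of length remove the exponentials and one more reduces
    mode 0, which leaves at least L / 2; likewise 3 + 4 K = (2 + 4 K) + 1 in the cost. The factor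
    eps^2 / 4 is the squared modulus of eps (A - i B) / 2 without its coefficients. *)
Lemma coef_bound K eps L N p q A B k : (0 < K)%N -> 0 < eps ->
  25 * shift_const rho / K%:R <= L / 2 -> (k < N)%N ->
  eps ^+ 2 / 4 * (A k ^+ 2 + B k ^+ 2) * (L / 2) <=
  expR ((3 + 4 * K%:R) * kill_cost_max K) * Iab 0 L (fun t => n2 (filtered eps N p q A B k.+1 t)).
Proof.
move=> K0 e0 KL kN; set n := k.+1.
have n0 : (0 < n)%N by [].
have nN : (n < N.+1)%N by [].
have B0 := shift_const_gt0 hrho.
have Kp : (0 : R) < K%:R by rewrite ltr0n.
have K1 : (1 : R) <= K%:R by rewrite ler1n.
have L0 : 0 <= L.
  have : 0 <= 25 * shift_const rho / K%:R by apply: divr_ge0 => //; apply: mulr_ge0 => //; exact: ltW.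
  lra.
have [b0 [b1 fE]] := filteredE eps N p q A B n.
pose f := filtered eps N p q A B n.
pose h t := cexp (- mu n * rc t) * f t.
have ch : ccont h by apply: ccontM; [exact: ccont_cexp|exact: ccont_filtered].
pose d0 : C := coef A B (n, true) * rc eps.
have hE t : h t = d0 + \sum_(i <- idx_but n N.+1) coef A B i * filter_coef eps n i * cexp (exp_diff n i * rc t) +
    cexp (- mu n * rc t) * (b0 + b1 * rc (SS 0 (- t))).
  rewrite /h /f fE mulrDr addrC; congr (_ + _).
  rewrite mulr_sumr (bigD1_seq (n, true)) ?mem_idx ?idx_uniq //= big_filter.
  congr (_ + _).
    rewrite filter_coef_self ?ltW // mulrCA -cexpD -mulrDl /exponent /= addNr mul0r cexp0 mulr1.
    by [].
  apply: eq_bigr => i _; rewrite /exp_diff mulrDl cexpD; ring.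
(* The two solutions of mode 0 are first reduced to the single exponential
   exp(2 sigma_0 t) by annihilating exp(- mu_n t). *)
pose a0 := kill_shift rho K (om n).
have Imu : complex.Im (- mu n) = om n by rewrite /= opprK.
have onp := om_gt0 halpha hrho n0.
have gon : gapc <= `|om n|.
  rewrite gtr0_norm //; apply: le_trans (om_ge halpha hrho n0).
  by rewrite ler_pMr ?gapc_gt0 // exprn_ege1 // ler1n.
have kmu : killable (- mu n) a0 (kill_cost rho K (om n)).
  by rewrite /a0 -Imu; apply: killable_shift; rewrite ?Imu.
pose c0 := kc0 (- mu n) a0; pose c1 := kc1 (- mu n) a0.
(* What is left of b0 + b1 S_0(- t): the increment S_0(- t - a0) - S_0(- t) equals S_0'(- t) S_0(-
   a0), a multiple of exp(2 sigma_0 t). *)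
pose gam := c1 * cexp (- mu n * rc a0) * b1 * rc (SS 0 (- a0)).
pose D i := coef A B i * filter_coef eps n i * (c0 + c1 * cexp (exp_diff n i * rc a0)) +
   (if i == (0%N, true) then gam else 0).
have a0p : 0 <= a0 by case: kmu.
have hkE t : c0 * h t + c1 * h (t + a0) = d0 + \sum_(i <- idx_but n N.+1) D i * cexp (exp_diff n i * rc t).
  rewrite !hE.
  have -> : \sum_(i <- idx_but n N.+1) D i * cexp (exp_diff n i * rc t) =
     c0 * (\sum_(i <- idx_but n N.+1) coef A B i * filter_coef eps n i * cexp (exp_diff n i * rc t)) +
     c1 * (\sum_(i <- idx_but n N.+1) coef A B i * filter_coef eps n i * cexp (exp_diff n i * rc (t + a0))) +
     gam * cexp (exp_diff n (0%N, true) * rc t).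
    rewrite !mulr_sumr -big_split /=.
    have -> : gam * cexp (exp_diff n (0%N, true) * rc t) =
        \sum_(i <- idx_but n N.+1) (if i == (0%N, true) then gam else 0) * cexp (exp_diff n i * rc t).
      have m0 : (0%N, true) \in idx_but n N.+1 by rewrite mem_filter mem_idx // andbT.
      have uq : uniq (idx_but n N.+1) by rewrite filter_uniq // idx_uniq.
      rewrite (bigD1_seq (0%N, true) m0 uq) eqxx big1 => [|i /negPf ->]; last by rewrite mul0r.
      by rewrite /= addr0.
    rewrite -big_split /=; apply: eq_bigr => i _.
    rewrite cexpDx /D.
    set X := (if _ then _ else _).
    by move: X (cexp _) (cexp _) (coef _ _ _) (filter_coef _ _ _) => X e1 e2 cf kk; ring.
  have -> : gam * cexp (exp_diff n (0%N, true) * rc t) =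
      c1 * (cexp (- mu n * rc t) * cexp (- mu n * rc a0)) * b1 * (rc (DS 0 (- t)) * rc (SS 0 (- a0))).
    rewrite /gam /exp_diff /exponent /= mulrDl cexpD.
    have -> : cexp (rc (2 * sig 0) * rc t) = rc (DS 0 (- t)).
      by rewrite DS_zero cexp_rc /= !mul0r cos0 sin0 mulr1 mulr0 mulrNN.
    ring.
  rewrite SS0D [rc (SS 0 (- t) + _)]rcD rcM [cexp (- mu n * rc (t + a0))]cexpDx.
  have r0 := kill_root kmu; have r1 := kill_one (- mu n) a0.
  rewrite -/c0 -/c1 in r0 r1.
  have gen (X Y e g s w : C) : c0 * (d0 + X + e * (b0 + b1 * s)) +
      c1 * (d0 + Y + e * g * (b0 + b1 * (s + w))) =
      (c0 + c1) * d0 + (c0 + c1 * g) * (e * (b0 + b1 * s)) +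
      (c0 * X + c1 * Y + c1 * (e * g) * b1 * w) by ring.
  by rewrite gen r0 r1 mul0r mul1r addr0.
pose aS := \sum_(i <- idx_but n N.+1) kill_shift rho K (complex.Im (exp_diff n i)).
have aSb : aS <= 24 * shift_const rho / K%:R by exact: sum_kill_shift.
have a0b : a0 <= shift_const rho / K%:R.
  apply: (@le_trans _ _ (shift_const rho / K%:R ^+ 2)); first by rewrite ge_min lexx.
  apply: ler_wpM2l; first exact: ltW.
  by rewrite lef_pV2 ?posrE ?exprn_gt0 // expr2 ler_pMr.
have E25 : 25 * shift_const rho / K%:R = 24 * shift_const rho / K%:R + shift_const rho / K%:R by field; rewrite gt_eqF.
have hk i : i \in idx_but n N.+1 ->
    killable (exp_diff n i) (kill_shift rho K (complex.Im (exp_diff n i))) (kill_cost rho K (complex.Im (exp_diff n i))).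
  rewrite mem_filter => /andP[h1 _]; apply: killable_shift => //.
  by have [] := Im_exp_diff_gap halpha hrho n0 h1.
have aL : aS <= L - a0 by lra.
have main := kill D d0 hk aL.
have T0 := @kill_cost_max_ge0 R K K0.
have nd : n2 d0 = eps ^+ 2 / 4 * (A k ^+ 2 + B k ^+ 2).
  by rewrite /d0 n2M n2_rc /coef /n2 /= sqrrN; field.
rewrite -nd.
apply: (@le_trans _ _ (n2 d0 * (L - a0 - aS))).
  by apply: ler_wpM2l; [exact: n2_ge0|lra].
apply: (le_trans main).
have kst := killstep a0p _ ch.
have M1 : (Normc.normc c0 + Normc.normc c1) ^+ 2 <= expR (kill_cost_max K).
  case: kmu => _ _ /le_trans; apply; rewrite ler_expR /kill_cost.
  by case: ifP.
have a0L : a0 <= L.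
  have : 0 <= aS by rewrite /aS big_seq; apply: sumr_ge0 => i /hk[].
  lra.
have k1 := kst L _ c0 c1 a0L M1.
have -> : Iab 0 (L - a0) (fun t => n2 (d0 + \sum_(i <- idx_but n N.+1) D i * cexp (exp_diff n i * rc t))) =
    Iab 0 (L - a0) (fun t => n2 (c0 * h t + c1 * h (t + a0))).
  by apply: Iab_eq => t _; rewrite hkE.
(* The factor exp(- mu_n t) has modulus exp(- sigma_n t) <= 1 for t >= 0. *)
have h2 : Iab 0 L (fun t => n2 (h t)) <= Iab 0 L (fun t => n2 (f t)).
  apply: Iab_le.
  - by apply: iab_cont; exact: n2_cont.
  - by apply: iab_cont; apply: n2_cont; exact: ccont_filtered.
  - move=> t /andP[t0 _]; rewrite /h n2M n2_cexp ler_piMl ?n2_ge0 //.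
    rewrite -[leRHS]expR0 ler_expR cReM /= !mulr0 subr0.
    by have := mulr_ge0 (sig_ge0 alpha hrho n) (ltW t0); lra.
have H0 : 0 <= Iab 0 L (fun t => n2 (f t)) by apply: Iab_ge0 => t _; exact: n2_ge0.
apply: (@le_trans _ _ (expR ((2 + 4 * K%:R) * kill_cost_max K) *
   (expR (kill_cost_max K) * Iab 0 L (fun t => n2 (f t))))).
  apply: ler_pM; try exact: expR_ge0.
  - by apply: Iab_ge0 => t _; exact: n2_ge0.
  - by rewrite ler_expR; exact: sum_kill_cost.
  - by apply: (le_trans k1); apply: ler_wpM2l => //; exact: expR_ge0.
rewrite mulrA -expRD le_eqVlt; apply/orP; left; apply/eqP; congr (expR _ * _); ring.
Qed.

End SingleCoefficient.

(** * Observability *)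

Section Observability.
Context {R : realType}.
Implicit Types (t x y L eps : R) (n m k N K : nat).
Context (alpha rho : R).
Context (halpha : 0 <= alpha < 1) (hrho : 0 < rho < 2).
Local Notation sig := (damp alpha rho).
Local Notation ec := (dampcos alpha rho).
Local Notation es := (dampsin alpha rho).
Local Notation SS := (Smode alpha rho).
Local Notation DS := (dSmode alpha rho).
Local Notation FF := (trigsum alpha rho).
Local Notation filtered := (filtered alpha rho).
Local Notation dirc := (direct_const rho).

(** At fixed t the averages are the moments of F(t + .) on (0, eps) against decaying modes. *)
Lemma filtered_bessel eps N p q A B t : 0 <= eps ->
  \sum_(k < N) n2 (filtered eps N p q A B k.+1 t) <=
  2 * dirc eps * Iab 0 eps (fun s => FF N p q A B (t + s) ^+ 2).
Proof.
move=> e0.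
have x0 s : 0 <= s <= eps -> 0 <= 1 * s + 0 by case/andP; rewrite mul1r addr0.
have cF : continuous (fun s => FF N p q A B (t + s)).
  under eq_fun do rewrite addrC.
  by apply: cont_shift; exact: FF_cont.
have := bessel_modes halpha hrho N e0 (expr1n _ 2) x0 (sqint_cont 0 eps cF).
rewrite subr0; apply: le_trans; rewrite le_eqVlt; apply/orP; left; apply/eqP.
apply: eq_bigr => k _; rewrite /n2 /=.
by congr (_ ^+ 2 + _ ^+ 2); apply: Iab_eq => s _; rewrite mul1r addr0.
Qed.

Lemma observability_high L : 0 < L -> exists2 c : R, 0 <= c & forall N (p q : R) (A B : nat -> R),
  \sum_(k < N) (A k ^+ 2 + B k ^+ 2) <= c * Iab 0 L (fun t => FF N p q A B t ^+ 2).
Proof.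
(* One half of the observation time is spent on averaging, the other on annihilation. *)
move=> L0; pose e := L / 2; have e0 : 0 < e by rewrite divr_gt0.
have B0 := shift_const_gt0 hrho.
(* Large enough for the total shift 25 pi / (c K) to fit into e / 2. *)
pose K := (Num.bound (50 * shift_const rho / e)).+1.
have K0 : (0 < K)%N by [].
have Kp : (0 : R) < K%:R by rewrite ltr0n.
have hK : 25 * shift_const rho / K%:R <= e / 2.
  rewrite ler_pdivrMr // mulrC.
  have : 50 * shift_const rho / e < K%:R.
    apply: (@lt_le_trans _ _ (Num.bound (50 * shift_const rho / e))%:R).
      by apply: archi_boundP; apply: divr_ge0; [apply: mulr_ge0 => //; exact: ltW|exact: ltW].
    by rewrite ler_nat.
  rewrite ltr_pdivrMr // => h; lra.
pose E := expR ((3 + 4 * K%:R) * kill_cost_max K : R).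
have E0 : 0 < E by exact: expR_gt0.
have D0 : 0 <= dirc e by apply: (dirc_ge0 hrho); exact: ltW.
pose c := E * (2 * dirc e * e) / (e ^+ 2 / 4 * (e / 2)).
have q0 : 0 < e ^+ 2 / 4 * (e / 2) by rewrite !mulr_gt0 // ?invr_gt0 // exprn_gt0.
exists c.
  by rewrite divr_ge0 ?(ltW q0) // mulr_ge0 ?(ltW E0) // !mulr_ge0 // ltW.
move=> N p q A B; set H := Iab 0 L _.
rewrite /c mulrAC ler_pdivlMr // mulr_suml.
apply: (@le_trans _ _ (\sum_(k < N) E * Iab 0 e (fun t => n2 (filtered e N p q A B k.+1 t)))).
  apply: ler_sum => k _.
  have := coef_bound halpha hrho p q A B K0 e0 hK (ltn_ord k).
  by apply: le_trans; rewrite le_eqVlt; apply/orP; left; apply/eqP; ring.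
rewrite -mulr_sumr -[leRHS]mulrA; apply: ler_wpM2l; first exact: ltW.
have ci k : iab 0 e (fun t => n2 (filtered e N p q A B k.+1 t)).
  by apply: iab_cont; apply: n2_cont; exact: ccont_filtered.
rewrite -Iab_sum //.
have -> : 2 * dirc e * e * H = Iab 0 e (fun=> 2 * dirc e * H).
  by rewrite Iab_cst ?(ltW e0) // subr0; ring.
apply: Iab_le.
- by apply: iab_sum.
- by apply: iab_cont; exact: cst_continuous.
move=> t /andP[t0 te]; apply: (le_trans (filtered_bessel _ _ _ _ _ _ (ltW e0))).
apply: ler_wpM2l; first by rewrite mulr_ge0.
have cF : continuous (fun t => FF N p q A B t ^+ 2).
  by under eq_fun do rewrite expr2; apply: contM; exact: FF_cont.
have -> : Iab 0 e (fun s => FF N p q A B (t + s) ^+ 2) =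
    Iab 0 e (fun s => FF N p q A B (s + t) ^+ 2).
  by apply: Iab_eq => s _; rewrite addrC.
rewrite (@Iab_shift _ 0 e t (fun s => FF N p q A B s ^+ 2)) ?(ltW e0) //.
apply: Iab_sub.
- exact: iab_cont.
- by move=> x; exact: sqr_ge0.
- by rewrite add0r ltW.
- by rewrite /e in te *; lra.
Qed.

Lemma SS0_neq0 x : x != 0 -> SS 0 x != 0.
Proof.
move=> x0; rewrite /Smode eqxx; case: (eqVneq (sig 0) 0) => // s0.
have s2 : 2 * sig 0 != 0 by apply: mulf_neq0 => //; rewrite pnatr_eq0.
rewrite mulf_neq0 ?invr_eq0 //.
rewrite subr_eq0 eq_sym -[X in _ != X]expR0; apply: contra x0 => /eqP /expR_inj /eqP.
by rewrite mulf_eq0 oppr_eq0 mulf_eq0 pnatr_eq0 /= (negbTE s0).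
Qed.

Lemma DS0_ge1 t : 0 <= t -> 1 <= DS 0 (- t).
Proof.
move=> t0; rewrite DS_zero mulrNN -[leLHS]expR0 ler_expR.
by apply: mulr_ge0 => //; apply: mulr_ge0 => //; exact: sig_ge0.
Qed.

Lemma ecD n x y : ec n (x + y) = ec n x * ec n y - es n x * es n y.
Proof. by rewrite /dampcos /dampsin !mulrDr cosD expRD; ring. Qed.

Lemma esD n x y : es n (x + y) = es n x * ec n y + ec n x * es n y.
Proof. by rewrite /dampcos /dampsin !mulrDr sinD expRD; ring. Qed.

(** What remains is to bound p and q. Observability on the second half of the interval bounds the
    oscillating coefficients at time h; from there the oscillating part decays backwards, so the
    direct inequality bounds it on (0, h). Subtracting it from F leaves y = p + q S_0(- t), whose
    increments yield q, and then y itself yields p. *)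
Lemma observability L : 0 < L -> exists2 c : R, 0 <= c & forall N (p q : R) (A B : nat -> R),
  p ^+ 2 + q ^+ 2 + \sum_(k < N) (A k ^+ 2 + B k ^+ 2) <=
  c * Iab 0 L (fun t => FF N p q A B t ^+ 2).
Proof.
move=> L0; pose h := L / 2; have h0 : 0 < h by rewrite divr_gt0.
have [c0 c0p H0] := observability_high L0.
have [c1 c1p H1] := observability_high h0.
have D0 : 0 <= dirc h by apply: (dirc_ge0 hrho); exact: ltW.
pose c2 := 2 + 4 * dirc h * c1.
have c2p : 0 <= c2 by rewrite addr_ge0 // !mulr_ge0.
(* The increment of y over a step h / 2 is q S_0'(- t) s, where S_0'(- t) >= 1. *)
pose s := SS 0 (- (h / 2)).
have s0 : s != 0 by apply: SS0_neq0; rewrite oppr_eq0 gt_eqF // divr_gt0.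
have s2 : 0 < s ^+ 2 by rewrite exprn_even_gt0.
pose c3 := 4 * c2 / (s ^+ 2 * (h / 2)).
have q3 : 0 < s ^+ 2 * (h / 2) by rewrite mulr_gt0 // divr_gt0.
have c3p : 0 <= c3 by apply: divr_ge0; [exact: mulr_ge0|exact: ltW].
have cS : continuous (fun t => SS 0 (- t)) by apply: cont_opp; exact: SS_cont.
have csq (f : R -> R) : continuous f -> continuous (fun t => f t ^+ 2).
  by move=> cf; under eq_fun do rewrite expr2; exact: contM.
pose S2 := Iab 0 h (fun t => SS 0 (- t) ^+ 2).
have S2p : 0 <= S2 by apply: Iab_ge0 => t _; exact: sqr_ge0.
pose c4 := (2 * c2 + 2 * c3 * S2) / h.
have c4p : 0 <= c4.
  by apply: divr_ge0; last exact: ltW; have := mulr_ge0 c3p S2p; lra.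
exists (c4 + c3 + c0); first by rewrite !addr_ge0.
move=> N p q A B; set H := Iab 0 L _.
have cF := @FF_cont _ _ _ halpha hrho N p q A B.
have HF : 0 <= H by apply: Iab_ge0 => t _; exact: sqr_ge0.
(* The oscillating coefficients of F expanded at time h instead of 0. *)
pose A' k := A k * ec k.+1 (- h) + B k * es k.+1 (- h).
pose B' k := B k * ec k.+1 (- h) - A k * es k.+1 (- h).
pose y t := p + q * SS 0 (- t).
have cy : continuous y.
  apply: contD; first exact: cst_continuous.
  by apply: contM => //; exact: cst_continuous.
have E1 t : FF N (y h) (q * DS 0 (- h)) A' B' t = FF N p q A B (t + h).
  rewrite /trigsum; congr (_ + _).
    by rewrite /y [t + h]addrC SS0D //; ring.
  by apply: eq_bigr => k _; rewrite opprD ecD esD /A' /B'; ring.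
have tail1 : \sum_(k < N) (A' k ^+ 2 + B' k ^+ 2) <= c1 * H.
  apply: (le_trans (H1 N (y h) (q * DS 0 (- h)) A' B')); apply: ler_wpM2l => //.
  have -> : Iab 0 h (fun t => FF N (y h) (q * DS 0 (- h)) A' B' t ^+ 2) =
      Iab 0 h (fun t => FF N p q A B (t + h) ^+ 2) by apply: Iab_eq => t _; rewrite E1.
  rewrite (@Iab_shift _ 0 h h (fun t => FF N p q A B t ^+ 2)) ?(ltW h0) //; last exact: csq.
  apply: Iab_sub.
  - by apply: iab_cont; exact: csq.
  - by move=> x; exact: sqr_ge0.
  - by rewrite add0r ltW.
  - by rewrite /h; lra.
pose G t := \sum_(k < N) (A k * ec k.+1 (- t) + B k * es k.+1 (- t)).
have cG : continuous G.
  apply: cont_sum => k; apply: contD; (apply: contM; first exact: cst_continuous);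
  apply: cont_opp; [exact: ec_cont|exact: es_cont].
have GE t : G t = \sum_(k < N) A' k * ec k.+1 (-1 * t + h) + \sum_(k < N) B' k * es k.+1 (-1 * t + h).
  rewrite -big_split /=; apply: eq_bigr => k _.
  set X := -1 * t + h; have -> : - t = X + (- h) by rewrite /X; ring.
  rewrite (ecD _ X) (esD _ X) /A' /B'.
  have gen (a1 a2 a3 a4 u v : R) : u * (a1 * a3 - a2 * a4) + v * (a2 * a3 + a1 * a4) =
    (u * a3 + v * a4) * a1 + (v * a3 - u * a4) * a2 by ring.
  exact: gen.
have k1 : (-1 : R) ^+ 2 = 1 by rewrite sqrrN expr1n.
have x0 t : 0 <= t <= h -> 0 <= -1 * t + h by case/andP => *; lra.
have tail2 : Iab 0 h (fun t => G t ^+ 2) <= 2 * dirc h * (c1 * H).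
  have d1 := direct_ec halpha hrho N A' (ltW h0) k1 x0.
  have d2 := direct_es halpha hrho N B' (ltW h0) k1 x0.
  rewrite subr0 in d1 d2.
  have ca : continuous (fun t => \sum_(k < N) A' k * ec k.+1 (-1 * t + h)).
    by apply: cont_sum => k; apply: contM; [exact: cst_continuous|apply: affine_cont; exact: ec_cont].
  have cb : continuous (fun t => \sum_(k < N) B' k * es k.+1 (-1 * t + h)).
    by apply: cont_sum => k; apply: contM; [exact: cst_continuous|apply: affine_cont; exact: es_cont].
  apply: (@le_trans _ _ (2 * Iab 0 h (fun t => (\sum_(k < N) A' k * ec k.+1 (-1 * t + h)) ^+ 2) +
     2 * Iab 0 h (fun t => (\sum_(k < N) B' k * es k.+1 (-1 * t + h)) ^+ 2))).
    under eq_fun do rewrite GE.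
    by apply: Iab_sqrD_le; exact: sqint_cont.
  rewrite big_split /= in tail1.
  have := ler_wpM2l D0 tail1; rewrite mulrDr; lra.
have hy : Iab 0 h (fun t => y t ^+ 2) <= c2 * H.
  have iF : iab 0 h (fun t => FF N p q A B t ^+ 2) by apply: iab_cont; exact: csq.
  apply: (@le_trans _ _ (2 * Iab 0 h (fun t => FF N p q A B t ^+ 2) + 2 * Iab 0 h (fun t => G t ^+ 2))).
    have -> : Iab 0 h (fun t => G t ^+ 2) = Iab 0 h (fun t => (- G t) ^+ 2).
      by apply: Iab_eq => t _; rewrite sqrrN.
    have -> : Iab 0 h (fun t => y t ^+ 2) = Iab 0 h (fun t => (FF N p q A B t + - G t) ^+ 2).
      by apply: Iab_eq => t _; congr (_ ^+ 2); rewrite /trigsum -/(y t) -/(G t); ring.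
    by apply: Iab_sqrD_le; apply: sqint_cont => //; exact: contN.
  have : Iab 0 h (fun t => FF N p q A B t ^+ 2) <= H.
    apply: Iab_sub => //.
    - by apply: iab_cont; exact: csq.
    - by move=> x; exact: sqr_ge0.
    - by rewrite /h; lra.
  rewrite /c2; lra.
have hq : q ^+ 2 <= c3 * H.
  rewrite /c3 mulrAC ler_pdivlMr //.
  have h20 : 0 <= h / 2 by rewrite divr_ge0 // ltW.
  have h2h : h / 2 <= h by lra.
  have -> : q ^+ 2 * (s ^+ 2 * (h / 2)) = Iab 0 (h - h / 2) (fun=> q ^+ 2 * s ^+ 2).
    by rewrite Iab_cst; [field|lra].
  apply: (@le_trans _ _ (Iab 0 (h - h / 2) (fun t => n2 (-1 * rc (y t) + 1 * rc (y (t + h / 2)))))).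
    apply: Iab_le.
    - by apply: iab_cont; exact: cst_continuous.
    - apply: iab_cont; apply: n2_cont; apply: ccontD; apply: ccontM; try exact: ccont_cst.
        exact: ccont_rc.
      by apply: ccont_rc; exact: cont_shift.
    move=> t /andP[t0 _].
    have -> : -1 * rc (y t) + 1 * rc (y (t + h / 2)) = rc (q * (DS 0 (- t) * s)).
      rewrite mulN1r mul1r -rcN -rcD; congr rc.
      by rewrite /y SS0D // /s; ring.
    have D1 : 1 <= DS 0 (- t) ^+ 2 by rewrite exprn_ege1 // DS0_ge1 // ltW.
    rewrite n2_rc !exprMn.
    by have := ler_wpM2r (mulr_ge0 (sqr_ge0 q) (sqr_ge0 s)) D1; lra.
  (* The increment of y is of the form treated by [killstep], with c0 = -1, c1 = 1 and (1 + 1)^2 =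
     4. *)
  have := @killstep R h (h / 2) 4 (fun t => rc (y t)) (-1) 1 h20 h2h (ccont_rc cy).
  have -> : (Normc.normc (-1) + Normc.normc 1) ^+ 2 = 4 :> R.
    by rewrite normcN Normc.normc1; ring.
  move=> /(_ (lexx _)) h3; apply: (le_trans h3).
  rewrite -mulrA; apply: ler_wpM2l => //.
  apply: le_trans hy; rewrite le_eqVlt; apply/orP; left; apply/eqP.
  by apply: Iab_eq => t _; rewrite n2_rc.
have hp : p ^+ 2 <= c4 * H.
  rewrite /c4 mulrAC ler_pdivlMr //.
  have -> : p ^+ 2 * h = Iab 0 h (fun=> p ^+ 2) by rewrite Iab_cst ?subr0 // ltW.
  have iy : iab 0 h (fun t => y t ^+ 2) by apply: iab_cont; exact: csq.
  have iS : iab 0 h (fun t => SS 0 (- t) ^+ 2) by apply: iab_cont; exact: csq.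
  apply: (@le_trans _ _ (2 * Iab 0 h (fun t => y t ^+ 2) + 2 * q ^+ 2 * S2)).
    rewrite /S2 -!IabZ // -IabD; try exact: iabZ.
    apply: Iab_le.
    - by apply: iab_cont; exact: cst_continuous.
    - by apply: iabD; exact: iabZ.
    - move=> t _; rewrite /y; move: (SS 0 (- t)) => u.
      by have := sqr_ge0 (p + 2 * (q * u)); nra.
  have := ler_wpM2r S2p hq; lra.
have hA := H0 N p q A B.
rewrite -/H in hA; lra.
Qed.

End Observability.

(** * The moment problem *)

Section Riesz.
Context {R : realType}.
Implicit Types (a b t x y : R) (f g : R -> R).

Definition norm2 a b f : R := Num.sqrt (Iab a b (fun t => f t ^+ 2)).

Lemma norm2_ge0 a b f : 0 <= norm2 a b f. Proof. exact: sqrtr_ge0. Qed.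

Lemma norm2_sq a b f : norm2 a b f ^+ 2 = Iab a b (fun t => f t ^+ 2).
Proof. by rewrite sqr_sqrtr //; apply: Iab_ge0 => t _; exact: sqr_ge0. Qed.

Lemma cs_norm2 a b f g : sqint a b f -> sqint a b g ->
  `|Iab a b (fun t => f t * g t)| <= norm2 a b f * norm2 a b g.
Proof.
move=> sf sg; rewrite -ler_sqr ?nnegrE ?mulr_ge0 ?norm2_ge0 //.
by rewrite real_normK ?num_real // exprMn !norm2_sq; exact: cauchy_schwarz.
Qed.

Lemma norm2D a b f g : sqint a b f -> sqint a b g ->
  norm2 a b (fun t => f t + g t) <= norm2 a b f + norm2 a b g.
Proof.
move=> sf sg; rewrite -ler_sqr ?nnegrE ?addr_ge0 ?norm2_ge0 // norm2_sq sqrrD !norm2_sq.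
have sfg := sqint_prod sf sg.
have -> : Iab a b (fun t => (f t + g t) ^+ 2) =
   Iab a b (fun t => f t ^+ 2) + 2 * Iab a b (fun t => f t * g t) + Iab a b (fun t => g t ^+ 2).
  rewrite -IabZ // -!IabD.
  - by apply: Iab_eq => t _; ring.
  - by apply: iabD; [exact: (proj2 sf)|exact: iabZ].
  - exact: (proj2 sg).
  - exact: (proj2 sf).
  - exact: iabZ.
have := cs_norm2 sf sg; rewrite ler_norml => /andP[_ h].
by rewrite lerD2r lerD2l mulr2n; lra.
Qed.

Lemma small_le x y : (forall e, 0 < e -> x <= y + e) -> x <= y.
Proof. by move=> h; apply/ler_addgt0Pr => e e0; exact: h. Qed.

(** Riesz representation for a functional given as a linear relation: its values may be attached to
    expressions rather than to functions, and the bound makes it single-valued. The representative g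
    is the limit of a minimizing sequence of J = |f|^2 / 2 - l. *)
Lemma riesz_relation T (K : R) (G : (R -> R) -> R -> Prop) : 0 <= K ->
  (exists f l, G f l) ->
  (forall a b f l f' l', G f l -> G f' l' ->
     G (fun t => a * f t + b * f' t) (a * l + b * l')) ->
  (forall f l, G f l -> sqint 0 T f) ->
  (forall f l, G f l -> `|l| <= K * norm2 0 T f) ->
  exists2 g, sqint 0 T g &
    (forall f l, G f l -> Iab 0 T (fun t => g t * f t) = l) /\ norm2 0 T g <= K.
Proof.
move=> K0 [f0 [l0 G0]] Gc Gs Gb.
pose J f (l : R) := 2^-1 * Iab 0 T (fun t => f t ^+ 2) - l.
have Jlb f l : G f l -> - (2^-1 * K ^+ 2) <= J f l.
  move=> Gf; have := Gb f l Gf; rewrite ler_norml => /andP[_ h].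
  rewrite /J -norm2_sq; have := norm2_ge0 0 T f; move: (norm2 0 T f) h => z h z0.
  by have := sqr_ge0 (z - K); nra.
pose V := [set x | exists f l, G f l /\ x = J f l].
have V0 : V !=set0 by exists (J f0 l0), f0, l0.
have hV : has_inf V.
  split => //; exists (- (2^-1 * K ^+ 2)) => _ [f [l [Gf ->]]]; exact: Jlb.
pose m := inf V.
have mle f l : G f l -> m <= J f l.
  by move=> Gf; apply: ge_inf; [case: hV|exists f, l].
have ex k : exists fl : (R -> R) * R, G fl.1 fl.2 /\ J fl.1 fl.2 <= m + k.+1%:R^-1.
  have k0 : (0 : R) < k.+1%:R^-1 by rewrite invr_gt0.
  have [_ [f [l [Gf ->]]] h] := inf_adherent k0 hV.
  by exists (f, l); split => //; exact: ltW.
have [F hF] := choice ex.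
pose fk k := (F k).1; pose lk k := (F k).2.
have Gk k : G (fk k) (lk k) by case: (hF k).
have Jk k : J (fk k) (lk k) <= m + k.+1%:R^-1 by case: (hF k).
have sk k : sqint 0 T (fk k) by exact: Gs (Gk k).
(* At the midpoint of two almost minimizers J is still at least m, and the parallelogram identity
   bounds their distance. *)
have para j k : Iab 0 T (fun t => (fk j t - fk k t) ^+ 2) <= 4 * (j.+1%:R^-1 + k.+1%:R^-1).
  have Gm := Gc 2^-1 2^-1 _ _ _ _ (Gk j) (Gk k).
  have := mle _ _ Gm; have := Jk j; have := Jk k; rewrite /J.
  have sp := sqint_prod (sk j) (sk k).
  have ij := proj2 (sk j); have ik := proj2 (sk k).
  have -> : Iab 0 T (fun t => (2^-1 * fk j t + 2^-1 * fk k t) ^+ 2) =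
    4^-1 * Iab 0 T (fun t => fk j t ^+ 2) + 2^-1 * Iab 0 T (fun t => fk j t * fk k t) +
    4^-1 * Iab 0 T (fun t => fk k t ^+ 2).
    rewrite -!IabZ // -!IabD; try (by apply: iabZ); last by apply: iabD; apply: iabZ.
    by apply: Iab_eq => t _; field.
  have -> : Iab 0 T (fun t => (fk j t - fk k t) ^+ 2) =
    Iab 0 T (fun t => fk j t ^+ 2) + (-2) * Iab 0 T (fun t => fk j t * fk k t) +
    Iab 0 T (fun t => fk k t ^+ 2).
    have i12 : iab 0 T (fun t => -2 * (fk j t * fk k t)) by exact: iabZ.
    rewrite -(IabZ (-2) sp) -(IabD ij i12) -IabD //; last exact: iabD.
    by apply: Iab_eq => t _; ring.
  by move: (k.+1%:R^-1 : R) (j.+1%:R^-1 : R) => ik' ij'; lra.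
have invle e : 0 < e -> exists N, forall n, (N <= n)%N -> n.+1%:R^-1 <= e :> R.
  move=> e0; exists (Num.bound e^-1) => n Nn.
  rewrite -[leRHS]invrK lef_pV2 ?posrE ?invr_gt0 // ltW //.
  apply: (@lt_le_trans _ _ (Num.bound e^-1)%:R).
    by apply: archi_boundP; rewrite invr_ge0 ltW.
  by rewrite ler_nat (leq_trans Nn).
have [g sg hg] : exists2 g, sqint 0 T g & forall e, 0 < e -> exists N, forall n, (N <= n)%N ->
    Iab 0 T (fun x => (fk n x - g x) ^+ 2) <= e.
  apply: sqint_complete => // e e0.
  have [N hN] := invle (e / 8) (divr_gt0 e0 (ltr0Sn _ _)).
  exists N => j k Nj Nk; apply: (le_trans (para j k)).
  by have := hN j Nj; have := hN k Nk; move: (k.+1%:R^-1 : R) (j.+1%:R^-1 : R) => ik ij; lra.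
exists g => //.
have first f l : G f l -> Iab 0 T (fun t => g t * f t) = l.
  move=> Gf; have sf := Gs _ _ Gf.
  set X := Iab 0 T (fun t => g t * f t).
  pose Z := Iab 0 T (fun t => f t ^+ 2).
  have Z0 : 0 <= Z by apply: Iab_ge0 => t _; exact: sqr_ge0.
  (* J at fk + s f stays above m for every s; the discriminant of this quadratic polynomial in s
     bounds the defect in the Euler equation. *)
  have bnd k : (Iab 0 T (fun t => fk k t * f t) - l) ^+ 2 <= 2 * k.+1%:R^-1 * Z.
    set Y := Iab 0 T _.
    have h : ((Y - l) / 2) ^+ 2 <= k.+1%:R^-1 * (2^-1 * Z).
      apply: quad_discr; [by rewrite invr_ge0|by rewrite mulr_ge0 // invr_ge0|].
      move=> s; have := mle _ _ (Gc 1 s _ _ _ _ (Gk k) Gf); have := Jk k; rewrite /J.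
      have -> : Iab 0 T (fun t => (1 * fk k t + s * f t) ^+ 2) =
        Iab 0 T (fun t => fk k t ^+ 2) + (2 * s) * Y + s ^+ 2 * Z.
        rewrite /Y /Z -!IabZ; [|exact: (proj2 sf)|exact: sqint_prod].
        have i1 : iab 0 T (fun t => 2 * s * (fk k t * f t)) by apply: iabZ; exact: sqint_prod.
        have i2 : iab 0 T (fun t => s ^+ 2 * f t ^+ 2) by apply: iabZ; exact: (proj2 sf).
        have i0 := proj2 (sk k); rewrite -(IabD i0 i1) -IabD //; last exact: iabD.
        by apply: Iab_eq => t _; ring.
      by move: (k.+1%:R^-1 : R) => ik; lra.
    have -> : (Y - l) ^+ 2 = 4 * ((Y - l) / 2) ^+ 2 by field.
    by move: (k.+1%:R^-1 : R) h => ik h; lra.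
  suff : (X - l) ^+ 2 <= 0.
    by move=> h; apply/eqP; rewrite -subr_eq0 -sqrf_eq0 eq_le h sqr_ge0.
  apply: small_le => e e0; rewrite add0r.
  pose d := e / (8 * (Z + 1)).
  have Z1 : 0 < 8 * (Z + 1) by rewrite mulr_gt0 // ltr_wpDl.
  have d0 : 0 < d by rewrite divr_gt0.
  have [N1 h1] := hg d d0; have [N2 h2] := invle d d0.
  pose k := maxn N1 N2.
  have b1 := bnd k; have b2 := h2 k (leq_maxr _ _); have b3 := h1 k (leq_maxl _ _).
  have b4 := cauchy_schwarz (sqintB (sk k) sg) sf.
  have E : Iab 0 T (fun t => (fk k t - g t) * f t) = Iab 0 T (fun t => fk k t * f t) - X.
    rewrite /X -IabB; [|exact: sqint_prod|exact: sqint_prod].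
    by apply: Iab_eq => t _; ring.
  rewrite E -/Z in b4.
  have b5 : (Iab 0 T (fun t => fk k t * f t) - X) ^+ 2 <= d * Z.
    by apply: (le_trans b4); apply: ler_wpM2r.
  have b6 : (Iab 0 T (fun t => fk k t * f t) - l) ^+ 2 <= 2 * d * Z.
    by move: (k.+1%:R^-1 : R) b1 b2 => ik b1 b2; have := ler_wpM2r Z0 b2; lra.
  move: (Iab 0 T (fun t => fk k t * f t)) b5 b6 => Y b5 b6.
  have dZ : 8 * (d * Z) <= e.
    have -> : 8 * (d * Z) = e * (Z / (Z + 1)).
      by rewrite /d; field; rewrite gt_eqF // ltr_wpDl.
    by rewrite ler_piMr ?(ltW e0) // ler_pdivrMr ?ltr_wpDl // mul1r lerDl.
  have := sqr_ge0 (Y - X + (Y - l)); nra.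
split => //.
set n := norm2 0 T g; have n0 : 0 <= n by exact: norm2_ge0.
(* Since g represents the value lk N at fk N, |g|^2 equals lk N minus the pairing of g with fk N -
   g; N is chosen so that |fk N - g| <= r. *)
have key r : 0 < r -> n ^+ 2 <= K * n + r * (K + n).
  move=> r0; have [N hN] := hg (r ^+ 2) (exprn_gt0 _ r0).
  have hr := hN N (leqnn _).
  have sd := sqintB (sk N) sg.
  have dr : norm2 0 T (fun t => fk N t - g t) <= r.
    by rewrite -ler_sqr ?nnegrE ?norm2_ge0 ?(ltW r0) // norm2_sq.
  have nf : norm2 0 T (fk N) <= n + r.
    have := norm2D sg sd; have -> : (fun t => g t + (fk N t - g t)) = fk N.
      by apply/funext => t; rewrite addrC subrK.
    by move=> /le_trans; apply; rewrite lerD2l.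
  have E : n ^+ 2 = lk N - Iab 0 T (fun t => g t * (fk N t - g t)).
    rewrite norm2_sq -(first _ _ (Gk N)) -IabB; [|exact: sqint_prod|exact: sqint_prod].
    by apply: Iab_eq => t _; ring.
  have := cs_norm2 sg sd; rewrite ler_norml => /andP[c1 _].
  have := Gb _ _ (Gk N); rewrite ler_norml => /andP[_ c2].
  have c3 := ler_wpM2l K0 nf; have c4 := ler_wpM2l n0 dr.
  rewrite E -/n in c1 *; lra.
have [->|nn] := eqVneq n 0; first exact: K0.
have np : 0 < n by rewrite lt_neqAle eq_sym nn.
rewrite -(ler_pM2r np) -expr2; apply: small_le => e e0.
have Kn : 0 < K + n by rewrite ltr_wpDl.
have := key (e / (K + n)) (divr_gt0 e0 Kn).
by rewrite divfK ?gt_eqF.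
Qed.

Lemma sum_cs (N : nat) (x y : 'I_N -> R) :
  (\sum_i x i * y i) ^+ 2 <= (\sum_i x i ^+ 2) * (\sum_i y i ^+ 2).
Proof.
apply: quad_discr; [by apply: sumr_ge0 => i _; exact: sqr_ge0..|move=> s].
have -> : \sum_i x i ^+ 2 + 2 * s * (\sum_i x i * y i) + s ^+ 2 * (\sum_i y i ^+ 2) =
   \sum_i (x i + s * y i) ^+ 2.
  by rewrite !mulr_sumr -!big_split /=; apply: eq_bigr => i _; ring.
by apply: sumr_ge0 => i _; exact: sqr_ge0.
Qed.

End Riesz.

(** * Existence of a control with prescribed moments *)

Section Control.
Context {R : realType}.
Implicit Types (t x y L eps : R) (n m k N K : nat).
Context (alpha rho : R).
Context (halpha : 0 <= alpha < 1) (hrho : 0 < rho < 2).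
Local Notation sig := (damp alpha rho).
Local Notation om := (om alpha rho).
Local Notation ec := (dampcos alpha rho).
Local Notation es := (dampsin alpha rho).
Local Notation SS := (Smode alpha rho).
Local Notation CC := (Cmode alpha rho).
Local Notation FF := (trigsum alpha rho).

Definition psi n : R := phiN n pi.

Lemma cos_npi n : cos (n%:R * pi : R) ^+ 2 = 1.
Proof.
suff : sin (n%:R * pi : R) = 0.
  by move=> s0; have := cos2Dsin2 (n%:R * pi : R); rewrite s0 expr0n /= addr0.
elim: n => [|n IH]; first by rewrite mul0r sin0.
by rewrite -addn1 natrD mulrDl mul1r sinDpi IH oppr0.
Qed.

(** The control at the end point acts on all modes with comparable strength, so dividing the moments
    by psi n is harmless. *)
Lemma psi_sq n : psi n ^+ 2 = if n == 0%N then pi^-1 else 2 / pi.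
Proof.
have p0 := pi_gt0 R; rewrite /psi /phiN; case: eqP => _.
  by rewrite exprVn sqr_sqrtr // ltW.
by rewrite exprMn cos_npi mulr1 sqr_sqrtr // divr_ge0 // ltW.
Qed.

Lemma psi_neq0 n : psi n != 0.
Proof.
have p0 := pi_gt0 R; rewrite -sqrf_eq0 psi_sq; case: ifP => _.
  by rewrite invr_eq0 gt_eqF.
by rewrite mulf_neq0 // ?invr_eq0 ?gt_eqF // pnatr_eq0.
Qed.

Lemma psi_le1 n : psi n ^+ 2 <= 1.
Proof.
have p2 : 2 <= pi :> R by exact: pi_ge2.
have p0 := pi_gt0 R; rewrite psi_sq; case: ifP => _; last by rewrite ler_pdivrMr // mul1r.
by rewrite invf_le1 // (le_trans _ p2) // ler1n.
Qed.

Lemma psiV_le n : (psi n)^-1 ^+ 2 <= pi.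
Proof.
have p0 := pi_gt0 R; rewrite exprVn psi_sq; case: ifP => _; first by rewrite invrK.
by rewrite invf_div ler_pdivrMr // ler_peMr ?ler1n // ltW.
Qed.

(** The right-hand side of the moment problem as a functional of the coefficients of F. In mode n >=
    1 the function p C_n(- t) + q S_n(- t) has A = p and B = (sigma_n p + q) / om_n, and then (q + 2
    sigma_n p) u0 + p u1 = A (sigma_n u0 + u1) + B om_n u0. *)
Definition moment_value (u0 u1 : nat -> R) N (p q : R) (A B : nat -> R) : R :=
  (psi 0)^-1 * (p * (2 * sig 0 * u0 0%N + u1 0%N) + q * u0 0%N) +
  \sum_(k < N) (psi k.+1)^-1 *
    (A k * (sig k.+1 * u0 k.+1 + u1 k.+1) + B k * (om k.+1 * u0 k.+1)).

(* Tested against the single modes, the weak formulation at time T with null final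
   data becomes this moment problem. *)
Definition moments T (g : R -> R) (u0 u1 : nat -> R) : Prop := forall n (p q : R),
  psi n * Iab 0 T (fun t => g t * (p * CC n (- t) + q * SS n (- t))) =
  (q + 2 * sig n * p) * u0 n + p * u1 n.

(** The power 0^(2 alpha) is 1 for alpha = 0 and 0 otherwise. *)
Lemma sig0_le1 : sig 0 <= 1.
Proof.
have /andP[r0 r2] := hrho; rewrite /damp.
have : (0 : R) `^ (2 * alpha) <= 1.
  by have [->|h] := eqVneq (2 * alpha) 0; rewrite ?powRr0 ?powR0.
have := powR_ge0 (0 : R) (2 * alpha); nra.
Qed.

(** Cauchy-Schwarz in the coefficients. As sigma_n and om_n are at most n^2, the data of the moment
    problem are square summable for (u0, u1) in X_N^2 x X_N^0; the factor 81 is generous. *)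
Lemma moment_value_bound (u0 u1 : nat -> R) (M0 M1 : R) N (p q : R) (A B : nat -> R) :
  (forall N, \sum_(n < N) wt 2 n * u0 n ^+ 2 <= M0 ^+ 2) ->
  (forall N, \sum_(n < N) wt 0 n * u1 n ^+ 2 <= M1 ^+ 2) ->
  moment_value u0 u1 N p q A B ^+ 2 <= 81 * pi * (M0 ^+ 2 + M1 ^+ 2) *
    (p ^+ 2 + q ^+ 2 + \sum_(k < N) (A k ^+ 2 + B k ^+ 2)).
Proof.
move=> h0 h1; have p0 := pi_gt0 R.
pose a0 := 2 * sig 0 * u0 0%N + u1 0%N.
pose xA k := (psi k.+1)^-1 * (sig k.+1 * u0 k.+1 + u1 k.+1).
pose xB k := (psi k.+1)^-1 * (om k.+1 * u0 k.+1).
pose W := M0 ^+ 2 + M1 ^+ 2.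
have W0 : 0 <= W by rewrite addr_ge0 ?sqr_ge0.
have wtE k : wt 2 k.+1 = k.+1%:R ^+ 4 :> R.
  rewrite /wt /=; have -> : (2 * 2 : R) = 4%:R by ring.
  by rewrite powR_mulrn.
have wt0 k : wt 0 k = 1 :> R by rewrite /wt mulr0 powRr0; case: ifP.
have hu0 : u0 0%N ^+ 2 + \sum_(k < N) k.+1%:R ^+ 4 * u0 k.+1 ^+ 2 <= M0 ^+ 2.
  apply: le_trans (h0 N.+1); rewrite big_ord_recl /= {1}/wt eqxx mul1r lerD2l.
  by apply: ler_sum => k _; rewrite /bump /= add1n wtE.
have hu1 : u1 0%N ^+ 2 + \sum_(k < N) u1 k.+1 ^+ 2 <= M1 ^+ 2.
  apply: le_trans (h1 N.+1); rewrite big_ord_recl /= wt0 mul1r lerD2l.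
  by apply: ler_sum => k _; rewrite /bump /= add1n wt0 mul1r.
have SS0' : 0 <= \sum_(k < N) k.+1%:R ^+ 4 * u0 k.+1 ^+ 2.
  by apply: sumr_ge0 => k _; rewrite mulr_ge0 ?sqr_ge0 // exprn_ge0.
have SS1' : 0 <= \sum_(k < N) u1 k.+1 ^+ 2 by apply: sumr_ge0 => k _; exact: sqr_ge0.
have bA : \sum_(k < N) xA k ^+ 2 <= pi * (2 * W).
  apply: (@le_trans _ _ (pi * (2 * \sum_(k < N) k.+1%:R ^+ 4 * u0 k.+1 ^+ 2 + 2 * \sum_(k < N) u1 k.+1 ^+ 2))).
    rewrite !mulr_sumr -big_split /= mulr_sumr; apply: ler_sum => k _.
    rewrite /xA exprMn; apply: ler_pM; rewrite ?sqr_ge0 ?psiV_le //.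
    have := om2 halpha hrho (ltn0Sn k); have := sqr_ge0 (om k.+1) => q1 q2.
    have : sig k.+1 ^+ 2 * u0 k.+1 ^+ 2 <= k.+1%:R ^+ 4 * u0 k.+1 ^+ 2.
      by apply: ler_wpM2r; [exact: sqr_ge0|lra].
    have := sqr_ge0 (sig k.+1 * u0 k.+1 - u1 k.+1); nra.
  apply: ler_wpM2l; first exact: ltW.
  by have := sqr_ge0 (u0 0%N); have := sqr_ge0 (u1 0%N); rewrite /W; lra.
have bB : \sum_(k < N) xB k ^+ 2 <= pi * W.
  apply: (@le_trans _ _ (pi * (\sum_(k < N) k.+1%:R ^+ 4 * u0 k.+1 ^+ 2))).
    rewrite mulr_sumr; apply: ler_sum => k _.
    rewrite /xB exprMn; apply: ler_pM; rewrite ?sqr_ge0 ?psiV_le // exprMn.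
    have := om2 halpha hrho (ltn0Sn k); have := sqr_ge0 (sig k.+1) => q1 q2.
    by apply: ler_wpM2r; [exact: sqr_ge0|lra].
  apply: ler_wpM2l; first exact: ltW.
  by have := sqr_ge0 (u0 0%N); have := sqr_ge0 (M1); rewrite /W; lra.
have b0 : (psi 0)^-1 ^+ 2 * (a0 ^+ 2 + u0 0%N ^+ 2) <= pi * (9 * W).
  apply: ler_pM; rewrite ?sqr_ge0 ?psiV_le ?addr_ge0 ?sqr_ge0 //.
  have s0 := sig_ge0 alpha hrho 0; have s1 := sig0_le1.
  have s2 : sig 0 ^+ 2 <= 1 by rewrite expr_le1.
  have : sig 0 ^+ 2 * u0 0%N ^+ 2 <= u0 0%N ^+ 2 by rewrite ler_piMl ?sqr_ge0.
  have := sqr_ge0 (2 * sig 0 * u0 0%N - u1 0%N).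
  rewrite /a0 /W; nra.
set L0 := (psi 0)^-1 * (p * a0 + q * u0 0%N).
have -> : moment_value u0 u1 N p q A B = L0 + (\sum_(k < N) A k * xA k + \sum_(k < N) B k * xB k).
  rewrite /moment_value -big_split /=; congr (_ + _); apply: eq_bigr => k _.
  by rewrite /xA /xB; ring.
have cA := sum_cs (fun k : 'I_N => A k) (fun k : 'I_N => xA k).
have cB := sum_cs (fun k : 'I_N => B k) (fun k : 'I_N => xB k).
rewrite /= in cA cB.
have c0 : L0 ^+ 2 <= (p ^+ 2 + q ^+ 2) * (pi * (9 * W)).
  apply: (@le_trans _ _ ((p ^+ 2 + q ^+ 2) * ((psi 0)^-1 ^+ 2 * (a0 ^+ 2 + u0 0%N ^+ 2)))).
    rewrite /L0 exprMn [leRHS]mulrCA; apply: ler_wpM2l; first exact: sqr_ge0.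
    by have := sqr_ge0 (p * u0 0%N - q * a0); nra.
  by apply: ler_wpM2l => //; rewrite addr_ge0 ?sqr_ge0.
rewrite big_split /=.
set X := \sum_(k < N) A k * xA k in cA *; set Y := \sum_(k < N) B k * xB k in cB *.
set a2 := \sum_(k < N) A k ^+ 2 in cA *; set b2 := \sum_(k < N) B k ^+ 2 in cB *.
have a20 : 0 <= a2 by apply: sumr_ge0 => k _; exact: sqr_ge0.
have b20 : 0 <= b2 by apply: sumr_ge0 => k _; exact: sqr_ge0.
have {}cA := le_trans cA (ler_wpM2l a20 bA).
have {}cB := le_trans cB (ler_wpM2l b20 bB).
have pW : 0 <= pi * W by rewrite mulr_ge0 // ltW.
have h3 : (L0 + (X + Y)) ^+ 2 <= 3 * (L0 ^+ 2 + X ^+ 2 + Y ^+ 2).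
  by have := sqr_ge0 (L0 - X); have := sqr_ge0 (L0 - Y); have := sqr_ge0 (X - Y); nra.
apply: (le_trans h3); rewrite -/W.
have e1 := mulr_ge0 a20 pW; have e2 := mulr_ge0 b20 pW.
have e3 : 0 <= (p ^+ 2 + q ^+ 2) * (pi * W) by rewrite mulr_ge0 // addr_ge0 ?sqr_ge0.
have -> : 81 * pi * W * (p ^+ 2 + q ^+ 2 + (a2 + b2)) =
  81 * ((p ^+ 2 + q ^+ 2) * (pi * W)) + 81 * (a2 * (pi * W)) + 81 * (b2 * (pi * W)) by ring.
have E4 : (p ^+ 2 + q ^+ 2) * (pi * (9 * W)) = 9 * ((p ^+ 2 + q ^+ 2) * (pi * W)) by ring.
have E5 : a2 * (pi * (2 * W)) = 2 * (a2 * (pi * W)) by ring.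
rewrite E4 in c0; rewrite E5 in cA.
lra.
Qed.

Lemma sum_widen n m (F : nat -> R) : (n <= m)%N ->
  \sum_(k < n) F k = \sum_(k < m) (k < n)%N%:R * F k.
Proof.
move=> h; rewrite (big_ord_widen _ F h) big_mkcond /=.
by apply: eq_bigr => k _; case: ltnP => _; rewrite ?mul1r ?mul0r.
Qed.

(** Sums of different lengths are padded with zeros by the indicators c and c'. With
    [moment_value_comb], which produces the same coefficients, this makes the relation between F and
    its moment linear. *)
Lemma FF_comb N N' (p q p' q' : R) (A B A' B' : nat -> R) (a b : R) t :
  let c k := (k < N)%N%:R : R in let c' k := (k < N')%N%:R : R in
  a * FF N p q A B t + b * FF N' p' q' A' B' t =
  FF (maxn N N') (a * p + b * p') (a * q + b * q')
    (fun k => a * (c k * A k) + b * (c' k * A' k))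
    (fun k => a * (c k * B k) + b * (c' k * B' k)) t.
Proof.
move=> c c'; rewrite /trigsum.
rewrite (sum_widen (n := N) (m := maxn N N') (fun k => A k * ec k.+1 (- t) + B k * es k.+1 (- t))) ?leq_maxl //.
rewrite (sum_widen (n := N') (m := maxn N N') (fun k => A' k * ec k.+1 (- t) + B' k * es k.+1 (- t))) ?leq_maxr //.
rewrite !mulrDr -!addrA; congr (_ + _).
rewrite [RHS]addrCA.
have -> : forall x y z w : R, x + (y + (z + w)) = z + ((x + w) + y) by move=> *; ring.
have -> : \sum_(k < maxn N N') ((a * (c k * A k) + b * (c' k * A' k)) * ec k.+1 (- t) +
     (a * (c k * B k) + b * (c' k * B' k)) * es k.+1 (- t)) =
   a * (\sum_(k < maxn N N') (k < N)%N%:R * (A k * ec k.+1 (- t) + B k * es k.+1 (- t))) +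
   b * (\sum_(k < maxn N N') (k < N')%N%:R * (A' k * ec k.+1 (- t) + B' k * es k.+1 (- t))).
  rewrite !mulr_sumr -big_split /=; apply: eq_bigr => k _.
  by rewrite /c /c'; ring.
ring.
Qed.

Lemma moment_value_comb (u0 u1 : nat -> R) N N' (p q p' q' : R) (A B A' B' : nat -> R) (a b : R) :
  let c k := (k < N)%N%:R : R in let c' k := (k < N')%N%:R : R in
  a * moment_value u0 u1 N p q A B + b * moment_value u0 u1 N' p' q' A' B' =
  moment_value u0 u1 (maxn N N') (a * p + b * p') (a * q + b * q')
    (fun k => a * (c k * A k) + b * (c' k * A' k))
    (fun k => a * (c k * B k) + b * (c' k * B' k)).
Proof.
move=> c c'; rewrite /moment_value.
rewrite (sum_widen (n := N) (m := maxn N N') (fun k => (psi k.+1)^-1 *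
    (A k * (sig k.+1 * u0 k.+1 + u1 k.+1) + B k * (om k.+1 * u0 k.+1)))) ?leq_maxl //.
rewrite (sum_widen (n := N') (m := maxn N N') (fun k => (psi k.+1)^-1 *
    (A' k * (sig k.+1 * u0 k.+1 + u1 k.+1) + B' k * (om k.+1 * u0 k.+1)))) ?leq_maxr //.
set X := \sum_(k < _) _; set Y := \sum_(k < _) _; set Z := \sum_(k < _) _.
have -> : Z = a * X + b * Y.
  rewrite /X /Y /Z !mulr_sumr -big_split /=; apply: eq_bigr => k _.
  by rewrite /c /c'; ring.
ring.
Qed.

(** Observability converts the bound of the moments by the coefficients of F into a bound by the
    norm of F, which is the continuity required for the representation. *)
Lemma control_exists T : 0 < T -> exists2 c : R, 0 <= c &
  forall (u0 u1 : nat -> R) (M0 M1 : R), 0 <= M0 -> 0 <= M1 ->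
  (forall N, \sum_(n < N) wt 2 n * u0 n ^+ 2 <= M0 ^+ 2) ->
  (forall N, \sum_(n < N) wt 0 n * u1 n ^+ 2 <= M1 ^+ 2) ->
  exists2 g, sqint 0 T g & moments T g u0 u1 /\ norm2 0 T g <= c * (M0 + M1).
Proof.
move=> T0; have [c c0 hc] := observability halpha hrho T0.
have p0 := pi_gt0 R.
pose K := Num.sqrt (81 * pi * c).
have K2 : K ^+ 2 = 81 * pi * c by rewrite sqr_sqrtr // !mulr_ge0 // ltW.
exists K; first exact: sqrtr_ge0.
move=> u0 u1 M0 M1 M00 M10 h0 h1.
pose G f l := exists N (p q : R) (A B : nat -> R), f = FF N p q A B /\ l = moment_value u0 u1 N p q A B.
have [g sg [hg ng]] : exists2 g, sqint 0 T g &
    (forall f l, G f l -> Iab 0 T (fun t => g t * f t) = l) /\ norm2 0 T g <= K * (M0 + M1).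
  apply: riesz_relation.
  - by apply: mulr_ge0; [exact: sqrtr_ge0|exact: addr_ge0].
  - by exists (FF 0 0 0 (fun=> 0) (fun=> 0)), (moment_value u0 u1 0 0 0 (fun=> 0) (fun=> 0)), 0%N, 0, 0, (fun=> 0), (fun=> 0).
  - move=> a b f l f' l' [N [p [q [A [B [-> ->]]]]]] [N' [p' [q' [A' [B' [-> ->]]]]]].
    rewrite moment_value_comb; eexists; eexists; eexists; eexists; eexists; split; last by [].
    by apply/funext => t; rewrite FF_comb.
  - by move=> f l [N [p [q [A [B [-> _]]]]]]; apply: sqint_cont; exact: FF_cont.
  - move=> f l [N [p [q [A [B [-> ->]]]]]].
    rewrite -ler_sqr ?nnegrE ?mulr_ge0 ?norm2_ge0 ?sqrtr_ge0 ?addr_ge0 //.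
    rewrite real_normK ?num_real // exprMn exprMn norm2_sq K2.
    apply: (le_trans (moment_value_bound N p q A B h0 h1)).
    have M2 : M0 ^+ 2 + M1 ^+ 2 <= (M0 + M1) ^+ 2 by have := mulr_ge0 M00 M10; nra.
    have H0 := hc N p q A B.
    set S := (X in X <= _) in H0; set H := Iab _ _ _ in H0 *.
    have S0 : 0 <= S.
      by rewrite /S !addr_ge0 ?sqr_ge0 // sumr_ge0 // => k _; rewrite addr_ge0 ?sqr_ge0.
    have -> : 81 * pi * c * (M0 + M1) ^+ 2 * H = 81 * pi * (M0 + M1) ^+ 2 * (c * H) by ring.
    apply: ler_pM => //.
    - apply: mulr_ge0; first by apply: mulr_ge0 => //; exact: ltW.
      by apply: addr_ge0; exact: sqr_ge0.
    - by apply: ler_wpM2l => //; apply: mulr_ge0 => //; exact: ltW.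
exists g => //; split => //.
move=> n p q.
have [->|n0] := posnP n.
  have := hg (FF 0 p q (fun=> 0) (fun=> 0)) (moment_value u0 u1 0 p q (fun=> 0) (fun=> 0)).
  move=> /(_ _)h; have {}h : Iab 0 T (fun t => g t * FF 0 p q (fun=> 0) (fun=> 0) t) =
      moment_value u0 u1 0 p q (fun=> 0) (fun=> 0).
    by apply: h; exists 0%N, p, q, (fun=> 0), (fun=> 0).
  have -> : Iab 0 T (fun t => g t * (p * CC 0 (- t) + q * SS 0 (- t))) =
      Iab 0 T (fun t => g t * FF 0 p q (fun=> 0) (fun=> 0) t).
    by apply: Iab_eq => t _; rewrite /trigsum big_ord0 addr0 /Cmode eqxx mulr1.
  rewrite h /moment_value big_ord0 addr0 mulrA mulfV ?psi_neq0 //; ring.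
have [k nk] : exists k, n = k.+1 by exists n.-1; rewrite prednK.
have w0 := om_gt0 halpha hrho n0.
(* Coordinates of p C_n(- t) + q S_n(- t) with respect to [ec] and [es]. *)
pose A j : R := if j == k then p else 0.
pose B j : R := if j == k then p * (sig n / om n) + q / om n else 0.
have hAB : Iab 0 T (fun t => g t * FF n 0 0 A B t) = moment_value u0 u1 n 0 0 A B.
  by apply: hg; exists n, 0, 0, A, B.
have kn : (k < n)%N by rewrite nk.
have -> : Iab 0 T (fun t => g t * (p * CC n (- t) + q * SS n (- t))) =
    Iab 0 T (fun t => g t * FF n 0 0 A B t).
  apply: Iab_eq => t _; congr (_ * _); rewrite /trigsum mul0r !add0r.
  rewrite (bigD1 (Ordinal kn)) //= big1 => [|j]; last first.
    rewrite -val_eqE /= => /negPf jk; by rewrite /A /B jk !mul0r addr0.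
  rewrite addr0 /A /B eqxx -nk /Cmode /Smode gtn_eqF //.
  by field; rewrite gt_eqF.
rewrite hAB /moment_value !mul0r addr0 mulr0 add0r.
rewrite (bigD1 (Ordinal kn)) //= big1 => [|j]; last first.
  rewrite -val_eqE /= => /negPf jk; by rewrite /A /B jk !mul0r addr0 mulr0.
rewrite addr0 /A /B eqxx -nk [LHS]mulrA mulfV ?psi_neq0 // mul1r.
by field; rewrite gt_eqF.
Qed.

End Control.

(** * Duhamel's formula and its energy estimate *)

Section Evolution.
Context {R : realType}.
Implicit Types (s t x y h : R) (n m k N K : nat).
Context (alpha rho : R).
Context (halpha : 0 <= alpha < 1) (hrho : 0 < rho < 2).
Local Notation sig := (damp alpha rho).
Local Notation om := (om alpha rho).
Local Notation ec := (dampcos alpha rho).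
Local Notation es := (dampsin alpha rho).
Local Notation SS := (Smode alpha rho).
Local Notation CC := (Cmode alpha rho).
Local Notation DS := (dSmode alpha rho).
Local Notation gapc := (gapc rho).
Local Notation dirc := (direct_const rho).
Context (T : R) (hT : 0 < T) (g : R -> R) (hg : sqint 0 T g) (u0 u1 : nat -> R).

Definition duhamel n t : R :=
  u0 n * CC n t + u1 n * SS n t - psi n * Iab 0 t (fun s => SS n (t - s) * g s).
Local Notation uu := duhamel.

Definition duhamel_dt n t : R :=
  u0 n * (- n%:R ^+ 4 * SS n t) + u1 n * DS n t - psi n * Iab 0 t (fun s => DS n (t - s) * g s).
Local Notation vv := duhamel_dt.

Lemma cont_rev (f : R -> R) t : continuous f -> continuous (fun s => f (t - s)).
Proof.
move=> cf; have := affine_cont (k := -1) (d := t) cf.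
by under eq_fun do rewrite mulN1r addrC.
Qed.

Lemma iab_kernel (f : R -> R) s t x : 0 <= s -> x <= T -> continuous f ->
  iab s x (fun r => f (t - r) * g r).
Proof.
move=> s0 xT cf; apply: sqint_prod; last by apply: sqintS hg.
by apply: sqint_cont; exact: cont_rev.
Qed.

Lemma duhamel0 n : uu n 0 = u0 n.
Proof. by rewrite /uu CC0 SS0 (Iab_nil _ (lexx 0)) !mulr0 mulr1 addr0 subr0. Qed.

Lemma duhamel_dt0 n : vv n 0 = u1 n.
Proof. by rewrite /vv DS0 SS0 (Iab_nil _ (lexx 0)) !mulr0 mulr1 add0r subr0. Qed.

(** The addition formulas turn the integral over (0, s) into multiples of the state at time s, so
    the evolution restarts from there. *)
Lemma duhamel_step n s t : 0 <= s -> s <= t -> t <= T ->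
  uu n t = CC n (t - s) * uu n s + SS n (t - s) * vv n s -
    psi n * Iab s t (fun r => SS n (t - r) * g r).
Proof.
move=> s0 st tT.
have cS := SS_cont halpha hrho (n := n); have cD := DS_cont halpha hrho (n := n).
have sT : s <= T by exact: le_trans tT.
have i1 : iab 0 s (fun r => SS n (s - r) * g r) by apply: iab_kernel.
have i2 : iab 0 s (fun r => DS n (s - r) * g r) by apply: iab_kernel.
have E : Iab 0 t (fun r => SS n (t - r) * g r) =
   CC n (t - s) * Iab 0 s (fun r => SS n (s - r) * g r) +
   SS n (t - s) * Iab 0 s (fun r => DS n (s - r) * g r) +
   Iab s t (fun r => SS n (t - r) * g r).
  rewrite (Iab_split s0 st); last by apply: iab_kernel.
  congr (_ + _); rewrite -!IabZ // -IabD; try exact: iabZ.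
  apply: Iab_eq => r _.
  have -> : t - r = (s - r) + (t - s) by ring.
  by rewrite SSD //; ring.
have tE : s + (t - s) = t by ring.
have e1 := CCD halpha hrho n s (t - s); have e2 := SSD halpha hrho n s (t - s).
rewrite tE in e1 e2.
rewrite /uu /vv E e1 e2.
move: (Iab 0 s _) (Iab 0 s _) (Iab s t _) => X Y Z.
ring.
Qed.

Lemma duhamel_dt_step n s t : 0 <= s -> s <= t -> t <= T ->
  vv n t = - n%:R ^+ 4 * SS n (t - s) * uu n s + DS n (t - s) * vv n s -
    psi n * Iab s t (fun r => DS n (t - r) * g r).
Proof.
move=> s0 st tT.
have cS := SS_cont halpha hrho (n := n); have cD := DS_cont halpha hrho (n := n).
have sT : s <= T by exact: le_trans tT.
have i1 : iab 0 s (fun r => SS n (s - r) * g r) by apply: iab_kernel.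
have i2 : iab 0 s (fun r => DS n (s - r) * g r) by apply: iab_kernel.
have E : Iab 0 t (fun r => DS n (t - r) * g r) =
   (- n%:R ^+ 4 * SS n (t - s)) * Iab 0 s (fun r => SS n (s - r) * g r) +
   DS n (t - s) * Iab 0 s (fun r => DS n (s - r) * g r) +
   Iab s t (fun r => DS n (t - r) * g r).
  rewrite (Iab_split s0 st); last by apply: iab_kernel.
  congr (_ + _); rewrite -!IabZ // -IabD; try exact: iabZ.
  apply: Iab_eq => r _.
  have -> : t - r = (s - r) + (t - s) by ring.
  by rewrite DSD //; ring.
have tE : s + (t - s) = t by ring.
have e1 := DSD halpha hrho n s (t - s); have e2 := SSD halpha hrho n s (t - s).
rewrite tE in e1 e2.
rewrite /uu /vv E e1 e2.
move: (Iab 0 s _) (Iab 0 s _) (Iab s t _) => X Y Z.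
rewrite /dSmode; ring.
Qed.

(* In the coordinates [al], [be] the free evolution of mode n is a rotation
   damped by exp(- sigma_n t). *)
Definition al n t : R := vv n t + sig n * uu n t.
Definition be n t : R := om n * uu n t.
Definition energy n t : R := al n t ^+ 2 + be n t ^+ 2.

Lemma energy_ge0 n t : 0 <= energy n t. Proof. by rewrite addr_ge0 ?sqr_ge0. Qed.

Lemma al_step n s t : (0 < n)%N -> 0 <= s -> s <= t -> t <= T ->
  al n t = ec n (t - s) * al n s - es n (t - s) * be n s -
    psi n * Iab s t (fun r => g r * ec n (t - r)).
Proof.
move=> n0 s0 st tT; have w0 := om_gt0 halpha hrho n0.
have -> : Iab s t (fun r => g r * ec n (t - r)) =
   Iab s t (fun r => DS n (t - r) * g r) + sig n * Iab s t (fun r => SS n (t - r) * g r).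
  have cS := SS_cont halpha hrho (n := n); have cD := DS_cont halpha hrho (n := n).
  rewrite -IabZ; last exact: iab_kernel.
  rewrite -IabD; [|exact: iab_kernel|by apply: iabZ; exact: iab_kernel].
  apply: Iab_eq => r _; rewrite DS_pos // /Smode gtn_eqF //.
  by field; rewrite gt_eqF.
rewrite /al /be (duhamel_step n s0 st tT) (duhamel_dt_step n s0 st tT).
have -> : n%:R ^+ 4 = om n ^+ 2 + sig n ^+ 2 by rewrite om2 // subrK.
rewrite DS_pos // /Smode /Cmode gtn_eqF //.
move: (Iab _ _ _) (Iab _ _ _) => X Y.
by field; rewrite gt_eqF.
Qed.

Lemma be_step n s t : (0 < n)%N -> 0 <= s -> s <= t -> t <= T ->
  be n t = es n (t - s) * al n s + ec n (t - s) * be n s -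
    psi n * Iab s t (fun r => g r * es n (t - r)).
Proof.
move=> n0 s0 st tT; have w0 := om_gt0 halpha hrho n0.
have -> : Iab s t (fun r => g r * es n (t - r)) = om n * Iab s t (fun r => SS n (t - r) * g r).
  have cS := SS_cont halpha hrho (n := n).
  rewrite -IabZ; last exact: iab_kernel.
  apply: Iab_eq => r _; rewrite /Smode gtn_eqF //.
  by field; rewrite gt_eqF.
rewrite /al /be (duhamel_step n s0 st tT).
rewrite /Smode /Cmode gtn_eqF //.
move: (Iab _ _ _) => X.
by field; rewrite gt_eqF.
Qed.

Definition source n s t : R := Iab s t (fun r => g r * ec n (t - r)) ^+ 2 +
  Iab s t (fun r => g r * es n (t - r)) ^+ 2.

(** The free evolution does not increase the energy; both factors 2 come from separating it from the
    control. *)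
Lemma energy_step n s t : (0 < n)%N -> 0 <= s -> s <= t -> t <= T ->
  energy n t <= 2 * energy n s + 2 * source n s t.
Proof.
move=> n0 s0 st tT; rewrite /energy (al_step n0 s0 st tT) (be_step n0 s0 st tT) /source.
have h1 := ec_le1 alpha hrho n (x := t - s).
have {}h1 : ec n (t - s) ^+ 2 + es n (t - s) ^+ 2 <= 1 by apply: h1; rewrite subr_ge0.
move: (ec _ _) (es _ _) (al n s) (be n s) (Iab _ _ _) (Iab _ _ _) h1 => c e a b X Y h1.
have p1 := psi_le1 (R := R) n; have p0 := sqr_ge0 (psi n : R).
have hX : (psi n * X) ^+ 2 <= X ^+ 2 by rewrite exprMn ler_piMl ?sqr_ge0.
have hY : (psi n * Y) ^+ 2 <= Y ^+ 2 by rewrite exprMn ler_piMl ?sqr_ge0.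
have hab : (c * a - e * b) ^+ 2 + (e * a + c * b) ^+ 2 <= a ^+ 2 + b ^+ 2.
  have -> : (c * a - e * b) ^+ 2 + (e * a + c * b) ^+ 2 = (c ^+ 2 + e ^+ 2) * (a ^+ 2 + b ^+ 2) by ring.
  by rewrite ler_piMl // addr_ge0 ?sqr_ge0.
move: (psi n * X) (psi n * Y) (c * a - e * b) (e * a + c * b) hX hY hab => x y p q hX hY hab.
by have := sqr_ge0 (p + y); have := sqr_ge0 (q + x); nra.
Qed.

(** In the reversed variable t - r the kernels decay, so the Bessel inequality applies. Only g on
    (s, t) enters, which makes the contribution of a short time interval small. *)
Lemma source_sum N s t : 0 <= s -> s <= t -> t <= T ->
  \sum_(k < N) source k.+1 s t <= 2 * dirc T * Iab s t (fun r => g r ^+ 2).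
Proof.
move=> s0 st tT.
have k1 : (-1 : R) ^+ 2 = 1 by rewrite sqrrN expr1n.
have x0 r : s <= r <= t -> 0 <= -1 * r + t by case/andP => *; lra.
have sg : sqint s t g by apply: sqintS hg.
have h := bessel_modes halpha hrho N st k1 x0 sg.
apply: (@le_trans _ _ (2 * dirc (t - s) * Iab s t (fun r => g r ^+ 2))).
  apply: le_trans h; rewrite le_eqVlt; apply/orP; left; apply/eqP.
  apply: eq_bigr => k _; rewrite /source.
  by congr (_ ^+ 2 + _ ^+ 2); apply: Iab_eq => r _; rewrite mulN1r [- r + t]addrC.
apply: ler_wpM2r; first by apply: Iab_ge0 => r _; exact: sqr_ge0.
by rewrite /direct_const; lra.
Qed.

Definition Xenergy n t : R := n%:R ^+ 4 * uu n t ^+ 2 + vv n t ^+ 2.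
Local Notation WW := Xenergy.

(** From n^4 u^2 <= be^2 / c^2 and v^2 <= 2 al^2 + 2 sigma_n^2 u^2 <= 2 al^2 + 2 n^4 u^2. *)
Definition energy_const : R := 2 + 3 / gapc ^+ 2.

Lemma energy_const_ge0 : 0 <= energy_const. Proof. by rewrite addr_ge0 // divr_ge0 // sqr_ge0. Qed.

Lemma Xenergy_energy n t : (0 < n)%N -> WW n t <= energy_const * energy n t.
Proof.
move=> n0; rewrite /WW /energy /al /be /energy_const.
have g0 := gapc_gt0 hrho.
set U := uu n t; set V := vv n t.
have h1 : n%:R ^+ 4 * U ^+ 2 <= (om n * U) ^+ 2 / gapc ^+ 2.
  rewrite ler_pdivlMr ?exprn_gt0 // exprMn mulrAC; apply: ler_wpM2r; first exact: sqr_ge0.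
  by rewrite mulrC; exact: om_sqr_ge.
have h2 : (sig n * U) ^+ 2 <= n%:R ^+ 4 * U ^+ 2.
  rewrite exprMn; apply: ler_wpM2r; [exact: sqr_ge0|exact: sig_sqr_le].
have h3 : V ^+ 2 <= 2 * (V + sig n * U) ^+ 2 + 2 * (sig n * U) ^+ 2.
  by have := sqr_ge0 (V + sig n * U + sig n * U); nra.
set B := (om n * U) ^+ 2 in h1 *; have B0 : 0 <= B by exact: sqr_ge0.
set A := (V + sig n * U) ^+ 2 in h3 *; have A0 : 0 <= A by exact: sqr_ge0.
have c0 : 0 <= A / gapc ^+ 2 by rewrite divr_ge0 ?sqr_ge0.
have -> : (2 + 3 / gapc ^+ 2) * (A + B) = 2 * A + 2 * B + 3 * (A / gapc ^+ 2) + 3 * (B / gapc ^+ 2).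
  by ring.
lra.
Qed.

Lemma energy_Xenergy n t : (0 < n)%N -> energy n t <= 2 * WW n t.
Proof.
move=> n0; rewrite /WW /energy /al /be.
have o2 := om2 halpha hrho n0; have k := sig_sqr_le halpha hrho n0.
set U := uu n t; set V := vv n t.
have h : (sig n * U) ^+ 2 + (sig n * U) ^+ 2 + (om n * U) ^+ 2 <= 2 * (n%:R ^+ 4 * U ^+ 2).
  rewrite (exprMn 2 (sig n) U) (exprMn 2 (om n) U) o2.
  have U0 : 0 <= U ^+ 2 := sqr_ge0 _.
  set S2 := sig n ^+ 2 in k *.
  have := mulr_ge0 (_ : 0 <= n%:R ^+ 4 - S2) U0; rewrite subr_ge0 => /(_ k); nra.
have := sqr_ge0 (V - sig n * U); nra.
Qed.

Context (M0 M1 : R)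
  (h0 : forall N, \sum_(n < N) wt 2 n * u0 n ^+ 2 <= M0 ^+ 2)
  (h1 : forall N, \sum_(n < N) wt 0 n * u1 n ^+ 2 <= M1 ^+ 2).

Lemma wt2E n : wt 2 n = if n == 0%N then 1 else n%:R ^+ 4 :> R.
Proof.
rewrite /wt; case: ifP => // _; have -> : (2 * 2 : R) = 4%:R by ring.
by rewrite powR_mulrn.
Qed.

Lemma wt0E n : wt 0 n = 1 :> R.
Proof. by rewrite /wt mulr0 powRr0; case: ifP. Qed.

Lemma energy_sum0 N : \sum_(k < N) energy k.+1 0 <= 2 * (M0 ^+ 2 + M1 ^+ 2).
Proof.
apply: (@le_trans _ _ (\sum_(k < N) 2 * (wt 2 k.+1 * u0 k.+1 ^+ 2 + wt 0 k.+1 * u1 k.+1 ^+ 2))).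
  apply: ler_sum => k _; apply: (le_trans (energy_Xenergy 0 (ltn0Sn k))).
  by rewrite /WW duhamel0 duhamel_dt0 wt2E wt0E mul1r.
rewrite -mulr_sumr big_split /=; apply: ler_wpM2l => //.
by apply: lerD; exact: wt_sum_succ.
Qed.

Lemma energy_sum N t : 0 <= t <= T -> \sum_(k < N) energy k.+1 t <=
  4 * (M0 ^+ 2 + M1 ^+ 2) + 4 * dirc T * Iab 0 T (fun r => g r ^+ 2).
Proof.
move=> /andP[t0 tT].
apply: (@le_trans _ _ (\sum_(k < N) (2 * energy k.+1 0 + 2 * source k.+1 0 t))).
  by apply: ler_sum => k _; exact: energy_step.
rewrite big_split /= -!mulr_sumr.
have e1 := energy_sum0 N; have e2 := source_sum N (lexx 0) t0 tT.
have e3 : Iab 0 t (fun r => g r ^+ 2) <= Iab 0 T (fun r => g r ^+ 2).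
  by apply: Iab_sub => //; [exact: (proj2 hg)|move=> x; exact: sqr_ge0].
have d0 : 0 <= dirc T by apply: (dirc_ge0 hrho); exact: ltW.
by have := ler_wpM2l d0 e3; lra.
Qed.

Lemma mode_bounds n : exists2 P : R, 1 <= P & forall x, 0 <= x <= T ->
  [/\ `|CC n x| <= P, `|SS n x| <= P, `|DS n x| <= P,
   `|n%:R ^+ 4 * SS n x| <= P & `|- n%:R ^+ 4 * SS n x - 2 * sig n * DS n x| <= P].
Proof.
pose F x := 1 + `|CC n x| + `|SS n x| + `|DS n x| + `|n%:R ^+ 4 * SS n x| +
   `|- n%:R ^+ 4 * SS n x - 2 * sig n * DS n x|.
have cS := SS_cont halpha hrho (n := n); have cD := DS_cont halpha hrho (n := n).
have cC := CC_cont halpha hrho (n := n).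
have cn (f : R -> R) : continuous f -> continuous (fun x => `|f x|).
  by move=> cf x; apply: cvg_norm; exact: cf.
have cF : continuous F.
  have c5 : continuous (fun x => - n%:R ^+ 4 * SS n x - 2 * sig n * DS n x).
    apply: contD; first by apply: contM => //; exact: cst_continuous.
    by apply: contN; apply: contM => //; exact: cst_continuous.
  have c4 : continuous (fun x => n%:R ^+ 4 * SS n x).
    by apply: contM => //; exact: cst_continuous.
  apply: contD; last exact: cn.
  apply: contD; last exact: cn.
  apply: contD; last exact: cn.
  apply: contD; last exact: cn.
  by apply: contD; [exact: cst_continuous|exact: cn].
have [c _ hc] := EVT_max (ltW hT) (continuous_subspaceT cF).
exists (F c).
  rewrite /F -!addrA lerDl !addr_ge0 //.
move=> x xT; have h : F x <= F c by apply: hc; rewrite in_itv.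
rewrite /F in h *.
set a1 := `|CC n x| in h *; set a2 := `|SS n x| in h *; set a3 := `|DS n x| in h *.
set a4 := `|n%:R ^+ 4 * SS n x| in h *; set a5 := `|- n%:R ^+ 4 * SS n x - _| in h *.
have [p1 p2 p3 p4 p5] : [/\ 0 <= a1, 0 <= a2, 0 <= a3, 0 <= a4 & 0 <= a5] by split; exact: normr_ge0.
by split; lra.
Qed.

Lemma mvt_bound (f df : R -> R) (P x : R) : (forall y : R, is_derive y (1 : R) f (df y)) ->
  (forall y, 0 <= y <= x -> `|df y| <= P) -> 0 <= x -> `|f x - f 0| <= P * x.
Proof.
move=> d hb; rewrite le_eqVlt => /predU1P[<-|x0]; first by rewrite subrr normr0 mulr0.
have cf : {within `[0, x], continuous f} by apply: continuous_subspaceT; exact: is_derive_continuous d.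
have [c cx ->] := MVT x0 (fun y _ => d y) cf.
rewrite subr0 normrM (gtr0_norm x0); apply: ler_wpM2r; first exact: ltW.
by apply: hb; move: cx; rewrite in_itv /= => /andP[c0 c1]; rewrite !ltW.
Qed.

(** A modulus of continuity for each mode: h from the smooth part of the evolution, and by
    Cauchy-Schwarz sqrt(h) |g| from the control. *)
Definition modulus h : R := h + Num.sqrt h * norm2 0 T g.
Local Notation rr := modulus.

Lemma modulus_ge0 h : 0 <= h -> 0 <= rr h.
Proof. by move=> h0'; rewrite addr_ge0 // mulr_ge0 ?sqrtr_ge0 ?norm2_ge0. Qed.

Lemma int_abs_le s t : 0 <= s -> s <= t -> t <= T ->
  Iab s t (fun r => `|g r|) <= Num.sqrt (t - s) * norm2 0 T g.
Proof.
move=> s0 st tT; have sg : sqint s t g by apply: sqintS hg.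
have s1 : sqint s t (fun=> 1) by apply: sqint_cont; exact: cst_continuous.
have := cs_norm2 s1 (sqint_norm sg).
have -> : Iab s t (fun x => 1 * `|g x|) = Iab s t (fun r => `|g r|).
  by apply: Iab_eq => x _; rewrite mul1r.
move=> h; apply: (le_trans (ler_norm _)); apply: (le_trans h).
have -> : norm2 s t (fun=> 1) = Num.sqrt (t - s).
  by rewrite /norm2 Iab_cst // expr1n mul1r.
apply: ler_wpM2l; first exact: sqrtr_ge0.
apply: ler_wsqrtr.
have -> : Iab s t (fun r => `|g r| ^+ 2) = Iab s t (fun r => g r ^+ 2).
  by apply: Iab_eq => x _; rewrite real_normK ?num_real.
by apply: Iab_sub => //; [exact: (proj2 hg)|move=> x; exact: sqr_ge0].
Qed.

Lemma conv_le n (f : R -> R) (P s t : R) : 0 <= s -> s <= t -> t <= T -> continuous f ->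
  0 <= P -> (forall x, 0 <= x <= t - s -> `|f x| <= P) ->
  `|psi n * Iab s t (fun r => f (t - r) * g r)| <= P * rr (t - s).
Proof.
move=> s0 st tT cf P0 hb.
have sg : sqint s t g by apply: sqintS hg.
have i1 : iab s t (fun r => f (t - r) * g r) by apply: iab_kernel.
have i2 : iab s t (fun r => `|g r|) by apply: iab_norm; exact: sqint_iab.
have p1 : `|psi n| <= 1 :> R.
  by rewrite -ler_sqr ?nnegrE // expr1n real_normK ?num_real ?psi_le1.
have a1 : `|Iab s t (fun r => f (t - r) * g r)| <= P * Iab s t (fun r => `|g r|).
  apply: (le_trans (Iab_norm i1)); rewrite -IabZ //.
  apply: Iab_le; [exact: iab_norm|exact: iabZ|].
  move=> r /andP[r1 r2]; rewrite normrM; apply: ler_wpM2r => //.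
  by apply: hb; lra.
have a2 := int_abs_le s0 st tT.
rewrite normrM; apply: (@le_trans _ _ (1 * (P * rr (t - s)))); last by rewrite mul1r.
apply: ler_pM => //; apply: (le_trans a1); apply: ler_wpM2l => //.
by rewrite /rr; apply: (le_trans a2); rewrite lerDr subr_ge0.
Qed.

Lemma duhamel_moduli n : exists2 K : R, 0 <= K & forall s t, 0 <= s -> s <= t -> t <= T ->
  [/\ `|uu n t - uu n s| <= K * rr (t - s), `|vv n t - vv n s| <= K * rr (t - s) &
   `|uu n t - uu n s - (t - s) * vv n s| <= K * (t - s) * rr (t - s)].
Proof.
have [P P1 hP] := mode_bounds n.
have P0 : 0 <= P by lra.
have cS := SS_cont halpha hrho (n := n); have cD := DS_cont halpha hrho (n := n).
pose U := `|u0 n| + `|u1 n|; have U0 : 0 <= U by exact: addr_ge0.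
pose L := P * U + P * rr T.
have rT : 0 <= rr T by apply: modulus_ge0; exact: ltW.
have PU : 0 <= P * U by exact: mulr_ge0.
have L0 : 0 <= L by rewrite addr_ge0 // mulr_ge0.
have hu s : 0 <= s -> s <= T -> `|uu n s| <= L /\ `|vv n s| <= L.
  move=> s0 sT.
  have sT' : 0 <= s <= T by rewrite s0.
  have [b1 b2 b3 b4 _] := hP s sT'.
  have rs : rr s <= rr T.
    rewrite /rr; apply: lerD => //; apply: ler_wpM2r; first exact: norm2_ge0.
    exact: ler_wsqrtr.
  have c1 := @conv_le n (SS n) P 0 s (lexx 0) s0 sT cS P0.
  have c2 := @conv_le n (DS n) P 0 s (lexx 0) s0 sT cD P0.
  rewrite subr0 in c1 c2.
  have {}c1 : `|psi n * Iab 0 s (fun r => SS n (s - r) * g r)| <= P * rr T.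
    apply: (le_trans (c1 _)); last exact: ler_wpM2l.
    by move=> x /andP[x0 xs]; have [] := hP x; rewrite ?x0 ?(le_trans xs).
  have {}c2 : `|psi n * Iab 0 s (fun r => DS n (s - r) * g r)| <= P * rr T.
    apply: (le_trans (c2 _)); last exact: ler_wpM2l.
    by move=> x /andP[x0 xs]; have [] := hP x; rewrite ?x0 ?(le_trans xs).
  have PUE : P * U = `|u0 n| * P + `|u1 n| * P by rewrite /U mulrDr ![P * _]mulrC.
  have m1 (a b : R) : `|b| <= P -> `|a * b| <= `|a| * P.
    by move=> hb; rewrite normrM; exact: ler_wpM2l.
  split; rewrite /uu /vv /L; apply: (le_trans (ler_normB _ _)); apply: lerD => //;
    apply: (le_trans (ler_normD _ _)); rewrite PUE; apply: lerD.
  - exact: m1.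
  - exact: m1.
  - by apply: m1 => //; rewrite mulNr normrN.
  - exact: m1.
pose N4 : R := n%:R ^+ 4; have N0 : 0 <= N4 by exact: exprn_ge0.
exists ((2 + N4) * (P * L) + P).
  by rewrite addr_ge0 // mulr_ge0 ?addr_ge0 // mulr_ge0.
move=> s t s0 st tT; set h := t - s.
have h0' : 0 <= h by rewrite subr_ge0.
have hT' : h <= T by rewrite /h; lra.
have [bu bv] := hu s s0 (le_trans st tT).
have r0 := modulus_ge0 h0'.
have hr : h <= rr h by rewrite /rr lerDl mulr_ge0 ?sqrtr_ge0 ?norm2_ge0.
have sub x : 0 <= x <= h -> 0 <= x <= T by move=> /andP[x0 xh]; rewrite x0 (le_trans xh).
have PL0 : 0 <= P * L by exact: mulr_ge0.
have S1 x : 0 <= x <= h -> `|SS n x| <= P * x.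
  move=> xh; have /andP[x0 xh'] := xh.
  have := @mvt_bound (SS n) (DS n) P x (dSS halpha hrho n); rewrite SS0 subr0; apply => //.
  move=> y /andP[y0 yx]; have yT : 0 <= y <= T by rewrite y0 /=; lra.
  by have [] := hP y yT.
have C1 : `|CC n h - 1| <= P * h.
  have := @mvt_bound (CC n) (fun x => - n%:R ^+ 4 * SS n x) P h (dCC halpha hrho n); rewrite CC0; apply => //.
  by move=> y yh; have [_ _ _ + _] := hP y (sub y yh); rewrite mulNr normrN.
have C2 : `|CC n h - 1| <= n%:R ^+ 4 * P * h * h.
  have := @mvt_bound (CC n) (fun x => - n%:R ^+ 4 * SS n x) (n%:R ^+ 4 * P * h) h (dCC halpha hrho n); rewrite CC0; apply => //.
  move=> y yh; rewrite mulNr normrN normrM ger0_norm ?exprn_ge0 // -mulrA.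
  apply: ler_wpM2l; first exact: exprn_ge0.
  by apply: (le_trans (S1 y yh)); apply: ler_wpM2l => //; case/andP: yh.
have D1 x : 0 <= x <= h -> `|DS n x - 1| <= P * x.
  move=> xh; have /andP[x0 xh'] := xh.
  have := @mvt_bound (DS n) _ P x (dDS halpha hrho n); rewrite DS0; apply => //.
  move=> y /andP[y0 yx]; have yT : 0 <= y <= T by rewrite y0 /=; lra.
  by have [] := hP y yT.
have S2 : `|SS n h - h| <= P * h * h.
  have d x : is_derive x (1 : R) (fun x => SS n x + -1 * x) (DS n x - 1).
    by apply: is_derive1_eq (is_derive1D (dSS halpha hrho n x) (is_derive_lin (-1) x)) _.
  have := @mvt_bound _ _ (P * h) h d; rewrite SS0 mulr0 addr0 subr0 mulN1r; apply => //.
  move=> y yh; apply: (le_trans (D1 y yh)); apply: ler_wpM2l => //; by case/andP: yh.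
have hh : 0 <= h <= h by rewrite h0' lexx.
have [bC bS bD b4 _] := hP h (sub h hh).
have N1 := @conv_le n (SS n) (P * h) s t s0 st tT cS (mulr_ge0 P0 h0').
have {}N1 : `|psi n * Iab s t (fun r => SS n (t - r) * g r)| <= P * h * rr h.
  apply: N1 => x xh; apply: (le_trans (S1 x xh)); apply: ler_wpM2l => //; by case/andP: xh.
have N1' := @conv_le n (SS n) P s t s0 st tT cS P0.
have {}N1' : `|psi n * Iab s t (fun r => SS n (t - r) * g r)| <= P * rr h.
  by apply: N1' => x xh; have [] := hP x (sub x xh).
have N2 := @conv_le n (DS n) P s t s0 st tT cD P0.
have {}N2 : `|psi n * Iab s t (fun r => DS n (t - r) * g r)| <= P * rr h.
  by apply: N2 => x xh; have [] := hP x (sub x xh).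
have hh2 : 0 <= h <= h by rewrite h0' lexx.
have tri (a b z A B Z : R) : `|a| <= A -> `|b| <= B -> `|z| <= Z ->
    `|a * uu n s + b * vv n s - z| <= A * L + B * L + Z.
  move=> ha hb hz; apply: (le_trans (ler_normB _ _)); apply: lerD => //.
  by apply: (le_trans (ler_normD _ _)); apply: lerD; rewrite normrM; apply: ler_pM.
have q1 : 0 <= P * L * (rr h - h) by rewrite mulr_ge0 ?subr_ge0.
have q2 : 0 <= N4 * (P * L) * (rr h - h) by rewrite !mulr_ge0 ?subr_ge0.
have q4 : 0 <= N4 * (P * L) * rr h by rewrite !mulr_ge0.
have q5 : 0 <= (P * L) * rr h by rewrite !mulr_ge0.
split.
- rewrite (duhamel_step n s0 st tT) -/h.
  set I := psi n * _ in N1' *.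
  have -> : CC n h * uu n s + SS n h * vv n s - I - uu n s =
    (CC n h - 1) * uu n s + SS n h * vv n s - I by ring.
  apply: (le_trans (tri _ _ _ _ _ _ C1 (S1 h hh2) N1')); nra.
- rewrite (duhamel_dt_step n s0 st tT) -/h.
  set I := psi n * _ in N2 *.
  have -> : - n%:R ^+ 4 * SS n h * uu n s + DS n h * vv n s - I - vv n s =
    (- N4 * SS n h) * uu n s + (DS n h - 1) * vv n s - I by rewrite /N4; ring.
  have B4 : `|- N4 * SS n h| <= N4 * (P * h).
    by rewrite mulNr normrN normrM (ger0_norm N0); apply: ler_wpM2l => //; exact: S1.
  apply: (le_trans (tri _ _ _ _ _ _ B4 (D1 h hh2) N2)); nra.
- rewrite (duhamel_step n s0 st tT) -/h.
  set I := psi n * _ in N1 *.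
  have -> : CC n h * uu n s + SS n h * vv n s - I - uu n s - h * vv n s =
    (CC n h - 1) * uu n s + (SS n h - h) * vv n s - I by ring.
  have q1' : 0 <= h * (P * L * (rr h - h)) by rewrite mulr_ge0.
  have q2' : 0 <= h * (N4 * (P * L) * (rr h - h)) by rewrite mulr_ge0.
  have q5' : 0 <= h * (P * L * rr h) by rewrite mulr_ge0.
  apply: (le_trans (tri _ _ _ _ _ _ C2 S2 N1)); rewrite -/N4; nra.
Qed.

End Evolution.

(** * Regularity of the evolution in the norms of X_N^2 and X_N^0 *)

Section Convergence.
Context {R : realType}.
Implicit Types (s t x y h e d : R) (n m k N K M : nat).

Lemma bounded_tail (a : nat -> R) (B e : R) : (forall n, 0 <= a n) ->
  (forall N, \sum_(k < N) a k <= B) -> 0 < e ->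
  exists M, forall N, \sum_(M <= k < N) a k <= e.
Proof.
move=> a0 hB e0.
pose E := [set \sum_(k < N) a k | N in setT].
have hE : has_sup E.
  by split; [exists (\sum_(k < 0) a k); exists 0%N | exists B => _ [N _ <-]].
have [_ [M _ <-] hM] := sup_adherent e0 hE.
exists M => N; have [NM|MN] := leqP N M; first by rewrite big_geq // ltW.
have : \sum_(k < N) a k <= sup E by apply: sup_upper_bound => //; exists N.
rewrite -[X in X <= _](big_mkord xpredT a) (big_cat_nat (n := M)) //=; last exact: ltnW.
rewrite (big_mkord xpredT a); lra.
Qed.

Lemma head_small (A : R -> Prop) (D : nat -> R -> R) s :
  (forall n e, 0 < e -> exists2 d, 0 < d & forall t, A t -> `|t - s| < d -> D n t <= e) ->
  forall M e, 0 < e -> exists2 d, 0 < d & forall t, A t -> `|t - s| < d -> \sum_(n < M) D n t <= e.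
Proof.
move=> hD; elim=> [|M IH] e e0.
  by exists 1 => // t _ _; rewrite big_ord0 ltW.
have e2 : 0 < e / 2 by exact: divr_gt0.
have [d1 d10 h1] := IH _ e2; have [d2 d20 h2] := hD M _ e2.
exists (Num.min d1 d2); first by rewrite lt_min d10.
move=> t At; rewrite lt_min => /andP[t1 t2]; rewrite big_ord_recr /= (splitr e).
by apply: lerD; [exact: h1|exact: h2].
Qed.

Lemma Xnorm_cvg0 {I : Type} (F : set_system I) {FF : Filter F} p (a : I -> nat -> R) :
  (forall e, 0 < e -> \forall t \near F, forall N, \sum_(n < N) wt p n * a t n ^+ 2 <= e ^+ 2) ->
  Xnorm p (a t) @[t --> F] --> 0%E.
Proof.
move=> h.
have X0 i : (0 <= Xnorm p (a i))%E by exact: poweR_ge0.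
have {}h e : 0 < e -> \forall t \near F, (Xnorm p (a t) <= e%:E)%E.
  move=> e0; apply: filterS (h e e0) => t; apply: Xnorm_le; exact: ltW.
apply/fine_cvgP; split.
  apply: filterS (h 1 ltr01) => t ht; apply/fin_numP.
  have := X0 t; case: (Xnorm p (a t)) ht => //.
apply/cvgrPdist_le => e e0; apply: filterS (h e e0) => t /= ht.
have := X0 t; case: (Xnorm p (a t)) ht => //= r.
by rewrite !lee_fin => r1 r0; rewrite sub0r normrN ger0_norm.
Qed.

Lemma is_derive1_sum (I : Type) (r : seq I) (f df : I -> R -> R) t :
  (forall i, is_derive t (1 : R) (f i) (df i t)) ->
  is_derive t (1 : R) (fun x => \sum_(i <- r) f i x) (\sum_(i <- r) df i t).
Proof.
move=> h; elim: r => [|i r IH].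
  by under eq_fun do rewrite big_nil; rewrite big_nil; exact: is_derive_cst.
by under eq_fun do rewrite big_cons; rewrite big_cons; exact: is_derive1D.
Qed.

Lemma within_near (D : set R) s (P : R -> Prop) d : 0 < d ->
  (forall t, D t -> `|t - s| < d -> P t) -> \forall t \near within D (nbhs s), P t.
Proof.
move=> d0 h; rewrite near_withinE; apply/nbhs_ballP; exists d => //= t.
by rewrite /ball /= distrC => hd Dt; exact: h.
Qed.

Lemma within_dnear (D : set R) s (P : R -> Prop) d : 0 < d ->
  (forall t, D t -> t != s -> `|t - s| < d -> P t) -> \forall t \near within D s^', P t.
Proof.
move=> d0 h; rewrite near_withinE; rewrite /dnbhs near_withinE; apply/nbhs_ballP; exists d => //= t.
by rewrite /ball /= distrC => hd ts Dt; exact: h.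
Qed.

Lemma derive_of_bound (f : R -> R) (v s : R) :
  (forall e, 0 < e -> exists2 d, 0 < d &
     forall t, `|t - s| < d -> `|f t - f s - (t - s) * v| <= e * `|t - s|) ->
  is_derive s (1 : R) f v.
Proof.
move=> h.
have c : h^-1 *: ((f \o shift s) (h *: 1) - f s) @[h --> 0^'] --> v.
  apply/cvgrPdist_le => e e0; have [d d0 hd] := h e e0.
  rewrite /dnbhs near_withinE; apply/nbhs_ballP; exists d => //= t.
  rewrite /ball /= sub0r normrN => td t0.
  have := hd (t + s); rewrite addrK => /(_ td).
  rewrite /GRing.scale /= mulr1 => hb.
  have tp : 0 < `|t| by rewrite normr_gt0.
  rewrite -(ler_pM2r tp) -normrM.
  have -> : (v - t^-1 * (f (t + s) - f s)) * t = - (f (t + s) - f s - t * v) by field.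
  by rewrite normrN.
by split; [apply/cvg_ex; exists v|exact: cvg_lim c].
Qed.

Lemma cont_of_bound (f : R -> R) (D : set R) :
  (forall s e, D s -> 0 < e -> exists2 d, 0 < d &
     forall t, D t -> `|t - s| < d -> `|f t - f s| <= e) ->
  {within D, continuous f}.
Proof.
move=> h; apply/subspace_continuousP => s Ds; apply/cvgrPdist_le => e e0.
have [d d0 hd] := h s e Ds e0.
by apply: (within_near d0) => t Dt ts; rewrite distrC; exact: hd.
Qed.

Context (alpha rho : R).
Context (halpha : 0 <= alpha < 1) (hrho : 0 < rho < 2).
Context (T : R) (hT : 0 < T) (g : R -> R) (hg : sqint 0 T g) (u0 u1 : nat -> R).
Local Notation uu := (duhamel alpha rho g u0 u1).
Local Notation vv := (duhamel_dt alpha rho g u0 u1).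
Local Notation energy := (energy alpha rho g u0 u1).
Local Notation WW := (Xenergy alpha rho g u0 u1).
Local Notation rr := (modulus T g).
Local Notation energy_const := (energy_const rho).
Local Notation dirc := (direct_const rho).

Lemma modulus_small e : 0 < e -> exists2 d, 0 < d & forall h, 0 <= h < d -> rr h <= e.
Proof.
move=> e0; set G := norm2 0 T g; have G0 : 0 <= G by exact: norm2_ge0.
pose q := Num.min 1 (e / (1 + G)).
have q0 : 0 < q by rewrite lt_min ltr01 divr_gt0 // ltr_wpDr.
have q1 : q <= 1 by rewrite ge_min lexx.
have qe : q * (1 + G) <= e by rewrite -ler_pdivlMr ?ltr_wpDr // ge_min lexx orbT.
exists (q ^+ 2); first exact: exprn_gt0.
move=> h /andP[h0 hq]; rewrite /modulus -/G.
have sq1 : Num.sqrt h <= q.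
  by rewrite -[leRHS](ger0_norm (ltW q0)) -sqrtr_sqr; apply: ler_wsqrtr; exact: ltW.
have hq' : h <= q.
  by apply: (le_trans (ltW hq)); rewrite expr2 ler_piMl // ltW.
have : Num.sqrt h * G <= q * G by exact: ler_wpM2r.
lra.
Qed.

Lemma duhamel_moduli_abs n : exists2 K : R, 0 <= K & forall s t, 0 <= s <= T -> 0 <= t <= T ->
  [/\ `|uu n t - uu n s| <= K * rr `|t - s|, `|vv n t - vv n s| <= K * rr `|t - s| &
   `|uu n t - uu n s - (t - s) * vv n s| <= K * `|t - s| * rr `|t - s|].
Proof.
have [K K0 h] := duhamel_moduli halpha hrho hT hg u0 u1 n.
exists (2 * K); first exact: mulr_ge0.
have dbl (x a : R) : 0 <= a -> x <= K * a -> x <= 2 * K * a.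
  by move=> a0 xa; apply: (le_trans xa); rewrite -mulrA ler_peMl ?mulr_ge0 // ler1n.
move=> s t /andP[s0 sT] /andP[t0 tT]; have [st|/ltW ts] := leP s t.
  have d0 : 0 <= t - s by rewrite subr_ge0.
  have rd := modulus_ge0 T g d0.
  rewrite (ger0_norm d0); have [a b c] := h s t s0 st tT.
  split; [exact: dbl|exact: dbl|].
  by rewrite -mulrA; apply: dbl; [exact: mulr_ge0|rewrite mulrA].
have d0 : 0 <= s - t by rewrite subr_ge0.
have rd := modulus_ge0 T g d0.
rewrite (distrC t s) (ger0_norm d0); have [a b c] := h t s t0 ts sT.
split; [by rewrite distrC; exact: dbl|by rewrite distrC; exact: dbl|].
(* For t < s the estimate is available at the base point t; moving it to s costs the increment of
   v. *)
have -> : uu n t - uu n s - (t - s) * vv n s =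
  - (uu n s - uu n t - (s - t) * vv n t) + (s - t) * (vv n s - vv n t) by ring.
apply: (le_trans (ler_normD _ _)); rewrite normrN normrM (ger0_norm d0).
have := ler_wpM2l d0 b; lra.
Qed.

Lemma is_derive_duhamel n t : 0 < t < T -> is_derive t (1 : R) (uu n) (vv n t).
Proof.
move=> /andP[t0 tT]; have [K K0 h] := duhamel_moduli_abs n.
have K1 : 0 < K + 1 by rewrite ltr_wpDl.
apply: derive_of_bound => e e0.
have [d d0 hd] := modulus_small (divr_gt0 e0 K1).
exists (Num.min d (Num.min t (T - t))); first by rewrite !lt_min d0 t0 subr_gt0.
move=> x; rewrite !lt_min => /and3P[xd xt xT].
have tI : 0 <= t <= T by rewrite !ltW.
have xI : 0 <= x <= T.
  have := ler_norm (x - t); have := ler_norm (- (x - t)); rewrite normrN; lra.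
have [_ _ b] := h t x tI xI; apply: (le_trans b).
rewrite mulrAC; apply: ler_wpM2r => //.
have hr : rr `|x - t| <= e / (K + 1) by apply: hd; rewrite normr_ge0.
apply: (@le_trans _ _ ((K + 1) * (e / (K + 1)))).
  by apply: ler_pM => //; [exact: modulus_ge0|rewrite lerDl].
by rewrite mulrC divfK // gt_eqF.
Qed.

Lemma duhamel_near n s e : 0 <= s <= T -> 0 < e -> exists2 d, 0 < d &
  forall t, 0 <= t <= T -> `|t - s| < d -> `|uu n t - uu n s| <= e /\ `|vv n t - vv n s| <= e.
Proof.
move=> sI e0; have [K K0 h] := duhamel_moduli_abs n.
have K1 : 0 < K + 1 by rewrite ltr_wpDl.
have [d d0 hd] := modulus_small (divr_gt0 e0 K1).
exists d => // t tI ts.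
have hr : K * rr `|t - s| <= e.
  apply: (@le_trans _ _ ((K + 1) * (e / (K + 1)))).
    by apply: ler_pM => //; [exact: modulus_ge0|rewrite lerDl|apply: hd; rewrite normr_ge0].
  by rewrite mulrC divfK // gt_eqF.
by have [a b _] := h s t sI tI; split; exact: le_trans hr.
Qed.

Context (M0 M1 : R)
  (h0 : forall N, \sum_(n < N) wt 2 n * u0 n ^+ 2 <= M0 ^+ 2)
  (h1 : forall N, \sum_(n < N) wt 0 n * u1 n ^+ 2 <= M1 ^+ 2).

(** Tails must be small uniformly for t near s: then continuity in norm follows from the continuity
    of finitely many modes. *)
Lemma energy_tail s e : 0 <= s <= T -> 0 < e -> exists2 d, 0 < d & exists M, forall t,
  0 <= t <= T -> `|t - s| < d -> forall N, \sum_(M <= k < N) energy k.+1 t <= e.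
Proof.
move=> /andP[s0 sT] e0.
have D0 : 0 <= dirc T by apply: (dirc_ge0 hrho); exact: ltW.
have e1 : 0 < e / (8 * (dirc T + 1)) by rewrite divr_gt0 // mulr_gt0 // ltr_wpDl.
have [d d0 hd] := Iab_abs_cont (proj2 hg) e1.
(* Restart from a time t0 shortly before s: the tail at t0 does not depend on t, and
   the control contributes little between t0 and t. *)
pose t0 := Num.max 0 (s - d / 2).
have t0I : 0 <= t0 <= T.
  by rewrite le_max lexx /= ge_max (ltW hT) /=; lra.
have e4 : 0 < e / 4 by exact: divr_gt0.
have [M hM] := bounded_tail (fun k => energy_ge0 alpha rho g u0 u1 k.+1 t0)
  (fun N => energy_sum halpha hrho hT hg h0 h1 N t0I) e4.
exists (d / 4); first exact: divr_gt0.
exists M => t /andP[t_0 tT] ts N.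
have [st tst] : s - d / 4 < t /\ t < s + d / 4.
  by have := ler_norm (t - s); have := ler_norm (- (t - s)); rewrite normrN; split; lra.
have t0t : t0 <= t by rewrite ge_max t_0 /=; lra.
have t0s : s - d / 2 <= t0 by rewrite le_max lexx orbT.
have /andP[t00 t0T] := t0I.
apply: (@le_trans _ _ (\sum_(M <= k < N) (2 * energy k.+1 t0 + 2 * source alpha rho g k.+1 t0 t))).
  by apply: ler_sum => k _; apply: (energy_step halpha hrho hg).
rewrite big_split /= -!mulr_sumr.
have A1 := hM N.
have source0 k : 0 <= source alpha rho g k t0 t by rewrite addr_ge0 ?sqr_ge0.
have A2 : \sum_(M <= k < N) source alpha rho g k.+1 t0 t <= \sum_(k < N) source alpha rho g k.+1 t0 t.
  have [NM|MN] := leqP N M; first by rewrite big_geq // sumr_ge0.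
  rewrite -[leRHS](big_mkord xpredT (fun k => source alpha rho g k.+1 t0 t)).
  rewrite [leRHS](big_cat_nat (n := M)) //=; last exact: ltnW.
  by rewrite lerDr sumr_ge0.
have A3 := source_sum halpha hrho hg N t00 t0t tT.
have A4 : Iab t0 t (fun r => g r ^+ 2) <= e / (8 * (dirc T + 1)).
  have -> : Iab t0 t (fun r => g r ^+ 2) = Iab t0 t (fun r => `|g r ^+ 2|).
    by apply: Iab_eq => x _; rewrite ger0_norm ?sqr_ge0.
  by apply: ltW; apply: hd => //; lra.
have A5 : dirc T * Iab t0 t (fun r => g r ^+ 2) <= e / 8.
  have -> : e / 8 = (dirc T + 1) * (e / (8 * (dirc T + 1))) by field; rewrite gt_eqF // ltr_wpDl.
  apply: ler_pM => //; first by apply: Iab_ge0 => x _; exact: sqr_ge0.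
  by rewrite lerDl.
lra.
Qed.

Definition Xdist2 n s t : R := wt 2 n * (uu n t - uu n s) ^+ 2 + (vv n t - vv n s) ^+ 2.

Lemma Xdist2_ge0 n s t : 0 <= Xdist2 n s t.
Proof. by rewrite addr_ge0 ?sqr_ge0 // mulr_ge0 ?wt_ge0 ?sqr_ge0. Qed.

Lemma Xdist2_energy n s t : (0 < n)%N -> Xdist2 n s t <= 2 * energy_const * (energy n t + energy n s).
Proof.
move=> n0; have a1 := Xenergy_energy halpha hrho g u0 u1 t n0; have a2 := Xenergy_energy halpha hrho g u0 u1 s n0.
rewrite /Xdist2 wt2E gtn_eqF //.
apply: (@le_trans _ _ (2 * (WW n t + WW n s))); last by lra.
rewrite /Xenergy; set N4 := n%:R ^+ 4; have N40 : 0 <= N4 by exact: exprn_ge0.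
have sqb (a b : R) : (a - b) ^+ 2 <= 2 * (a ^+ 2 + b ^+ 2) by have := sqr_ge0 (a + b); lra.
have := sqb (vv n t) (vv n s); have := ler_wpM2l N40 (sqb (uu n t) (uu n s)); lra.
Qed.

Lemma Xdist2_small s e : 0 <= s <= T -> 0 < e -> exists2 d, 0 < d & forall t,
  0 <= t <= T -> `|t - s| < d -> forall N, \sum_(n < N) Xdist2 n s t <= e.
Proof.
move=> sI e0; have Q0 := energy_const_ge0 rho.
have e1 : 0 < e / (8 * (energy_const + 1)) by rewrite divr_gt0 // mulr_gt0 // ltr_wpDl.
have [d1 d10 [M hM]] := energy_tail sI e1.
have e2 : 0 < e / 2 by exact: divr_gt0.
have hD n e' : 0 < e' -> exists2 d, 0 < d &
    forall t, 0 <= t <= T -> `|t - s| < d -> Xdist2 n s t <= e'.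
  move=> e'0; have w1 : 0 < wt 2 n + 1 :> R by rewrite ltr_wpDl ?wt_ge0.
  pose q := Num.sqrt (e' / (wt 2 n + 1)).
  have q0 : 0 < q by rewrite sqrtr_gt0 divr_gt0.
  have [d d0 hd] := duhamel_near n sI q0.
  exists d => // t tI ts; have [a b] := hd t tI ts.
  have sqq (x : R) : `|x| <= q -> x ^+ 2 <= e' / (wt 2 n + 1).
    move=> xq; rewrite -[leRHS]sqr_sqrtr; last by rewrite divr_ge0 // ltW.
    by rewrite -real_normK ?num_real // ler_sqr ?nnegrE // sqrtr_ge0.
  have := sqq _ b; have := ler_wpM2l (wt_ge0 2 n) (sqq _ a).
  have -> : wt 2 n * (e' / (wt 2 n + 1)) = e' - e' / (wt 2 n + 1).
    by field; rewrite gt_eqF.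
  rewrite /Xdist2; lra.
(* The head takes M + 1 modes: the energy tail begins at mode M + 1, and mode 0 is always treated
   separately. *)
have [d2 d20 h2] := head_small hD M.+1 e2.
exists (Num.min d1 d2); first by rewrite lt_min d10.
move=> t tI; rewrite lt_min => /andP[t1 t2] N.
have hs := hM s sI _ N; rewrite subrr normr0 in hs; have {}hs := hs d10.
have ht := hM t tI t1 N.
have h2t := h2 t tI t2.
have tail : \sum_(M <= k < N) Xdist2 k.+1 s t <= e / 2.
  apply: (@le_trans _ _ (2 * energy_const * (\sum_(M <= k < N) energy k.+1 t + \sum_(M <= k < N) energy k.+1 s))).
    rewrite -big_split /= mulr_sumr; apply: ler_sum => k _; exact: Xdist2_energy.
  apply: (@le_trans _ _ (2 * energy_const * (e / (8 * (energy_const + 1)) + e / (8 * (energy_const + 1))))).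
    by apply: ler_wpM2l; [exact: mulr_ge0|exact: lerD].
  have -> : 2 * energy_const * (e / (8 * (energy_const + 1)) + e / (8 * (energy_const + 1))) = e / 2 - e / (2 * (energy_const + 1)).
    by field; rewrite gt_eqF // ltr_wpDl.
  by rewrite gerBl divr_ge0 ?ltW // mulr_gt0 // ltr_wpDl.
have [NM|MN] := leqP N M.+1.
  apply: (@le_trans _ _ (\sum_(n < M.+1) Xdist2 n s t)); last by lra.
  rewrite -!(big_mkord xpredT (fun n => Xdist2 n s t)) [leRHS](big_cat_nat (n := N)) //=.
  by rewrite lerDl sumr_ge0 // => n _; exact: Xdist2_ge0.
rewrite -(big_mkord xpredT (fun n => Xdist2 n s t)) (big_cat_nat (n := M.+1)) //=; last exact: ltnW.
rewrite big_mkord; case: N MN {hs ht} tail => // N MN tail.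
have tl : \sum_(M.+1 <= k < N.+1) Xdist2 k s t <= e / 2.
  rewrite big_add1 /=; apply: le_trans tail.
  have [NM|MN'] := leqP N M; first by rewrite big_geq // sumr_ge0 // => k _; exact: Xdist2_ge0.
  rewrite [leRHS]big_nat_recr /=; last exact: ltnW.
  by rewrite lerDl Xdist2_ge0.
by rewrite (splitr e); exact: lerD.
Qed.

Lemma Xenergy_sum t : 0 <= t <= T -> exists2 B : R, 0 <= B & forall N,
  \sum_(n < N) (wt 2 n * uu n t ^+ 2 + vv n t ^+ 2) <= B ^+ 2.
Proof.
move=> tI; set F := fun n => wt 2 n * uu n t ^+ 2 + vv n t ^+ 2.
have F0 n : 0 <= F n by rewrite addr_ge0 ?sqr_ge0 // mulr_ge0 ?wt_ge0 ?sqr_ge0.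
set E := 4 * (M0 ^+ 2 + M1 ^+ 2) + 4 * dirc T * Iab 0 T (fun r => g r ^+ 2).
have hE N : \sum_(k < N) energy k.+1 t <= E by exact: energy_sum.
have E0 : 0 <= E by have := hE 0%N; rewrite big_ord0.
have Q0 := energy_const_ge0 rho.
have B0 : 0 <= F 0%N + energy_const * E by rewrite addr_ge0 ?mulr_ge0.
exists (Num.sqrt (F 0%N + energy_const * E)); first exact: sqrtr_ge0.
case=> [|N]; rewrite sqr_sqrtr //; first by rewrite big_ord0.
rewrite big_ord_recl; apply: lerD => //.
apply: (@le_trans _ _ (energy_const * \sum_(k < N) energy k.+1 t)); last exact: ler_wpM2l.
rewrite mulr_sumr; apply: ler_sum => k _.
by have := Xenergy_energy halpha hrho g u0 u1 t (ltn0Sn k); rewrite /Xenergy /= wt2E.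
Qed.

Lemma evolution_cont2 : Xcontinuous 2 `[0, T] (fun t n => uu n t).
Proof.
split=> [t|s]; rewrite /= in_itv /=.
  move=> tI; have [B B0 hB] := Xenergy_sum tI; apply: (inXI B0) => N.
  by apply: le_trans (hB N); apply: ler_sum => n _; rewrite lerDl sqr_ge0.
move=> sI; apply: Xnorm_cvg0 => e e0.
have [d d0 hd] := Xdist2_small sI (exprn_gt0 2 e0).
apply: (within_near d0) => t; rewrite /= in_itv /= => tI ts N.
by apply: le_trans (hd t tI ts N); apply: ler_sum => n _; rewrite lerDl sqr_ge0.
Qed.

Lemma evolution_cont0 : Xcontinuous 0 `[0, T] (fun t n => vv n t).
Proof.
split=> [t|s]; rewrite /= in_itv /=.
  move=> tI; have [B B0 hB] := Xenergy_sum tI; apply: (inXI B0) => N.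
  apply: le_trans (hB N); apply: ler_sum => n _.
  by rewrite wt0E mul1r lerDr mulr_ge0 ?wt_ge0 ?sqr_ge0.
move=> sI; apply: Xnorm_cvg0 => e e0.
have [d d0 hd] := Xdist2_small sI (exprn_gt0 2 e0).
apply: (within_near d0) => t; rewrite /= in_itv /= => tI ts N.
apply: le_trans (hd t tI ts N); apply: ler_sum => n _.
by rewrite wt0E mul1r lerDr mulr_ge0 ?wt_ge0 ?sqr_ge0.
Qed.

Lemma duhamel_within_cont n : {within `[0, T], continuous (uu n)}.
Proof.
apply: cont_of_bound => s e; rewrite /= in_itv /= => sI e0.
have [d d0 hd] := duhamel_near n sI e0.
by exists d => // t; rewrite /= in_itv /= => tI ts; have [] := hd t tI ts.
Qed.

Lemma evolution_derive : Xderivative 0 `[0, T] (fun t n => uu n t) (fun t n => vv n t).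
Proof.
move=> s; rewrite /= in_itv /= => sI; apply: Xnorm_cvg0 => e e0.
have [d d0 hd] := Xdist2_small sI (exprn_gt0 2 e0).
apply: (within_dnear d0) => t; rewrite /= in_itv /= => tI nts ts N.
pose D n := (uu n t - uu n s) / (t - s) - vv n s.
have ts0 : t - s != 0 by rewrite subr_eq0.
pose a := Num.min s t; pose b := Num.max s t.
have ab : a < b by rewrite /a /b; case: (ltgtP s t) nts => //; rewrite eq_sym => ->; rewrite eqxx.
have aI : 0 <= a <= T by rewrite /a /Num.min; case: ifP.
have bI : 0 <= b <= T by rewrite /b /Num.max; case: ifP.
(* The difference quotients D n are fixed, and the mean value theorem applied to
   F bounds their sum of squares by the velocities at a single time c. *)
pose F r := \sum_(n < N) D n * (uu n r + (- vv n s) * r).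
pose dF r := \sum_(n < N) D n * (vv n r + - vv n s).
have dFF r : r \in `]a, b[ -> is_derive r (1 : R) F (dF r).
  rewrite in_itv /= => /andP[ar rb].
  apply: (@is_derive1_sum 'I_N _ (fun i x => D i * (uu i x + - vv i s * x)) (fun i x => D i * (vv i x + - vv i s))) => i.
  apply: is_derive1Z.
  apply: is_derive1D; last exact: is_derive_lin.
  by apply: is_derive_duhamel; case/andP: aI; case/andP: bI => *; apply/andP; split; lra.
have cF : {within `[a, b], continuous F}.
  apply: (@continuous_subspaceW _ _ _ `[0, T]).
    by move=> x /=; rewrite !in_itv /= => /andP[ax xb]; case/andP: aI; case/andP: bI => *; apply/andP; split; lra.
  apply: (@continuous_big _ _ _ _ _ (@add_continuous _)) => n _.
  have cl : {within `[0, T], continuous (fun r : R => (- vv n s) * r)}.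
    by apply: continuous_subspaceT => r; exact: mulrl_continuous.
  move=> x; apply: cvgM; first exact: cvg_cst.
  by apply: cvgD; [exact: duhamel_within_cont|exact: cl].
have [c cI hc] := MVT ab dFF cF.
have hst : F t - F s = dF c * (t - s).
  move: hc; rewrite /a /b; case: (ltP s t) => st // hc.
  by rewrite -opprB hc; ring.
have cI2 : 0 <= c <= T.
  move: cI; rewrite in_itv /= => /andP[ac cb]; case/andP: aI; case/andP: bI => *; apply/andP; split; lra.
have cs : `|c - s| < d.
  apply: le_lt_trans ts; move: cI; rewrite in_itv /= /a /b; case: (ltP s t) => st /andP[ac cb].
    by rewrite !gtr0_norm ?subr_gt0 //; lra.
  by rewrite distrC (distrC t) !ger0_norm ?subr_ge0 //; lra.
have key : \sum_(n < N) D n ^+ 2 = dF c.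
  apply: (mulIf ts0); rewrite -hst /F -sumrB mulr_suml; apply: eq_bigr => n _.
  rewrite -mulrBr expr2 -mulrA; congr (_ * _); rewrite {1}/D.
  by field.
(* Young's inequality; the first half is absorbed, since [key] identifies dF c with the sum of the D
   n ^+ 2. *)
have half : dF c <= 2^-1 * \sum_(n < N) D n ^+ 2 + 2^-1 * \sum_(n < N) Xdist2 n s c.
  rewrite !mulr_sumr -big_split /=; apply: ler_sum => n _; rewrite /Xdist2.
  have : 0 <= wt 2 n * (uu n c - uu n s) ^+ 2 by rewrite mulr_ge0 ?wt_ge0 ?sqr_ge0.
  by have := sqr_ge0 (D n - (vv n c - vv n s)); nra.
have sm := hd c cI2 cs N.
have -> : \sum_(n < N) wt 0 n * ((uu n t - uu n s) / (t - s) - vv n s) ^+ 2 = \sum_(n < N) D n ^+ 2.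
  by apply: eq_bigr => n _; rewrite wt0E mul1r.
rewrite key in half *; lra.
Qed.

End Convergence.

(** * Adjoint solutions and their traces *)

Section Adjoint.
Context {R : realType}.
Implicit Types (s t x y h e d : R) (n m k N K M : nat).
Context (alpha rho : R).
Context (halpha : 0 <= alpha < 1) (hrho : 0 < rho < 2).
Local Notation sig := (damp alpha rho).
Local Notation om := (om alpha rho).
Local Notation ec := (dampcos alpha rho).
Local Notation es := (dampsin alpha rho).
Local Notation SS := (Smode alpha rho).
Local Notation CC := (Cmode alpha rho).
Local Notation DS := (dSmode alpha rho).
Local Notation gapc := (gapc rho).
Local Notation dirc := (direct_const rho).
Local Notation psi n := (psi n : R).

Lemma bracket_const (s N4 t1 tau : R) (w dw u du : R -> R) : t1 <= tau ->
  {within `[t1, tau], continuous w} -> {within `[t1, tau], continuous dw} ->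
  (forall t, t \in `]t1, tau[ -> is_derive t (1 : R) w (dw t)) ->
  (forall t, t \in `]t1, tau[ -> exists ddw : R, is_derive t (1 : R) dw ddw /\
     ddw - 2 * s * dw t + N4 * w t = 0) ->
  (forall t, is_derive t (1 : R) u (du t)) ->
  (forall t, is_derive t (1 : R) du (- N4 * u t - 2 * s * du t)) ->
  (dw t1 - 2 * s * w t1) * u t1 - w t1 * du t1 =
  (dw tau - 2 * s * w tau) * u tau - w tau * du tau.
Proof.
rewrite le_eqVlt => /predU1P[-> //|lt] cw cdw d1 d2 d3 d4.
(* The Lagrange bracket of the adjoint solution w and the forward solution u. *)
pose B t := (dw t + - (2 * s) * w t) * u t + - 1 * (w t * du t).
have dB t : t \in `]t1, tau[ -> is_derive t (1 : R) B ((fun=> 0) t).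
  move=> tI; have [ddw [e1 e2]] := d2 t tI.
  have := is_derive1D (is_derive1M (is_derive1D e1 (is_derive1Z (- (2 * s)) (d1 t tI))) (d3 t))
   (is_derive1Z (-1) (is_derive1M (d1 t tI) (d4 t))).
  move=> H; apply: (is_derive1_eq H).
  have -> : ddw = 2 * s * dw t - N4 * w t by lra.
  ring.
have cu : {within `[t1, tau], continuous u}.
  by apply: continuous_subspaceT; exact: is_derive_continuous d3.
have cdu : {within `[t1, tau], continuous du}.
  by apply: continuous_subspaceT; exact: is_derive_continuous d4.
have cB : {within `[t1, tau], continuous B}.
  move=> x; apply: cvgD.
    apply: cvgM; last exact: cu.
    by apply: cvgD; [exact: cdw|apply: cvgM; [exact: cvg_cst|exact: cw]].
  by apply: cvgM; [exact: cvg_cst|apply: cvgM; [exact: cw|exact: cdu]].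
have [c _] := MVT lt dB cB; rewrite mul0r /B => /eqP.
rewrite subr_eq0 => /eqP; lra.
Qed.

(** The forward solution is started at t1, where simple initial data make the bracket read off w or
    its derivative. *)
Lemma bracket_shift (s N4 t1 tau : R) (w dw u du : R -> R) : t1 <= tau ->
  {within `[t1, tau], continuous w} -> {within `[t1, tau], continuous dw} ->
  (forall t, t \in `]t1, tau[ -> is_derive t (1 : R) w (dw t)) ->
  (forall t, t \in `]t1, tau[ -> exists ddw : R, is_derive t (1 : R) dw ddw /\
     ddw - 2 * s * dw t + N4 * w t = 0) ->
  (forall t, is_derive t (1 : R) u (du t)) ->
  (forall t, is_derive t (1 : R) du (- N4 * u t - 2 * s * du t)) ->
  (dw t1 - 2 * s * w t1) * u 0 - w t1 * du 0 =
  (dw tau - 2 * s * w tau) * u (tau - t1) - w tau * du (tau - t1).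
Proof.
move=> le cw cdw d1 d2 d3 d4.
have sh (f df : R -> R) : (forall x, is_derive x (1 : R) f (df x)) ->
    forall x, is_derive x (1 : R) (fun y => f (1 * y + - t1)) (df (1 * x + - t1)).
  by move=> d x; apply: is_derive1_eq (is_derive_affine (d (1 * x + - t1))) _; rewrite mul1r.
have := bracket_const le cw cdw d1 d2 (sh _ _ d3) (sh du (fun x => - N4 * u x - 2 * s * du x) d4).
by rewrite !mul1r subrr.
Qed.

Lemma damp2 n : rho * n%:R `^ (2 * alpha) = 2 * sig n.
Proof. by rewrite /damp; field. Qed.

Lemma wtV p n : wt p n * wt (- p) n = 1 :> R.
Proof.
rewrite /wt; case: (posnP n) => [_|n0]; first by rewrite mulr1.
by rewrite -powRD ?pnatr_eq0 ?gtn_eqF ?implybT // mulrN subrr powRr0.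
Qed.

Section Data.
Context (tau : R) (w0 w1 : nat -> R).

(** In the reversed time tau - t the adjoint equation becomes the damped modal equation, with the
    sign of the velocity changed. *)
Definition adj n t : R := w0 n * CC n (tau - t) - w1 n * SS n (tau - t).
Definition adj_dt n t : R := w0 n * n%:R ^+ 4 * SS n (tau - t) + w1 n * DS n (tau - t).

(** The bracket with S_n, started at t1 with data (0, 1), determines w; the bracket with C_n, with
    data (1, 0), then determines its derivative. *)
Lemma adjoint_unique (w dw : R -> nat -> R) : adjoint_solution alpha rho tau w0 w1 w dw ->
  forall n t, 0 <= t <= tau -> w t n = adj n t /\ dw t n = adj_dt n t.
Proof.
move=> hw n t1 /andP[t10 t1T]; have [cw cdw d1 d2 [ew edw]] := hw n.
have sub1 : `[t1, tau] `<=` `[0, tau].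
  by move=> x /=; rewrite !in_itv /= => /andP[x1 ->]; rewrite (le_trans t10).
have sub2 x : x \in `]t1, tau[ -> x \in `]0, tau[.
  by rewrite !in_itv /= => /andP[x1 ->]; rewrite (le_lt_trans t10).
have cw' := continuous_subspaceW sub1 cw; have cdw' := continuous_subspaceW sub1 cdw.
have d1' x (xI : x \in `]t1, tau[) := d1 x (sub2 x xI).
have d2' x : x \in `]t1, tau[ -> exists ddw : R, is_derive x (1 : R) (fun s => dw s n) ddw /\
     ddw - 2 * sig n * dw x n + n%:R ^+ 4 * w x n = 0.
  by move=> xI; have [ddw] := d2 x (sub2 x xI); rewrite damp2 => h; exists ddw.
have B1 := bracket_shift t1T cw' cdw' d1' d2' (dSS halpha hrho n) (dDS halpha hrho n).
have d4 x : is_derive x (1 : R) (fun x => - n%:R ^+ 4 * SS n x)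
    (- n%:R ^+ 4 * CC n x - 2 * sig n * (- n%:R ^+ 4 * SS n x)).
  apply: (is_derive1_eq (is_derive1Z (- n%:R ^+ 4) (dSS halpha hrho n x))).
  by rewrite /dSmode; ring.
have B2 := bracket_shift t1T cw' cdw' d1' d2' (dCC halpha hrho n) d4.
move: B1 B2; rewrite /= SS0 CC0 DS0 ew edw !mulr0 !mulr1 sub0r subr0 => B1 B2.
have e1 : w t1 n = adj n t1.
  by rewrite -[LHS]opprK B1 /adj /dSmode; ring.
split=> //; rewrite -[LHS](subrK (2 * sig n * w t1 n)) B2 e1 /adj /adj_dt /dSmode; ring.
Qed.

Lemma is_derive_adj n t : is_derive t (1 : R) (adj n) (adj_dt n t) /\
  is_derive t (1 : R) (adj_dt n) (2 * sig n * adj_dt n t - n%:R ^+ 4 * adj n t).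
Proof.
have rv (f df : R -> R) : (forall x, is_derive x (1 : R) f (df x)) ->
    forall x, is_derive x (1 : R) (fun y => f (tau - y)) (- df (tau - x)).
  move=> d x; have e y : tau - y = -1 * y + tau by rewrite mulN1r addrC.
  under eq_fun do rewrite e; rewrite e.
  by apply: is_derive1_eq (is_derive_affine (d (-1 * x + tau))) _; rewrite [LHS]mulN1r.
have dS := rv _ _ (dSS halpha hrho n) t; have dC := rv _ _ (dCC halpha hrho n) t.
have dD := rv _ _ (dDS halpha hrho n) t.
split.
  have := is_derive1D (is_derive1Z (w0 n) dC) (is_derive1Z (- w1 n) dS).
  have -> : (fun x => w0 n * CC n (tau - x) + - w1 n * SS n (tau - x)) = adj n.
    by apply/funext => x; rewrite /adj mulNr.
  by move=> h; apply: (is_derive1_eq h); rewrite /adj_dt; ring.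
have := is_derive1D (is_derive1Z (w0 n * n%:R ^+ 4) dS) (is_derive1Z (w1 n) dD).
move=> h; apply: (is_derive1_eq h); rewrite /adj_dt /adj /dSmode; ring.
Qed.

Lemma adj_cont n : continuous (adj n).
Proof. exact: (@is_derive_continuous _ (adj n) (adj_dt n) (fun x => (is_derive_adj n x).1)). Qed.

Lemma adj_dt_cont n : continuous (adj_dt n).
Proof.
exact: (@is_derive_continuous _ (adj_dt n) (fun t => 2 * sig n * adj_dt n t - n%:R ^+ 4 * adj n t)
  (fun x => (is_derive_adj n x).2)).
Qed.

Lemma adjoint_exists : adjoint_solution alpha rho tau w0 w1 (fun t n => adj n t) (fun t n => adj_dt n t).
Proof.
move=> n; split.
- by apply: continuous_subspaceT; exact: adj_cont.
- by apply: continuous_subspaceT; exact: adj_dt_cont.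
- by move=> t _; exact: (is_derive_adj n t).1.
- move=> t _; exists (2 * sig n * adj_dt n t - n%:R ^+ 4 * adj n t); split.
    exact: (is_derive_adj n t).2.
  by rewrite damp2; ring.
- by rewrite /adj /adj_dt subrr CC0 SS0 DS0; split; ring.
Qed.

Definition acoef n : R := psi n * w0 n.
Definition bcoef n : R := psi n * ((sig n * w0 n - w1 n) / om n).

Lemma adj_coef n t : (0 < n)%N ->
  psi n * adj n t = acoef n * ec n (tau - t) + bcoef n * es n (tau - t).
Proof.
move=> n0; have o0 := om_gt0 halpha hrho n0.
rewrite /adj /acoef /bcoef /Smode /Cmode gtn_eqF //.
by field; rewrite gt_eqF.
Qed.

(** The velocity w1 and sigma_n w0 are divided by om_n, of order n^2, so data in X_N^0 x X_N^(-2)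
    already have square summable trace coefficients. This is why the trace exists in L^2. *)
Lemma coef_le n : (0 < n)%N ->
  acoef n ^+ 2 + bcoef n ^+ 2 <= (1 + 2 / gapc ^+ 2) * (wt 0 n * w0 n ^+ 2 + wt (- 2) n * w1 n ^+ 2).
Proof.
move=> n0; have g0 := gapc_gt0 hrho; have o0 := om_gt0 halpha hrho n0.
have V := wtV 2 n; rewrite wt2E gtn_eqF // in V.
rewrite wt0E mul1r /acoef /bcoef.
set v := wt (- 2) n in V *; have v0 : 0 <= v by exact: wt_ge0.
set x := w0 n; set y := w1 n; set q := (_ - _) / _.
have sq2 (a : R) : (psi n * a) ^+ 2 <= a ^+ 2.
  by rewrite exprMn ler_piMl ?sqr_ge0 ?psi_le1.
have w2 := om_sqr_ge halpha hrho n0; have s2 := sig_sqr_le halpha hrho n0.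
set N4 : R := n%:R ^+ 4 in V w2 s2 *.
have hq : q ^+ 2 <= 2 / gapc ^+ 2 * (x ^+ 2 + v * y ^+ 2).
  rewrite /q expr_div_n ler_pdivrMr ?exprn_gt0 //.
  have X0 : 0 <= 2 / gapc ^+ 2 * (x ^+ 2 + v * y ^+ 2).
    by rewrite mulr_ge0 ?divr_ge0 ?sqr_ge0 // addr_ge0 ?sqr_ge0 // mulr_ge0 ?sqr_ge0.
  apply: (@le_trans _ _ (2 / gapc ^+ 2 * (x ^+ 2 + v * y ^+ 2) * (gapc ^+ 2 * N4))); last exact: ler_wpM2l.
  have -> : 2 / gapc ^+ 2 * (x ^+ 2 + v * y ^+ 2) * (gapc ^+ 2 * N4) = 2 * (N4 * x ^+ 2) + 2 * ((N4 * v) * y ^+ 2).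
    by field; rewrite gt_eqF.
  rewrite V mul1r; have h1 := ler_wpM2r (sqr_ge0 x) s2.
  have h2 : (sig n * x - y) ^+ 2 <= 2 * (sig n ^+ 2 * x ^+ 2) + 2 * y ^+ 2.
    by rewrite -(exprMn 2 (sig n) x); have := sqr_ge0 (sig n * x + y); nra.
  lra.
have := sq2 x; have := sq2 q.
have : 0 <= v * y ^+ 2 by rewrite mulr_ge0 ?sqr_ge0.
lra.
Qed.

Context (W0 W1 : R)
  (h0 : forall N, \sum_(n < N) wt 0 n * w0 n ^+ 2 <= W0 ^+ 2)
  (h1 : forall N, \sum_(n < N) wt (- 2) n * w1 n ^+ 2 <= W1 ^+ 2).

Definition trace_sum N t : R := \sum_(n < N) psi n * adj n t.

Lemma trace_sum_cont N : continuous (trace_sum N).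
Proof. by apply: cont_sum => n; apply: contM; [exact: cst_continuous|exact: adj_cont]. Qed.

Lemma coef_sum N : \sum_(k < N) (acoef k.+1 ^+ 2 + bcoef k.+1 ^+ 2) <=
  (1 + 2 / gapc ^+ 2) * (W0 ^+ 2 + W1 ^+ 2).
Proof.
have g0 := gapc_gt0 hrho.
apply: (@le_trans _ _ (\sum_(k < N) (1 + 2 / gapc ^+ 2) * (wt 0 k.+1 * w0 k.+1 ^+ 2 + wt (- 2) k.+1 * w1 k.+1 ^+ 2))).
  by apply: ler_sum => k _; exact: coef_le.
rewrite -mulr_sumr big_split /=; apply: ler_wpM2l.
  by rewrite addr_ge0 // divr_ge0 // sqr_ge0.
by apply: lerD; exact: wt_sum_succ.
Qed.

Lemma trace_sum_diff m n : 0 < tau -> (n <= m)%N ->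
  Iab 0 tau (fun x => (trace_sum m.+1 x - trace_sum n.+1 x) ^+ 2) <=
  2 * dirc tau * \sum_(n <= k < m) (acoef k.+1 ^+ 2 + bcoef k.+1 ^+ 2).
Proof.
move=> t0 nm.
(* The indicator extends the block n <= k < m by zeros down to k = 0, the form required by the
   direct inequality. *)
pose a k := (n <= k)%N%:R * acoef k.+1; pose b k := (n <= k)%N%:R * bcoef k.+1.
pose A t := \sum_(k < m) a k * ec k.+1 (-1 * t + tau).
pose B t := \sum_(k < m) b k * es k.+1 (-1 * t + tau).
have E t : trace_sum m.+1 t - trace_sum n.+1 t = A t + B t.
  rewrite /trace_sum -!(big_mkord xpredT (fun n => psi n * adj n t)) (big_cat_nat (n := n.+1)) //= addrAC subrr add0r.
  rewrite big_add1 /= /A /B -big_split /=.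
  rewrite -(big_mkord xpredT (fun k => a k * ec k.+1 (-1 * t + tau) + b k * es k.+1 (-1 * t + tau))).
  rewrite [RHS](big_cat_nat (n := n)) //= [X in _ = X + _]big_nat [X in _ = X + _]big1 ?add0r.
    apply: eq_big_nat => k /andP[nk _]; rewrite adj_coef // /a /b nk !mul1r.
    by rewrite mulN1r [- t + tau]addrC.
  by move=> k /andP[_ kn]; rewrite /a /b leqNgt kn !mul0r addr0.
have k1 : (-1 : R) ^+ 2 = 1 by rewrite sqrrN expr1n.
have x0 r : 0 <= r <= tau -> 0 <= -1 * r + tau by case/andP => *; lra.
have hA := direct_ec halpha hrho m a (ltW t0) k1 x0.
have hB := direct_es halpha hrho m b (ltW t0) k1 x0.
have cA : continuous A.
  by apply: cont_sum => k; apply: contM; [exact: cst_continuous|apply: affine_cont; exact: ec_cont].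
have cB : continuous B.
  by apply: cont_sum => k; apply: contM; [exact: cst_continuous|apply: affine_cont; exact: es_cont].
rewrite subr0 in hA hB.
apply: (@le_trans _ _ (2 * Iab 0 tau (fun x => A x ^+ 2) + 2 * Iab 0 tau (fun x => B x ^+ 2))).
  under eq_fun do rewrite E.
  by apply: Iab_sqrD_le; exact: sqint_cont.
have sm (c : nat -> R) : \sum_(k < m) ((n <= k)%N%:R * c k) ^+ 2 = \sum_(n <= k < m) c k ^+ 2.
  rewrite -(big_mkord xpredT (fun k => ((n <= k)%N%:R * c k) ^+ 2)) (big_cat_nat (n := n)) //=.
  rewrite big_nat big1 ?add0r.
    by apply: eq_big_nat => k /andP[nk _]; rewrite nk mul1r.
  by move=> k /andP[_ kn]; rewrite leqNgt kn mul0r expr0n.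
rewrite big_split /= mulrDr -!mulrA -mulrDr.
rewrite (sm (fun k => acoef k.+1)) in hA; rewrite (sm (fun k => bcoef k.+1)) in hB.
by rewrite [leRHS]mulrDr; apply: lerD; apply: ler_wpM2l.
Qed.

Lemma trace_sum_cauchy e : 0 < tau -> 0 < e -> exists M, forall m n, (M <= m)%N -> (M <= n)%N ->
  Iab 0 tau (fun x => (trace_sum m x - trace_sum n x) ^+ 2) <= e.
Proof.
move=> t0 e0; have D0 : 0 <= dirc tau by apply: (dirc_ge0 hrho); exact: ltW.
have e1 : 0 < e / (2 * (dirc tau + 1)) by rewrite divr_gt0 // mulr_gt0 // ltr_wpDl.
have c0 k : 0 <= acoef k.+1 ^+ 2 + bcoef k.+1 ^+ 2 by rewrite addr_ge0 ?sqr_ge0.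
have [M hM] := bounded_tail c0 coef_sum e1.
have main m n : (M <= n)%N -> (n <= m)%N ->
    Iab 0 tau (fun x => (trace_sum m.+1 x - trace_sum n.+1 x) ^+ 2) <= e.
  move=> Mn nm; apply: (le_trans (trace_sum_diff t0 nm)).
  apply: (@le_trans _ _ (2 * dirc tau * (e / (2 * (dirc tau + 1))))).
    apply: ler_wpM2l; first exact: mulr_ge0.
    apply: le_trans (hM m); rewrite [leRHS](big_cat_nat (n := n)) //=.
    by rewrite lerDr sumr_ge0.
  have -> : 2 * dirc tau * (e / (2 * (dirc tau + 1))) = e - e / (dirc tau + 1).
    by field; rewrite gt_eqF // ltr_wpDl.
  by rewrite gerBl divr_ge0 ?ltW // ltr_wpDl.
exists M.+1; case=> // m [] // n; rewrite !ltnS => Mm Mn.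
have [nm|/ltnW mn] := leqP n m; first exact: main.
have -> : Iab 0 tau (fun x => (trace_sum m.+1 x - trace_sum n.+1 x) ^+ 2) = Iab 0 tau (fun x => (trace_sum n.+1 x - trace_sum m.+1 x) ^+ 2).
  by apply: Iab_eq => x _; ring.
exact: main.
Qed.

Lemma trace_diffE (w : R -> nat -> R) z N : (forall n t, 0 <= t <= tau -> w t n = adj n t) ->
  sqint 0 tau z ->
  L2norm tau (fun t => z t - \sum_(0 <= n < N) phiN n pi * w t n) =
  (norm2 0 tau (fun t => z t - trace_sum N t))%:E.
Proof.
move=> hw sz.
have E t : 0 < t < tau -> z t - trace_sum N t = z t - \sum_(0 <= n < N) phiN n pi * w t n.
  move=> /andP[t1 t2]; rewrite big_mkord; congr (_ - _); apply: eq_bigr => n _.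
  by rewrite hw // !ltW.
have s1 : sqint 0 tau (fun t => z t - trace_sum N t).
  by apply: sqintB => //; apply: sqint_cont; exact: trace_sum_cont.
rewrite sqint_inL2; last exact: sqint_eq E s1.
by rewrite /norm2; congr (Num.sqrt _)%:E; apply: Iab_eq => t /E ->.
Qed.

Lemma trace_exists (w : R -> nat -> R) : 0 < tau -> (forall n t, 0 <= t <= tau -> w t n = adj n t) ->
  exists z, is_trace tau w z.
Proof.
move=> t0 hw.
have sZ N : sqint 0 tau (trace_sum N) by apply: sqint_cont; exact: trace_sum_cont.
have [z sz hz] := sqint_complete sZ (fun e => trace_sum_cauchy (e := e) t0).
exists z; split; first exact/inL2P.
under eq_fun do rewrite trace_diffE //.
apply/fine_cvgP; split; first by near=> N.
apply/cvgrPdist_le => e e0; have [N0 hN] := hz _ (exprn_gt0 2 e0).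
near=> N; rewrite /= sub0r normrN ger0_norm ?norm2_ge0 //.
rewrite -ler_sqr ?nnegrE ?norm2_ge0 ?(ltW e0) // norm2_sq.
have -> : Iab 0 tau (fun x => (z x - trace_sum N x) ^+ 2) = Iab 0 tau (fun x => (trace_sum N x - z x) ^+ 2).
  by apply: Iab_eq => x _; ring.
by apply: hN; near: N; exact: nbhs_infty_ge.
Unshelve. all: by end_near. Qed.

End Data.

(** Stated for an arbitrary trace z, since the one supplied by a given weak solution is not the one
    built in [trace_exists]. *)
Lemma trace_lim tau w0 w1 (w : R -> nat -> R) z g : sqint 0 tau g ->
  (forall n t, 0 <= t <= tau -> w t n = adj tau w0 w1 n t) -> is_trace tau w z ->
  Iab 0 tau (fun t => trace_sum tau w0 w1 N t * g t) @[N --> \oo] --> Iab 0 tau (fun t => z t * g t).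
Proof.
move=> sg hw [/inL2P sz]; under eq_fun do rewrite (trace_diffE _ hw sz).
move=> /fine_cvgP[_ /cvgrPdist_le hz].
apply/cvgrPdist_le => e e0.
have G0 : 0 < norm2 0 tau g + 1 by rewrite ltr_wpDl ?norm2_ge0.
apply: filterS (hz _ (divr_gt0 e0 G0)) => N /=.
rewrite sub0r normrN (ger0_norm (norm2_ge0 _ _ _)) => hN.
have sZ : sqint 0 tau (trace_sum tau w0 w1 N) by apply: sqint_cont; exact: trace_sum_cont.
rewrite -IabB; [|exact: sqint_prod..].
have -> : Iab 0 tau (fun x => z x * g x - trace_sum tau w0 w1 N x * g x) = Iab 0 tau (fun x => (z x - trace_sum tau w0 w1 N x) * g x).
  by apply: Iab_eq => x _; ring.
apply: (le_trans (cs_norm2 (sqintB sz sZ) sg)).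
apply: (@le_trans _ _ (e / (norm2 0 tau g + 1) * (norm2 0 tau g + 1))); last by rewrite divfK // gt_eqF.
by apply: ler_pM; rewrite ?norm2_ge0 // lerDl.
Qed.

End Adjoint.

(** * The weak formulation *)

Section WeakForm.
Context {R : realType}.
Implicit Types (s t x y h e d p : R) (n m k N K M : nat) (a b : nat -> R).

Lemma sum_le a b N : (forall n, a n <= b n) -> \sum_(n < N) a n <= \sum_(n < N) b n.
Proof. by move=> h; apply: ler_sum => n _; exact: h. Qed.

(** The pairing is defined through [limn], so it can be handled as a limit only once its series is
    known to converge. *)
Lemma pairing_cvg p a b (A B : R) : (forall N, \sum_(n < N) wt p n * a n ^+ 2 <= A) ->
  (forall N, \sum_(n < N) wt (- p) n * b n ^+ 2 <= B) -> cvgn (series (fun n => a n * b n)).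
Proof.
move=> hA hB; apply: normed_cvg.
apply: nondecreasing_is_cvgn; first by apply: nondecreasing_series => n _ _; exact: normr_ge0.
exists (A + B) => _ [N _ <-].
rewrite -[X in X <= _]/(\sum_(0 <= k < N) `|a k * b k|) big_mkord.
apply: (@le_trans _ _ (\sum_(n < N) (wt p n * a n ^+ 2 + wt (- p) n * b n ^+ 2))).
  apply: ler_sum => n _; have V := wtV p n.
  have p0 := wt_ge0 p n; have q0 := wt_ge0 (- p) n.
  set P := wt p n in V p0 *; set Q := wt (- p) n in V q0 *.
  have X0 : 0 <= P * a n ^+ 2 by rewrite mulr_ge0 ?sqr_ge0.
  have Y0 : 0 <= Q * b n ^+ 2 by rewrite mulr_ge0 ?sqr_ge0.
  rewrite -ler_sqr ?nnegrE ?addr_ge0 // real_normK ?num_real //.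
  have -> : (a n * b n) ^+ 2 = (P * a n ^+ 2) * (Q * b n ^+ 2).
    by rewrite mulrACA V mul1r exprMn.
  by move: (P * _) (Q * _) X0 Y0 => X Y X0 Y0; nra.
by rewrite big_split /=; apply: lerD; [exact: hA|exact: hB].
Qed.

Lemma series_cvg_single a m : (forall n, n != m -> a n = 0) -> series a N @[N --> \oo] --> a m.
Proof.
move=> h; apply: cvg_near_cst; near=> N.
have mN : (m < N)%N by near: N; exact: nbhs_infty_gt.
rewrite /series /= big_mkord (bigD1 (Ordinal mN)) //= big1 ?addr0 // => i.
by rewrite -val_eqE /= => /h.
Unshelve. all: by end_near. Qed.

Lemma pairing_single a b m : (forall n, n != m -> a n * b n = 0) -> pairing a b = a m * b m.
Proof. by move=> h; apply: cvg_lim => //; exact: series_cvg_single. Qed.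

Context (alpha rho : R).
Context (halpha : 0 <= alpha < 1) (hrho : 0 < rho < 2).
Local Notation sig := (damp alpha rho).
Local Notation om := (om alpha rho).
Local Notation SS := (Smode alpha rho).
Local Notation CC := (Cmode alpha rho).
Local Notation DS := (dSmode alpha rho).
Local Notation gapc := (gapc rho).

(** In contrast to [mode_bounds], the bound is uniform in n; it keeps the adjoint state at time 0 in
    X_N^0 x X_N^(-2). *)
Lemma modes_unif T : 0 < T -> exists2 B : R, 0 <= B & forall n t, 0 <= t <= T ->
  CC n t ^+ 2 <= B /\ wt 2 n * SS n t ^+ 2 <= B.
Proof.
move=> T0; have [P P1 hP] := mode_bounds halpha hrho T0 0%N.
have g0 := gapc_gt0 hrho.
have i0 : 0 <= 2 / gapc ^+ 2 by rewrite divr_ge0 ?sqr_ge0.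
exists (2 + 2 / gapc ^+ 2 + P ^+ 2); first by rewrite !addr_ge0 ?sqr_ge0.
move=> n t tI; have [->|n0] := posnP n.
  have [_ h _ _ _] := hP t tI.
  have h2 : SS 0 t ^+ 2 <= P ^+ 2.
    by rewrite -real_normK ?num_real // ler_sqr ?nnegrE // (le_trans _ P1).
  rewrite wt2E eqxx /Cmode eqxx mul1r expr1n; have := sqr_ge0 P; split; lra.
have /andP[t0 _] := tI.
have w0 := om_gt0 halpha hrho n0.
have he := ec_le1 alpha hrho n t0.
have w2 := om_sqr_ge halpha hrho n0; have s2 := sig_sqr_le halpha hrho n0.
set N4 : R := n%:R ^+ 4 in w2 s2 *; have N40 : 0 <= N4 by exact: exprn_ge0.
have r1 : N4 / om n ^+ 2 <= 1 / gapc ^+ 2.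
  rewrite ler_pdivrMr ?exprn_gt0 // mulrAC ler_pdivlMr ?exprn_gt0 // mul1r; lra.
have r2 : sig n ^+ 2 / om n ^+ 2 <= 1 / gapc ^+ 2.
  by apply: le_trans r1; rewrite ler_pM2r ?invr_gt0 ?exprn_gt0.
rewrite wt2E gtn_eqF // -/N4 /Cmode /Smode gtn_eqF //.
set c := dampcos alpha rho n t in he *; set e := dampsin alpha rho n t in he *.
have c1 : c ^+ 2 <= 1 by have := sqr_ge0 e; lra.
have e1 : e ^+ 2 <= 1 by have := sqr_ge0 c; lra.
have P0 := sqr_ge0 P.
split.
  have h : (c + sig n / om n * e) ^+ 2 <= 2 * c ^+ 2 + 2 * (sig n ^+ 2 / om n ^+ 2 * e ^+ 2).
    rewrite -(expr_div_n (sig n)) -(exprMn 2 (sig n / om n)).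
    by have := sqr_ge0 (c - sig n / om n * e); nra.
  have : sig n ^+ 2 / om n ^+ 2 * e ^+ 2 <= 1 / gapc ^+ 2.
    by apply: le_trans r2; rewrite ler_piMr // divr_ge0 ?sqr_ge0.
  by move: (sig n ^+ 2 / om n ^+ 2 * e ^+ 2) h i0 => X; lra.
have : N4 * (e / om n) ^+ 2 <= 1 / gapc ^+ 2.
  rewrite expr_div_n mulrCA mulrC; apply: le_trans r1; rewrite ler_piMr // divr_ge0 ?sqr_ge0 //.
by move: (N4 * _) i0 => X; lra.
Qed.

Context (T : R) (hT : 0 < T) (g : R -> R) (hg : sqint 0 T g).

Section Mode.
Context (u0 u1 : nat -> R).
Local Notation uu := (duhamel alpha rho g u0 u1).
Local Notation vv := (duhamel_dt alpha rho g u0 u1).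

(** The weak formulation in a single mode. Both solutions are explicit, so it is an algebraic
    identity between the same two integrals of g. *)
Lemma mode_identity tau (w0 w1 : nat -> R) n : 0 < tau <= T ->
  (w1 n - 2 * sig n * w0 n) * uu n tau - w0 n * vv n tau
  - (adj_dt alpha rho tau w0 w1 n 0 - 2 * sig n * adj alpha rho tau w0 w1 n 0) * u0 n
  + adj alpha rho tau w0 w1 n 0 * u1 n
  = Iab 0 tau (fun t => psi n * adj alpha rho tau w0 w1 n t * g t).
Proof.
move=> /andP[t0 tT].
have cS := SS_cont halpha hrho (n := n); have cD := DS_cont halpha hrho (n := n).
have i1 : iab 0 tau (fun r => SS n (tau - r) * g r) by apply: (iab_kernel hg).
have i2 : iab 0 tau (fun r => DS n (tau - r) * g r) by apply: (iab_kernel hg).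
have -> : Iab 0 tau (fun t => psi n * adj alpha rho tau w0 w1 n t * g t) =
   (psi n * w0 n) * Iab 0 tau (fun r => DS n (tau - r) * g r) +
   (psi n * (2 * sig n * w0 n - w1 n)) * Iab 0 tau (fun r => SS n (tau - r) * g r).
  rewrite -!IabZ // -IabD; try exact: iabZ.
  by apply: Iab_eq => r _; rewrite /adj /dSmode; ring.
rewrite /duhamel /duhamel_dt /adj /adj_dt subr0.
move: (Iab 0 tau _) (Iab 0 tau _) => X Y; rewrite /dSmode; ring.
Qed.

Context (M0 M1 : R)
  (h0 : forall N, \sum_(n < N) wt 2 n * u0 n ^+ 2 <= M0 ^+ 2)
  (h1 : forall N, \sum_(n < N) wt 0 n * u1 n ^+ 2 <= M1 ^+ 2).

(** Summing [mode_identity] over n < N equates the partial sums of the four pairings with the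
    integral of g against the partial sum of the trace; each of these converges. *)
Lemma weak_identity tau (w0 w1 : nat -> R) (w dw : R -> nat -> R) z :
  0 < tau <= T -> inX 0 w0 -> inX (- 2) w1 ->
  adjoint_solution alpha rho tau w0 w1 w dw -> is_trace tau w z ->
  0 = pairing (fun n => w1 n - rho * AN alpha w0 n) (fun n => uu n tau)
      - pairing w0 (fun n => vv n tau)
      - pairing (fun n => dw 0 n - rho * AN alpha (w 0) n) u0
      + pairing (w 0) u1
      - \int[lebesgue_measure]_(t in `]0, tau[) (z t * g t).
Proof.
move=> tI hw0 hw1 hw hz.
have /andP[t0 tT] := tI.
have [W0 W00 [_ H0]] := inX_bound hw0; have [W1 W10 [_ H1]] := inX_bound hw1.
have wE n t : 0 <= t <= tau -> w t n = adj alpha rho tau w0 w1 n t.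
  by move=> h; have [] := adjoint_unique halpha hrho hw n h.
have sg : sqint 0 tau g by apply: sqintS hg.
have z0 : (0 : R) <= 0 <= tau by rewrite lexx ltW.
have tTI : 0 <= tau <= T by rewrite ltW.
have L := trace_lim halpha hrho sg wE hz.
have [B B0 hB] := modes_unif hT.
have [Bu Bu0 hBu] := Xenergy_sum halpha hrho hT hg h0 h1 tTI.
pose a1 n := w1 n - 2 * sig n * w0 n.
pose a3 n := adj_dt alpha rho tau w0 w1 n 0 - 2 * sig n * adj alpha rho tau w0 w1 n 0.
pose a4 n := adj alpha rho tau w0 w1 n 0.
have E1 : (fun n => w1 n - rho * AN alpha w0 n) = a1.
  by apply/funext => n; rewrite /AN mulrA damp2.
have E3 : (fun n => dw 0 n - rho * AN alpha (w 0) n) = a3.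
  apply/funext => n; rewrite /AN mulrA damp2 wE //.
  by have [_ ->] := adjoint_unique halpha hrho hw n z0.
have E4 : w 0 = a4 by apply/funext => n; rewrite wE.
(* As sigma_n is at most n^2 for n >= 1 and at most 1 for n = 0, the damping operator maps X_N^0
   into X_N^(-2). *)
have sw n : wt (- 2) n * sig n ^+ 2 <= 1.
  have V := wtV (2 : R) n; rewrite wt2E in V; have s0 := sig_ge0 alpha hrho n.
  have [n0|n0] := eqVneq n 0%N.
    by rewrite n0 /wt eqxx mul1r expr_le1 // ?sig0_le1 // sig_ge0.
  rewrite (negPf n0) in V; apply: (@le_trans _ _ (n%:R ^+ 4 * wt (- 2) n)); last by rewrite V.
  rewrite mulrC; apply: ler_wpM2r; first exact: wt_ge0.
  by apply: sig_sqr_le; rewrite ?lt0n.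
have a1w n : wt (- 2) n * a1 n ^+ 2 <= 2 * (wt (- 2) n * w1 n ^+ 2) + 8 * (wt 0 n * w0 n ^+ 2).
  have v0 := wt_ge0 (- 2 : R) n; have hs := sw n; rewrite wt0E mul1r.
  have h : a1 n ^+ 2 <= 2 * w1 n ^+ 2 + 8 * (sig n ^+ 2 * w0 n ^+ 2).
    by rewrite /a1 -(exprMn 2 (sig n)); have := sqr_ge0 (w1 n + 2 * (sig n * w0 n)); nra.
  have := ler_wpM2l v0 h; have := ler_wpM2r (sqr_ge0 (w0 n)) hs; lra.
have S1 N : \sum_(n < N) wt (- 2) n * a1 n ^+ 2 <= 2 * W1 ^+ 2 + 8 * W0 ^+ 2.
  apply: (le_trans (sum_le N a1w)); rewrite big_split /= -!mulr_sumr.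
  by apply: lerD; apply: ler_wpM2l => //; [exact: H1|exact: H0].
have S3 N : \sum_(n < N) wt (- 2) n * a3 n ^+ 2 <= 2 * B * (2 * W1 ^+ 2 + 8 * W0 ^+ 2) + 2 * B * W0 ^+ 2.
  have a3w n : wt (- 2) n * a3 n ^+ 2 <= 2 * B * (wt (- 2) n * a1 n ^+ 2) + 2 * B * (wt 0 n * w0 n ^+ 2).
    have v0 := wt_ge0 (- 2 : R) n; have [bC bS] := hB n tau tTI; rewrite wt0E mul1r.
    have -> : a3 n = a1 n * CC n tau + w0 n * (n%:R ^+ 4 * SS n tau).
      by rewrite /a3 /a1 /adj_dt /adj subr0 /dSmode; ring.
    have hn : wt (- 2) n * (n%:R ^+ 4 * SS n tau) ^+ 2 <= B.
      have V := wtV (2 : R) n; rewrite wt2E in V bS; have [n0|n0] := eqVneq n 0%N.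
        by rewrite n0 expr0n /= mul0r expr0n mulr0.
      rewrite (negPf n0) in V bS.
      have -> : wt (- 2) n * (n%:R ^+ 4 * SS n tau) ^+ 2 = (n%:R ^+ 4 * wt (- 2) n) * (n%:R ^+ 4 * SS n tau ^+ 2) by ring.
      by rewrite V mul1r.
    set Y := n%:R ^+ 4 * SS n tau in hn *; set X := CC n tau in bC *.
    have h : (a1 n * X + w0 n * Y) ^+ 2 <= 2 * (a1 n ^+ 2 * X ^+ 2) + 2 * (w0 n ^+ 2 * Y ^+ 2).
      by rewrite -!exprMn; have := sqr_ge0 (a1 n * X - w0 n * Y); nra.
    have k1 : wt (- 2) n * a1 n ^+ 2 * X ^+ 2 <= wt (- 2) n * a1 n ^+ 2 * B.
      by apply: ler_wpM2l => //; rewrite mulr_ge0 ?sqr_ge0.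
    have k2 := ler_wpM2l (sqr_ge0 (w0 n)) hn.
    have := ler_wpM2l v0 h; lra.
  apply: (le_trans (sum_le N a3w)); rewrite big_split /= -!mulr_sumr.
  by apply: lerD; apply: ler_wpM2l; rewrite ?mulr_ge0 //; [exact: S1|exact: H0].
have S4 N : \sum_(n < N) wt 0 n * a4 n ^+ 2 <= 2 * B * W0 ^+ 2 + 2 * B * W1 ^+ 2.
  have a4w n : wt 0 n * a4 n ^+ 2 <= 2 * B * (wt 0 n * w0 n ^+ 2) + 2 * B * (wt (- 2) n * w1 n ^+ 2).
    have v0 := wt_ge0 (- 2 : R) n; have [bC bS] := hB n tau tTI; rewrite wt0E !mul1r /a4 /adj subr0.
    have V := wtV (2 : R) n.
    set Y := SS n tau in bS *; set X := CC n tau in bC *.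
    have h : (w0 n * X - w1 n * Y) ^+ 2 <= 2 * (w0 n ^+ 2 * X ^+ 2) + 2 * (w1 n ^+ 2 * Y ^+ 2).
      by rewrite -!exprMn; have := sqr_ge0 (w0 n * X + w1 n * Y); nra.
    have k1 := ler_wpM2l (sqr_ge0 (w0 n)) bC.
    have k2 : (wt (- 2) n * w1 n ^+ 2) * (wt 2 n * Y ^+ 2) <= (wt (- 2) n * w1 n ^+ 2) * B.
      by apply: ler_wpM2l => //; rewrite mulr_ge0 ?sqr_ge0.
    have k3 : (wt (- 2) n * w1 n ^+ 2) * (wt 2 n * Y ^+ 2) = w1 n ^+ 2 * Y ^+ 2.
      by transitivity ((wt 2 n * wt (- 2) n) * (w1 n ^+ 2 * Y ^+ 2)); [ring|rewrite V mul1r].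
    lra.
  apply: (le_trans (sum_le N a4w)); rewrite big_split /= -!mulr_sumr.
  by apply: lerD; apply: ler_wpM2l; rewrite ?mulr_ge0 //; [exact: H0|exact: H1].
have Suu N : \sum_(n < N) wt (- - 2) n * uu n tau ^+ 2 <= Bu ^+ 2.
  by rewrite opprK; apply: le_trans (hBu N); apply: ler_sum => n _; rewrite lerDl sqr_ge0.
have Svv N : \sum_(n < N) wt (- 0) n * vv n tau ^+ 2 <= Bu ^+ 2.
  rewrite oppr0; apply: le_trans (hBu N); apply: ler_sum => n _.
  by rewrite wt0E mul1r lerDr mulr_ge0 ?wt_ge0 ?sqr_ge0.
have h0' N : \sum_(n < N) wt (- - 2) n * u0 n ^+ 2 <= M0 ^+ 2 by rewrite opprK.
have h1' N : \sum_(n < N) wt (- 0) n * u1 n ^+ 2 <= M1 ^+ 2 by rewrite oppr0.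
have c1 := pairing_cvg (b := fun n => uu n tau) S1 Suu; have c2 := pairing_cvg (b := fun n => vv n tau) H0 Svv.
have c3 := pairing_cvg S3 h0'; have c4 := pairing_cvg S4 h1'.
rewrite E1 E3 E4.
have Lim : series (fun n => a1 n * uu n tau) N - series (fun n => w0 n * vv n tau) N
   - series (fun n => a3 n * u0 n) N + series (fun n => a4 n * u1 n) N @[N --> \oo] -->
   pairing a1 (fun n => uu n tau) - pairing w0 (fun n => vv n tau) - pairing a3 u0 + pairing a4 u1.
  exact: (cvgD (cvgB (cvgB c1 c2) c3) c4).
have EN : (fun N => series (fun n => a1 n * uu n tau) N - series (fun n => w0 n * vv n tau) N
   - series (fun n => a3 n * u0 n) N + series (fun n => a4 n * u1 n) N) =
   (fun N => Iab 0 tau (fun t => trace_sum alpha rho tau w0 w1 N t * g t)).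
  apply/funext => N; rewrite /series /= !big_mkord -!sumrB -big_split /=.
  transitivity (\sum_(n < N) Iab 0 tau (fun t => psi n * adj alpha rho tau w0 w1 n t * g t)).
    by apply: eq_bigr => n _; rewrite -mode_identity.
  rewrite -Iab_sum; first by apply: Iab_eq => t _; rewrite /trace_sum mulr_suml.
  move=> n; apply: sqint_prod sg; apply: sqint_cont; apply: contM; first exact: cst_continuous.
  exact: adj_cont.
rewrite EN in Lim.
have -> : \int[lebesgue_measure]_(t in `]0, tau[) (z t * g t) = Iab 0 tau (fun t => z t * g t) by [].
by rewrite (cvg_unique _ Lim L) // subrr.
Qed.

Lemma weak_solution_exists : weak_solution T alpha rho u0 u1 g (fun t n => uu n t) (fun t n => vv n t).
Proof.
split.
- exact: (evolution_cont2 halpha hrho hT hg h0 h1).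
- exact: (evolution_cont0 halpha hrho hT hg h0 h1).
- exact: (evolution_derive halpha hrho hT hg h0 h1).
- by split; apply/funext => n; rewrite ?duhamel0 ?duhamel_dt0.
move=> tau tI w0 w1 hw0 hw1 w dw hw.
have /andP[t0 tT] := tI.
have [W0 W00 [_ H0]] := inX_bound hw0; have [W1 W10 [_ H1]] := inX_bound hw1.
have wE n t : 0 <= t <= tau -> w t n = adj alpha rho tau w0 w1 n t.
  by move=> h; have [] := adjoint_unique halpha hrho hw n h.
have [z hz] := trace_exists halpha hrho H0 H1 t0 wE.
by exists z => //; apply: weak_identity hz.
Qed.

End Mode.

Definition single m (c : R) n : R := if n == m then c else 0.

Lemma single_inX p m (c : R) : inX p (single m c).
Proof.
apply: (@inXI _ _ _ (Num.sqrt (wt p m * c ^+ 2))); first exact: sqrtr_ge0.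
have X0 : 0 <= wt p m * c ^+ 2 by rewrite mulr_ge0 ?wt_ge0 // sqr_ge0.
move=> N; rewrite sqr_sqrtr //.
have [mN|Nm] := ltnP m N; last first.
  rewrite big1 // => i _.
  by rewrite /single ltn_eqF ?expr0n ?mulr0 // (leq_trans _ Nm).
rewrite (bigD1 (Ordinal mN)) //= big1 ?addr0 => [|i]; first by rewrite /single eqxx.
by rewrite -val_eqE /= => /negPf im; rewrite /single im expr0n mulr0.
Qed.

(** In the formulation at time T, tested with data (c, d) in mode m alone, the moment identity
    cancels the terms at time 0 against the control. What remains at time T vanishes for all c and
    d; (0, 1) gives u and then (1, 0) gives its derivative. *)
Lemma weak_solution_null (u0 u1 : nat -> R) u ut : moments alpha rho T g u0 u1 ->
  weak_solution T alpha rho u0 u1 g u ut -> forall m, u T m = 0 /\ ut T m = 0.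
Proof.
move=> hm [_ _ _ _ hw] m.
have key (c d : R) : (d - 2 * sig m * c) * u T m - c * ut T m = 0.
  have TT : 0 < T <= T by rewrite hT lexx.
  pose W := adj alpha rho T (single m c) (single m d).
  pose dW := adj_dt alpha rho T (single m c) (single m d).
  have W0 n t : n != m -> W n t = 0.
    by move=> /negPf nm; rewrite /W /adj /single nm !mul0r subrr.
  have dW0 n t : n != m -> dW n t = 0.
    by move=> /negPf nm; rewrite /dW /adj_dt /single nm !mul0r addr0.
  have ad := adjoint_exists halpha hrho T (single m c) (single m d).
  have [z hz] := hw T TT _ _ (single_inX 0 m c) (single_inX (- 2) m d) _ _ ad.
  have L := @trace_lim _ alpha rho halpha hrho T _ _ (fun t n => W n t) z g hg (fun _ _ _ => erefl) hz.
  have Z : (fun N => Iab 0 T (fun t => trace_sum alpha rho T (single m c) (single m d) N t * g t)) @ \oo -->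
      psi m * Iab 0 T (fun t => g t * W m t).
    apply: cvg_near_cst; near=> N.
    have mN : (m < N)%N by near: N; exact: nbhs_infty_gt.
    rewrite -IabZ; last by apply: sqint_prod => //; apply: sqint_cont; exact: adj_cont.
    apply: Iab_eq => t _; rewrite /trace_sum (bigD1 (Ordinal mN)) //= big1 ?addr0; first by rewrite -/(W m t); ring.
    by move=> i; rewrite -val_eqE /= => im; rewrite -/(W i t) W0 ?mulr0.
  have E : Iab 0 T (fun t => z t * g t) = psi m * Iab 0 T (fun t => g t * W m t).
    by rewrite (cvg_unique _ L Z).
  rewrite !(@pairing_single _ _ m); first last.
  - by move=> n nm; rewrite /AN /single (negPf nm) !mulr0 subr0 mul0r.
  - by move=> n nm; rewrite /single (negPf nm) mul0r.
  - by move=> n nm; rewrite /AN -/(dW n 0) -/(W n 0) dW0 ?W0 // !mulr0 subr0 mul0r.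
  - by move=> n nm; rewrite -/(W n 0) W0 ?mul0r.
  have -> : \int[lebesgue_measure]_(t in `]0, T[) (z t * g t) = Iab 0 T (fun t => z t * g t) by [].
  rewrite E /AN.
  (* The moment identity is used with the adjoint solution expanded at time 0, p and q being its
     value and minus its derivative there. *)
  have M := hm m (W m 0) (- dW m 0).
  have WE t : W m t = W m 0 * CC m (- t) + (- dW m 0) * SS m (- t).
    rewrite /W /dW /adj /adj_dt /single eqxx subr0.
    rewrite CCD // SSD // /dSmode; ring.
  rewrite (_ : Iab 0 T (fun t => g t * W m t) =
     Iab 0 T (fun t => g t * (W m 0 * CC m (- t) + (- dW m 0) * SS m (- t)))); last first.
    by apply: Iab_eq => t _; rewrite -WE.
  rewrite M -/(W m 0) -/(dW m 0) /single eqxx !(mulrA rho) !damp2.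
  move: (W m 0) (dW m 0) (sig m) => x y s; lra.
have U : u T m = 0 by have := key 0 1; rewrite mulr0 subr0 mul1r mul0r subr0.
by split=> //; have := key 1 0; rewrite U mulr0 mul1r sub0r => /eqP; rewrite oppr_eq0 => /eqP.
Unshelve. all: by end_near. Qed.

End WeakForm.

(** C is chosen before the data, which expresses that it depends on alpha, rho and T alone. The
    final conditions are claimed for every weak solution, and the existence clause ensures that this
    claim is not vacuous. *)
Theorem theorem10 (R : realType) (T alpha rho : R)
    (hT : 0 < T) (halpha : 0 <= alpha < 1) (hrho : 0 < rho < 2) :
  exists C : R,
    forall u0 u1 : nat -> R, inX 2 u0 -> inX 0 u1 ->
    exists g : R -> R,
      [/\ inL2 T g,
          exists u ut : R -> nat -> R,
            weak_solution T alpha rho u0 u1 g u ut,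
          forall u ut : R -> nat -> R,
            weak_solution T alpha rho u0 u1 g u ut ->
            (forall n, u T n = 0) /\ (forall n, ut T n = 0)
        & (L2norm T g <= C%:E * (Xnorm 2 u0 + Xnorm 0 u1))%E].
Proof.
have [C C0 hC] := control_exists halpha hrho hT.
exists C => u0 u1 /inX_bound[M0 M00 [E0 h0]] /inX_bound[M1 M10 [E1 h1]].
have [g sg [hm hn]] := hC u0 u1 M0 M1 M00 M10 h0 h1.
exists g; split.
- exact/inL2P.
- by exists (fun t n => duhamel alpha rho g u0 u1 n t), (fun t n => duhamel_dt alpha rho g u0 u1 n t);
    exact: weak_solution_exists h0 h1.
- by move=> u ut /(weak_solution_null halpha hrho hT sg hm) h; split=> n; have [] := h n.
- by rewrite sqint_inL2 // E0 E1 -EFinD -EFinM lee_fin.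
Qed.
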